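(* Let $p>0$ and $\lambda<q\delta$. Let $1\le r,r'\le\infty$ be Young (Hölder) conjugate exponents, and let $\mathcal{A}_{2r}$ be the set of controls $\nu\in\mathcal{A}$ such that $$\sup_{T>0}\frac1T\mathbb{E}\Big[\int_0^T|X^\nu_t|^{2r}dt\Big]<\infty .$$ Let $\hat\nu\in\mathcal{A}_{2r}$ be such that $$\sup_{T>0}\frac1T\mathbb{E}\Big[\int_0^T\big|(X^{\hat\nu}_t)^{\alpha-2}\big|^{r'}dt\Big]<\infty\quad\text{if } r'<\infty,$$ and such that $$\sup_{T>0}\inf\{C\ge0:\ (X^{\hat\nu}_t)^{\alpha-2}\le C\ \text{for } dt\otimes d\mathbb{P}\text{-a.e. }(t,\omega)\in[0,T]\times\Omega\}<\infty\quad\text{if } r'=\infty.$$ (a) Suppose $\hat\nu$ is optimal within the set $\mathcal{A}_{2r}$ for the problem of maximizing $\tilde{\mathsf{J}}(\cdot,p,\lambda)$. Then for every $\nu\in\mathcal{A}_{2r}$, $$\limsup_{T\uparrow\infty}\frac1T\mathbb{E}\Big[\int_0^Tg_x(X^{\hat\nu}_t,p,\lambda)(X^{\hat\nu}_t-X^\nu_t)dt-q(\hat\nu_T-\nu_T)\Big]\ge0.\qquad(\ast)$$ (b) Suppose that either $\hat\nu$ satisfies $(\ast)$ for every $\nu\in\mathcal{A}_{2r}$ and the limit $$\lim_{T\uparrow\infty}\frac1T\mathbb{E}\Big[\int_0^Tg(X^{\hat\nu}_t,p,\lambda)dt-q\hat\nu_T\Big]$$ exists (so that it equals the corresponding $\liminf$),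 or that for every $\nu\in\mathcal{A}_{2r}$ $$\liminf_{T\uparrow\infty}\frac1T\mathbb{E}\Big[\int_0^Tg_x(X^{\hat\nu}_t,p,\lambda)(X^{\hat\nu}_t-X^\nu_t)dt-q(\hat\nu_T-\nu_T)\Big]\ge0.$$ Then $\hat\nu$ is optimal within the set $\mathcal{A}_{2r}$.
   Context: Let $\delta,\sigma,q>0$, $\alpha\in(0,1)$. Let $W$ be an $\mathbb{F}$-Brownian motion on a filtered probability space $(\Omega,\mathcal{F},\mathbb{F}=(\mathcal{F}_t)_{t\ge0^-},\mathbb{P})$ satisfying the usual conditions, and $\xi>0$ an $\mathcal{F}_{0^-}$-measurable random variable independent of $W$. Standing assumption: $2\delta-\sigma^2>0$ and $\xi$ has finite second moment. $\mathcal{A}$ is the set of $\mathbb{F}$-adapted processes $\nu\ge0$ with a.s. nondecreasing right-continuous paths, $\nu_{0^-}=0$ and $\mathbb{E}[\nu_T]<\infty$ for all $T>0$; for $\nu\in\mathcal{A}$, $X^\nu$ solves $dX^\nu_t=-\delta X^\nu_tdt+\sigma X^\nu_tdW_t+d\nu_t$, $X^\nu_{0^-}=\xi$. Define $g(x,p,\lambda)=p\,x^\alpha+\lambda x$ for $x>0$, $g_x=\partial_xg$, and $$\tilde{\mathsf{J}}(\nu,p,\lambda)=\liminf_{T\uparrow\infty}\frac1T\mathbb{E}\Big[\int_0^Tg(X^\nu_t,p,\lambda)dt-q\nu_T\Big].$$ $\hat\nu\in\mathcal{A}_{2r}$ is optimal within $\mathcal{A}_{2r}$ if $\tilde{\mathsf{J}}(\hat\nu,p,\lambda)\ge\tilde{\mathsf{J}}(\nu,p,\lambda)$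 for all $\nu\in\mathcal{A}_{2r}$. When $r=\infty$, the condition defining $\mathcal{A}_{2r}$ is read as $X^\nu$ being $dt\otimes d\mathbb{P}$-essentially bounded on $[0,\infty)\times\Omega$. *)

(* Defs.v *)
From HB Require Import structures.
From mathcomp Require Import all_boot all_order all_algebra.
From mathcomp Require Import all_classical all_reals all_analysis.

Set Implicit Arguments.
Unset Strict Implicit.
Unset Printing Implicit Defensive.

Import Order.TTheory GRing.Theory Num.Theory.
Import numFieldNormedType.Exports.

Local Open Scope classical_set_scope.
Local Open Scope ring_scope.

(* Time runs over {0-} and [0, +oo[.  Processes and filtrations are indexed by
   all of R, but only the times t >= 0 are ever constrained or inspected; the
   data at time 0- are kept apart: the sigma-algebra F0m and the initial state
   xi.  A control satisfies nu_{0-} = 0 by convention, so that nu 0 is the size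
   of its initial jump. *)
Section stochastic_basis.
Context {d : measure_display} {Omega : measurableType d} {R : realType}.
Variable P : probability Omega R.

Definition process := R -> Omega -> R.

Definition measurable_wrt (G : set (set Omega)) (f : Omega -> R) :=
  forall B : set R, measurable B -> G (f @^-1` B).

Record usual_filtration (F0m : set (set Omega)) (F : R -> set (set Omega)) :
    Prop := UsualFiltration {
  uf_sigma0m : sigma_algebra setT F0m ;
  uf_sigma : forall t : R, 0 <= t -> sigma_algebra setT (F t) ;
  uf_sub : forall t : R, 0 <= t -> F t `<=` measurable ;
  uf_incr0m : F0m `<=` F 0 ;
  uf_incr : forall s t : R, 0 <= s -> s <= t -> F s `<=` F t ;
  uf_right_continuous :
    forall t : R, 0 <= t -> \bigcap_(s in [set s | t < s]) F s `<=` F t ;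
  uf_complete : P.-negligible `<=` F0m }.

Definition independent_algebras (G H : set (set Omega)) :=
  forall A B, G A -> H B -> P (A `&` B) = (P A * P B)%E.

Definition generated_by (f : Omega -> R) : set (set Omega) :=
  [set f @^-1` B | B in [set B : set R | measurable B]].

Definition generated_by_process (Y : process) : set (set Omega) :=
  <<s \bigcup_(t in [set t : R | 0 <= t]) generated_by (Y t) >>.

Definition adapted (F : R -> set (set Omega)) (Y : process) :=
  forall t : R, 0 <= t -> measurable_wrt (F t) (Y t).

Definition right_continuous_path (y : R -> R) :=
  forall t : R, 0 <= t -> y s @[s --> t^'+] --> y t.

Definition left_limits_path (y : R -> R) :=
  forall t : R, 0 < t -> cvg (y s @[s --> t^'-]).

Definition continuous_path (y : R -> R) :=
  {within `[0%R, +oo[%classic, continuous y}.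

(* [normal_prob m s] has standard deviation s. *)
Record brownian_motion (F : R -> set (set Omega)) (W : process) : Prop :=
  BrownianMotion {
  bm_adapted : adapted F W ;
  bm_start : {ae P, forall w, W 0 w = 0} ;
  bm_continuous : {ae P, forall w, continuous_path (W ^~ w)} ;
  bm_independent : forall s t : R, 0 <= s -> s < t ->
    independent_algebras (F s) (generated_by (W t \- W s)) ;
  bm_gaussian : forall s t : R, 0 <= s -> s < t ->
    forall B : set R, measurable B ->
      P ((W t \- W s) @^-1` B) = normal_prob 0 (Num.sqrt (t - s)) B }.

End stochastic_basis.

Section ito_integral.
Context {d : measure_display} {Omega : measurableType d} {R : realType}.
Variables (P : probability Omega R) (F : R -> set (set Omega)).
Variable W : @process d Omega R.
Notation process := (@process d Omega R).
Notation mu := (@lebesgue_measure R).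

(* The process with value sp_coef i on ]sp_time i, sp_time i.+1], for
   i < sp_size, and 0 elsewhere. *)
Record simple_process := SimpleProcess {
  sp_size : nat ;
  sp_time : nat -> R ;
  sp_coef : nat -> Omega -> R }.

Definition simple_predictable (H : simple_process) :=
  [/\ 0 <= sp_time H 0,
      forall i, (i < sp_size H)%N -> sp_time H i <= sp_time H i.+1,
      forall i, (i < sp_size H)%N ->
        measurable_wrt (F (sp_time H i)) (sp_coef H i) &
      forall i, (i < sp_size H)%N ->
        exists C : R, forall w, `|sp_coef H i w| <= C].

Definition simple_value (H : simple_process) : process := fun s w =>
  \sum_(i < sp_size H)
    sp_coef H i w * \1_(`]sp_time H i, sp_time H i.+1]%classic) s.

Definition simple_integral (H : simple_process) : process := fun t w =>
  \sum_(i < sp_size H)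
    sp_coef H i w *
      (W (Num.min (sp_time H i.+1) t) w - W (Num.min (sp_time H i) t) w).

Definition cvg_to0_in_probability (Z : nat -> Omega -> \bar R) :=
  forall e : R, 0 < e ->
    P [set w | (e%:E <= `|Z n w|)%E] @[n --> \oo] --> 0%E.

Definition approximates (Hn : nat -> simple_process) (H : process) (t : R) :=
  (forall n, simple_predictable (Hn n)) /\
  cvg_to0_in_probability (fun n w =>
    (\int[mu]_(s in `[0%R, t]) ((simple_value (Hn n) s w - H s w) ^+ 2)%:E)%E).

(* I is (a version of) the Ito integral of H with respect to W over [0, t]: the
   common limit in probability of the elementary integrals of the sequences of
   simple predictable processes approximating H. *)
Definition is_ito_integral (H : process) (t : R) (I : Omega -> R) :=
  (exists Hn, approximates Hn H t) /\
  (forall Hn, approximates Hn H t ->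
    cvg_to0_in_probability
      (fun n w => (simple_integral (Hn n) t w - I w)%:E)).

End ito_integral.

Section control_problem.
Context {d : measure_display} {Omega : measurableType d} {R : realType}.
Variables (P : probability Omega R) (F : R -> set (set Omega)).
Variables (W : @process d Omega R) (xi : Omega -> R).
Variables delta sigma q alpha : R.
Notation process := (@process d Omega R).
Notation mu := (@lebesgue_measure R).

Record admissible (nu : process) : Prop := Admissible {
  adm_adapted : adapted F nu ;
  adm_ge0 : {ae P, forall w, forall t : R, 0 <= t -> 0 <= nu t w} ;
  adm_incr : {ae P, forall w,
    forall s t : R, 0 <= s -> s <= t -> nu s w <= nu t w} ;
  adm_right_continuous : {ae P, forall w, right_continuous_path (nu ^~ w)} ;
  adm_mean : forall T : R, 0 < T -> ('E_P[nu T] < +oo)%E }.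

(* X solves dX = - delta X dt + sigma X dW + d nu with X_{0-} = xi, that is,
     X_t = xi - delta int_0^t X_s ds + sigma int_0^t X_s dW_s + nu_t,  t >= 0.
   The path of X jumps only where that of nu does, so that int X_s dW_s and
   int X_{s-} dW_s are the same. *)
Record solves_sde (nu X : process) : Prop := SolvesSDE {
  sde_adapted : adapted F X ;
  sde_right_continuous : {ae P, forall w, right_continuous_path (X ^~ w)} ;
  sde_left_limits : {ae P, forall w, left_limits_path (X ^~ w)} ;
  sde_equation : exists I : process,
    [/\ adapted F I,
        {ae P, forall w, continuous_path (I ^~ w)},
        forall t : R, 0 <= t -> is_ito_integral P F W X t (I t) &
        {ae P, forall w, forall t : R, 0 <= t ->
          X t w = xi w - delta * (\int[mu]_(s in `[0%R, t]) X s w)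
                  + sigma * I t w + nu t w}] }.

Definition g (p lambda x : R) : R := p * x `^ alpha + lambda * x.

Definition g_x (p lambda : R) : R -> R := derive1 (g p lambda).

(* sup_{T > 0} 1/T E[ int_0^T |Y_t|^a dt ] *)
Definition sup_mean_moment (a : R) (Y : process) : \bar R :=
  ereal_sup [set ((T^-1)%:E *
      \int[P]_w \int[mu]_(t in `[0%R, T]) (`|Y t w| `^ a)%:E)%E
    | T in [set T : R | 0 < T]].

Definition ess_bounded (Y : process) := exists C : R,
  {ae (mu \x P)%E, forall z, 0 <= z.1 -> `|Y z.1 z.2| <= C}.

(* sup_{T > 0} inf { C >= 0 : Y <= C  dt (x) dP - a.e. on [0, T] x Omega } *)
Definition sup_ess_bound (Y : process) : \bar R :=
  ereal_sup [set ereal_inf [set C%:E | C in [set C : R | 0 <= C /\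
      {ae (mu \x P)%E, forall z, 0 <= z.1 <= T -> Y z.1 z.2 <= C}]]
    | T in [set T : R | 0 < T]].

Definition moment_condition (r : \bar R) (Y : process) : Prop :=
  match r with
  | r%:E => (sup_mean_moment (2 * r) Y < +oo)%E
  | _ => ess_bounded Y
  end.

Definition inverse_moment_condition (r' : \bar R) (Y : process) : Prop :=
  let Z : process := fun t w => Y t w `^ (alpha - 2) in
  match r' with
  | r'%:E => (sup_mean_moment r' Z < +oo)%E
  | _ => (sup_ess_bound Z < +oo)%E
  end.

(* nu |-> X nu is the state map nu |-> X^nu. *)
Variable X : process -> process.

Definition A2 (r : \bar R) : set process :=
  [set nu | admissible nu /\ moment_condition r (X nu)].

Definition mean_payoff (p lambda : R) (nu : process) (T : R) : \bar R :=
  ((T^-1)%:E * 'E_P[fun w =>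
    ((\int[mu]_(t in `[0%R, T]) g p lambda (X nu t w)) - q * nu T w)%R])%E.

Definition payoff (p lambda : R) (nu : process) : \bar R :=
  limf_einf (mean_payoff p lambda nu) (pinfty_nbhs R).

Definition mean_first_order (p lambda : R) (nuh nu : process) (T : R) : \bar R :=
  ((T^-1)%:E * 'E_P[fun w =>
    ((\int[mu]_(t in `[0%R, T])
        (g_x p lambda (X nuh t w) * (X nuh t w - X nu t w)))
     - q * (nuh T w - nu T w))%R])%E.

Definition optimal_within (A : set process) (p lambda : R) (nuh : process) :=
  A nuh /\ forall nu, A nu -> (payoff p lambda nu <= payoff p lambda nuh)%E.

End control_problem.

(* Main.v *)
Require Import Defs.
From HB Require Import structures.
From mathcomp Require Import all_boot all_order all_algebra.
From mathcomp Require Import all_classical all_reals all_analysis.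
From mathcomp Require Import measurable_realfun.
From mathcomp Require Import ring lra.

Set Implicit Arguments.
Unset Strict Implicit.
Unset Printing Implicit Defensive.

Import Order.TTheory GRing.Theory Num.Theory.
Import numFieldNormedType.Exports.

Local Open Scope classical_set_scope.
Local Open Scope ring_scope.

(** The average payoff is concave in the control, because [g] is concave and the
    state depends affinely on the control. Write [J_T(nu)] for the average payoff
    over [[0, T]] and [D_T] for the first-order average of the statement.

    The tangent inequality for [x ^ alpha] gives [D_T <= J_T(nuh) - J_T(nu)]
    ([g_tangent], [first_order_upper]). If the lower limit of [D_T] is nonnegative,
    or if its upper limit is and [J_T(nuh)] converges, this yields
    [liminf J_T(nu) <= liminf J_T(nuh)], which is part (b)
    ([limf_einf_le_of_einf], [limf_einf_le_of_cvg]).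

    For part (a), perturb [nuh] into [e nu + (1 - e) nuh], whose state is
    [e X^nu + (1 - e) X^nuh] and which satisfies the moment condition again. For
    [e <= 1 / 2] the perturbed state stays above [X^nuh / 2], which gives the
    opposite inequality with a quadratic remainder,
    [J_T(nuh) - J_T(e nu + (1 - e) nuh) <= e D_T + e ^ 2 C]
    ([g_perturbation], [first_order_lower]); the constant bounds the averages of
    [(X^nuh) ^ (alpha - 2) (X^nu - X^nuh) ^ 2] and is finite by Young's inequality
    and the two moment conditions ([conjugate_avg_bounded]). If the upper limit of
    [D_T] were negative, a small [e] would improve the payoff by a fixed amount at
    all large times ([limf_esup_ge0_of_perturbation]). The improvement shows in the
    lower limit as soon as [J_T(nuh)] is bounded, that is, as soon as [E nuh_T]
    grows at most linearly ([control_growth]): the equation expresses [nuh_u]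
    through the state and a stochastic integral, whose first moment is controlled
    by the mean square of the state; one averages over [u] in [[T, T + 1]].

    What remains is that the state is positive and affine in the control
    ([state_gt0], [state_affine]). Affinity follows from positivity: the defect of
    affinity solves the homogeneous equation from [0], and so does its opposite.
    Positivity is a comparison with a geometric Brownian motion, and is carried out
    on the Euler scheme. The Ito integral is a limit in probability of the
    integrals of simple processes, and clamped Riemann sums are admissible among
    these ([ito_rsum]); hence the state satisfies its equation up to Riemann sums
    that converge in probability ([euler_consistent]). This notion is linear, and
    it implies the lower bound [consistent_lower_bound], the heart of the proof:
    the scheme is run on a coarse grid, whose factors are positive, while the
    Riemann sums are formed on a much finer one, and the discrepancy is estimated
    in square mean with the symmetry and the variance of Brownian increments
    ([noise_step], [block_err_bound]). *)

(** * Square means of symmetric noise *)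

Section centered_noise.
Context {d : measure_display} {Omega : measurableType d} {R : realType}.
Variable P : probability Omega R.

Lemma measurable_wrtW (G : set (set Omega)) (f : Omega -> R) :
  G `<=` measurable -> measurable_wrt G f -> measurable_fun setT f.
Proof. by move=> Gm Gf _ B mB; rewrite setTI; exact/Gm/Gf. Qed.

Lemma independent_joint_law (G : set (set Omega)) (f D : {mfun Omega >-> R})
    (phi : measurableTypeR R * measurableTypeR R -> \bar R) :
  measurable_wrt G f -> independent_algebras P G (generated_by D) ->
  measurable_fun setT phi -> (forall z, 0 <= phi z)%E ->
  (\int[P]_w phi (f w, D w) =
   \int[distribution P f]_a \int[distribution P D]_b phi (a, b))%E.
Proof.
move=> Gf ind mphi phi0.
have mXY : measurable_fun setT (fun w => (f w, D w)).
  exact: measurable_fun_pair.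
transitivity (\int[pushforward P (fun w => (f w, D w))]_z phi z)%E.
  by rewrite ge0_integral_pushforward.
transitivity (\int[distribution P f \x distribution P D]_z phi z)%E; last first.
  by rewrite fubini_tonelli1.
apply: eq_measure_integral => A mA _; apply/esym.
apply: (@product_measure_unique _ _ _ _ _ (distribution P f) (distribution P D)
  (pushforward P (fun w => (f w, D w)))) => // U V mU mV.
by apply: ind; [exact: Gf | exists V].
Qed.

(** The two facts on a Brownian increment that the [L2] estimates use: a
    symmetric law, which makes the cross terms vanish without any integrability
    bookkeeping, and a bound on the second moment. *)
Record noise (G : set (set Omega)) (D : Omega -> R) (v : R) : Prop := Noise {
  noise_measurable : measurable_fun setT D ;
  noise_indep : independent_algebras P G (generated_by D) ;
  noise_sym : forall B : set R, measurable B ->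
    P (D @^-1` (-%R @^-1` B)) = P (D @^-1` B) ;
  noise_var : (\int[P]_w (D w ^+ 2)%:E <= v%:E)%E }.

Lemma noise_mul_sqr (G : set (set Omega)) (D V : Omega -> R) (v : R) :
  G `<=` measurable -> noise G D v -> measurable_wrt G V ->
  (\int[P]_w ((V w * D w) ^+ 2)%:E <= v%:E * \int[P]_w (V w ^+ 2)%:E)%E.
Proof.
move=> Gm [mD ind sym var] GV; have mV := measurable_wrtW Gm GV.
have m2 : measurable_fun setT (fun x : R => (x ^+ 2)%:E).
  by apply/measurable_EFinP; exact: measurable_funX.
pose V' : {mfun Omega >-> R} := mfun_Sub (mem_set mV).
pose D' : {mfun Omega >-> R} := mfun_Sub (mem_set mD).
have := @independent_joint_law G V' D' (fun z => ((z.1 * z.2) ^+ 2)%:E) GV ind.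
move=> ->; last 2 first.
  - apply/measurable_EFinP; apply: measurable_funX.
    by apply: measurable_funM; [exact: measurable_fst|exact: measurable_snd].
  - by move=> z; rewrite lee_fin sqr_ge0.
have inner (a : R) : (\int[distribution P D']_b ((a * b) ^+ 2)%:E =
    (a ^+ 2)%:E * \int[P]_w (D w ^+ 2)%:E)%E.
  rewrite ge0_integral_pushforward//=; last 2 first.
  - apply/measurable_EFinP; apply: measurable_funX.
    exact: mulrl_measurable.
  - by move=> x _; rewrite lee_fin sqr_ge0.
  rewrite preimage_setT -ge0_integralZl//; last 3 first.
  - by apply/measurable_EFinP; exact: measurable_funX.
  - by move=> x _; rewrite lee_fin sqr_ge0.
  - by rewrite lee_fin sqr_ge0.
  by apply: eq_integral => w _; rewrite /= exprMn EFinM.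
under eq_integral do rewrite inner.
rewrite /= ge0_integralZr//.
- rewrite ge0_integral_pushforward//; last first.
    by move=> x _; rewrite lee_fin sqr_ge0.
  rewrite muleC lee_wpmul2r//.
  by apply: integral_ge0 => w _; rewrite lee_fin sqr_ge0.
- by move=> x _; rewrite lee_fin sqr_ge0.
- by apply: integral_ge0 => w _; rewrite lee_fin sqr_ge0.
Qed.

(** Once independence has frozen [H], the symmetry of [D] exchanges the two parts
    of [H D]. Comparing the parts, rather than asserting that the mean vanishes,
    makes sense for non-integrable products too. *)
Lemma noise_mul_sym (G : set (set Omega)) (D H : Omega -> R) (v : R) :
  G `<=` measurable -> noise G D v -> measurable_wrt G H ->
  (\int[P]_w (Num.max (H w * D w) 0)%:E =
   \int[P]_w (Num.max (- (H w * D w)) 0)%:E)%E.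
Proof.
move=> Gm [mD ind sym _] GH; have mH := measurable_wrtW Gm GH.
have mM : measurable_fun setT (fun z : measurableTypeR R * measurableTypeR R => z.1 * z.2).
  by apply: measurable_funM; [exact: measurable_fst|exact: measurable_snd].
pose H' : {mfun Omega >-> R} := mfun_Sub (mem_set mH).
pose D' : {mfun Omega >-> R} := mfun_Sub (mem_set mD).
have := @independent_joint_law G H' D'
  (fun z => (Num.max (z.1 * z.2) 0)%:E) GH ind.
move=> ->; last 2 first.
  - by apply/measurable_EFinP; apply: measurable_maxr.
  - by move=> z; rewrite lee_fin le_max lexx orbT.
have := @independent_joint_law G H' D'
  (fun z => (Num.max (- (z.1 * z.2)) 0)%:E) GH ind.
move=> ->; last 2 first.
  - apply/measurable_EFinP; apply: measurable_maxr => //.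
    exact: measurable_funN.
  - by move=> z; rewrite lee_fin le_max lexx orbT.
apply: eq_integral => a aT.
have mND : measurable_fun setT (fun w => - D w) by exact: measurable_funN.
pose N' : {mfun Omega >-> R} := mfun_Sub (mem_set mND).
have ma b : measurable_fun setT (fun x : R => (Num.max (b * x) 0)%:E).
  by apply/measurable_EFinP; apply: measurable_maxr => //; exact: mulrl_measurable.
transitivity (\int[distribution P N']_x (Num.max (a * x) 0)%:E)%E.
  apply: eq_measure_integral => A mA _.
  exact/esym/sym.
rewrite ge0_integral_distribution//; last first.
  by move=> x; rewrite lee_fin le_max lexx orbT.
have eqN x : - (a * x) = - a * x by rewrite mulNr.
under [RHS]eq_integral do rewrite /= eqN.
rewrite ge0_integral_distribution//; last first.
  by move=> x; rewrite lee_fin le_max lexx orbT.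
by apply: eq_integral => w _ /=; rewrite mulrN mulNr.
Qed.

(** One step of the discrete Ito isometry. The cross term [2 Q V D] need not be
    integrable: its two parts are put on opposite sides, where they cancel. *)
Lemma noise_step (G : set (set Omega)) (D Q V : Omega -> R) (v : R) :
  G `<=` measurable -> noise G D v -> measurable_wrt G Q ->
  measurable_wrt G V -> measurable_wrt G (fun w => Q w * V w) ->
  (\int[P]_w ((Q w + V w * D w) ^+ 2)%:E <=
   \int[P]_w (Q w ^+ 2)%:E + v%:E * \int[P]_w (V w ^+ 2)%:E)%E.
Proof.
move=> Gm nD GQ GV GH; have [mD _ _ _] := nD.
have mQ := measurable_wrtW Gm GQ; have mV := measurable_wrtW Gm GV.
have mH := measurable_wrtW Gm GH.
have mHD : measurable_fun setT (fun w => Q w * V w * D w) by exact: measurable_funM.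
have mQ2 : measurable_fun setT (fun w => (Q w ^+ 2)%:E).
  by apply/measurable_EFinP; exact: measurable_funX.
have mVD2 : measurable_fun setT (fun w => ((V w * D w) ^+ 2)%:E).
  by apply/measurable_EFinP; apply: measurable_funX; exact: measurable_funM.
apply: (@le_trans _ _
  (\int[P]_w (Q w ^+ 2)%:E + \int[P]_w ((V w * D w) ^+ 2)%:E)%E); last first.
  by apply: leeD => //; exact: (@noise_mul_sqr G).
rewrite -ge0_integralD//; last 2 first.
  - by move=> w _; rewrite lee_fin sqr_ge0.
  - by move=> w _; rewrite lee_fin sqr_ge0.
have [->|fin] := eqVneq (\int[P]_x ((Q x ^+ 2)%:E + ((V x * D x) ^+ 2)%:E))%E +oo%E.
  exact: leey.
set A := (X in (_ <= X)%E) in fin *.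
pose p w := Num.max (Q w * V w * D w) 0.
pose n w := Num.max (- (Q w * V w * D w)) 0.
have mp : measurable_fun setT p by exact: measurable_maxr.
have mn : measurable_fun setT n.
  by apply: measurable_maxr => //; exact: measurable_funN.
have p0 w : 0 <= p w by rewrite /p le_max lexx orbT.
have n0 w : 0 <= n w by rewrite /n le_max lexx orbT.
have pn : (\int[P]_w (2 * p w)%:E = \int[P]_w (2 * n w)%:E)%E.
  under eq_integral do rewrite EFinM.
  under [RHS]eq_integral do rewrite EFinM.
  rewrite !ge0_integralZl//; try by [|exact/measurable_EFinP|move=> w _; rewrite lee_fin].
  by congr (_ * _)%E; exact: (@noise_mul_sym G D _ v).
have E : (A + \int[P]_w (2 * p w)%:E =
    \int[P]_w ((Q w + V w * D w) ^+ 2)%:E + \int[P]_w (2 * n w)%:E)%E.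
  have m2p : measurable_fun setT (fun w => (2 * p w)%:E).
    by apply/measurable_EFinP; apply: measurable_funM.
  have m2n : measurable_fun setT (fun w => (2 * n w)%:E).
    by apply/measurable_EFinP; apply: measurable_funM.
  have mS : measurable_fun setT (fun w => ((Q w + V w * D w) ^+ 2)%:E).
    apply/measurable_EFinP; apply: measurable_funX; apply: measurable_funD => //.
    exact: measurable_funM.
  rewrite /A -ge0_integralD//; last 3 first.
  - by move=> w _; rewrite adde_ge0// lee_fin sqr_ge0.
  - exact: emeasurable_funD.
  - by move=> w _; rewrite lee_fin mulr_ge0.
  rewrite -ge0_integralD//; last 2 first.
  - by move=> w _; rewrite lee_fin sqr_ge0.
  - by move=> w _; rewrite lee_fin mulr_ge0.
  apply: eq_integral => w _; rewrite -!EFinD; congr EFin.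
  rewrite /p /n /Num.max; case: ltP => h1; case: ltP => h2; nra.
have B : (\int[P]_w (2 * n w)%:E <= A)%E.
  apply: ge0_le_integral => //.
  - by move=> w _; rewrite lee_fin mulr_ge0.
  - by apply/measurable_EFinP; apply: measurable_funM.
  - exact: emeasurable_funD.
  - move=> w _; rewrite -EFinD lee_fin /n /Num.max.
    have := sqr_ge0 (Q w); have := sqr_ge0 (V w * D w).
    have := sqr_ge0 (Q w + V w * D w); case: ltP => h1; nra.
have Bfin : (\int[P]_w (2 * n w)%:E)%E \is a fin_num.
  rewrite ge0_fin_numE; last by apply: integral_ge0 => w _; rewrite lee_fin mulr_ge0.
  by apply: le_lt_trans B _; rewrite ltey.
by rewrite -(leeD2rE _ _ Bfin) -E pn.
Qed.

End centered_noise.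

(** * Brownian increments *)

Section brownian_noise.
Context {R : realType}.
Notation mu := (@lebesgue_measure R).

Lemma integral_normal_prob (s : R) (f : R -> \bar R) :
  measurable_fun setT f -> (forall x, 0 <= f x)%E ->
  (\int[normal_prob 0%R s]_x f x = \int[mu]_x (f x * (normal_pdf 0%R s x)%:E))%E.
Proof.
move=> mf f0.
have dom := @normal_prob_dominates R 0 s.
rewrite -(Radon_Nikodym_SigmaFinite.change_of_variables dom)//.
apply: ae_eq_integral => //.
- apply: emeasurable_funM => //; apply: (measurable_int mu).
  exact: Radon_Nikodym_SigmaFinite.f_integrable.
- apply: emeasurable_funM => //; apply/measurable_EFinP.
  exact: measurable_normal_pdf.
- apply: ae_eqe_mul2l => /=.
  apply: integral_ae_eq => //=.
  + exact: Radon_Nikodym_SigmaFinite.f_integrable.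
  + by apply/measurable_EFinP; exact: measurable_normal_pdf.
  + move=> A _ mA; rewrite -Radon_Nikodym_SigmaFinite.f_integral//.
Qed.

Lemma normal_prob_sym (s : R) (B : set R) : s != 0 -> measurable B ->
  normal_prob 0 s (-%R @^-1` B) = normal_prob 0 s B.
Proof.
move=> s0 mB; rewrite /normal_prob.
have mN : measurable_fun setT (-%R : R -> measurableTypeR R).
  exact: oppr_measurable.
have mpdf : measurable_fun setT (fun x : R => (normal_pdf 0 s x)%:E).
  by apply/measurable_EFinP; exact: measurable_normal_pdf.
transitivity (\int[pushforward mu (-%R : R -> measurableTypeR R)]_(x in B)
    (normal_pdf 0 s x)%:E)%E; last first.
  by apply: eq_measure_integral => A mA AB; exact: lebesgue_measureN.
rewrite ge0_integral_pushforward//.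
- apply: eq_integral => x _ /=.
  by rewrite !normal_pdfE// /normal_fun !subr0 sqrrN.
- exact: measurable_funS mpdf.
- by move=> x _; rewrite lee_fin normal_pdf_ge0.
Qed.

(** [y exp (- y) <= 1] trades the factor [x ^ 2] for a Gaussian density of twice
    the variance, and only the order [s ^ 2] of the bound matters. *)
Lemma normal_prob_second_moment (s : R) : 0 < s ->
  (\int[normal_prob 0%R s]_x (x ^+ 2)%:E <= (8 * s ^+ 2)%:E)%E.
Proof.
move=> s0.
rewrite integral_normal_prob//; last 2 first.
- by apply/measurable_EFinP; exact: measurable_funX.
- by move=> x; rewrite lee_fin sqr_ge0.
have s2 : 0 < Num.sqrt 2 * s by rewrite mulr_gt0// sqrtr_gt0.
rewrite -[leRHS]mule1 -(@integral_normal_pdf _ 0 (Num.sqrt 2 * s)).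
have mp t : measurable_fun setT (fun x : R => (normal_pdf 0 t x)%:E).
  by apply/measurable_EFinP; exact: measurable_normal_pdf.
rewrite -ge0_integralZl//; last 3 first.
- exact: mp.
- by move=> x _; rewrite lee_fin normal_pdf_ge0.
- by rewrite lee_fin mulr_ge0// sqr_ge0.
apply: ge0_le_integral => //.
- by move=> x _; rewrite mule_ge0// lee_fin ?sqr_ge0 ?normal_pdf_ge0.
- apply: emeasurable_funM; last exact: mp.
  by apply/measurable_EFinP; exact: measurable_funX.
- by apply: emeasurable_funM; [exact: measurable_cst|exact: mp].
move=> x _; rewrite -!EFinM lee_fin !normal_pdfE ?gt_eqF// /normal_fun !subr0.
rewrite /normal_peak.
have -> : (Num.sqrt 2 * s) ^+ 2 = s ^+ 2 *+ 2.
  by rewrite exprMn sqr_sqrtr// mulr2n; ring.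
have ss : 0 < s ^+ 2 by rewrite exprn_gt0.
set S := s ^+ 2 in ss *.
set u := x ^+ 2 / (4 * S).
have u0 : 0 <= u by rewrite divr_ge0 ?sqr_ge0 ?mulr_ge0 ?ltW.
have -> : - x ^+ 2 / (S *+ 2) = - u + - u.
  by rewrite /u; field; rewrite gt_eqF.
have -> : - x ^+ 2 / (S *+ 2 *+ 2) = - u.
  by rewrite /u; field; rewrite gt_eqF.
rewrite expRD.
have xu : x ^+ 2 = 4 * S * u by rewrite /u; field; rewrite gt_eqF.
have ue : u * expR (- u) <= 1.
  rewrite expRN ler_pdivrMr ?expR_gt0// mul1r.
  by have := expR_ge1Dx u; lra.
have Spi : 0 < S * pi by rewrite mulr_gt0// pi_gt0.
have k : (Num.sqrt (S * pi *+ 2))^-1 <= 2 * (Num.sqrt (S *+ 2 * pi *+ 2))^-1.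
  rewrite -[leRHS]invrK lef_pV2 ?posrE ?invr_gt0 ?mulr_gt0 ?invr_gt0 ?sqrtr_gt0//;
    try lra.
  rewrite invfM invrK ler_pdivrMl//.
  have <- : Num.sqrt 4 = 2 :> R.
    by rewrite (_ : 4 = 2 ^+ 2); [rewrite sqrtr_sqr ger0_norm | ring].
  by rewrite -sqrtrM// ler_sqrt; lra.
rewrite xu.
set k1 := (Num.sqrt (S * pi *+ 2))^-1 in k *.
set k2 := (Num.sqrt _)^-1 in k *.
have k10 : 0 <= k1 by rewrite invr_ge0 sqrtr_ge0.
have e0 := expR_ge0 (- u).
set e := expR (- u) in ue e0 *.
have -> : 4 * S * u * (k1 * (e * e)) = 4 * S * e * (k1 * (u * e)) by ring.
have -> : 8 * S * (k2 * e) = 4 * S * e * (2 * k2) by ring.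
apply: ler_wpM2l; first by rewrite !mulr_ge0// ltW.
apply: le_trans k; rewrite -[leRHS]mulr1; exact: ler_wpM2l.
Qed.

Context {d : measure_display} {Omega : measurableType d}.
Variables (P : probability Omega R) (F : R -> set (set Omega)) (W : R -> Omega -> R).
Hypothesis F_sub : forall t : R, 0 <= t -> F t `<=` measurable.
Hypothesis W_bm : brownian_motion P F W.

Lemma brownian_noise (s t : R) : 0 <= s -> s < t ->
  noise P (F s) (W t \- W s) (8 * (t - s)).
Proof.
move=> s0 st; have t0 : 0 <= t by lra.
have ts : 0 < Num.sqrt (t - s) by rewrite sqrtr_gt0 subr_gt0.
have mW u : 0 <= u -> measurable_fun setT (W u).
  move=> u0; apply: (@measurable_wrtW _ _ _ (F u)); first exact: F_sub.
  exact: (bm_adapted W_bm).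
have mD : measurable_fun setT (W t \- W s) by apply: measurable_funB; exact: mW.
have law := bm_gaussian W_bm s0 st.
split => //.
- exact: (bm_independent W_bm).
- move=> B mB; have mNB : measurable (-%R @^-1` B : set R).
    by rewrite -[X in measurable X]setTI; exact: oppr_measurable.
  rewrite [LHS](law (-%R @^-1` B))// [RHS](law B)//.
  by rewrite normal_prob_sym// gt_eqF.
- have mD' : measurable_fun (U := measurableTypeR R) setT (W t \- W s).
    exact: mD.
  pose D : {mfun Omega >-> measurableTypeR R} :=
    @mfun_Sub _ _ Omega (measurableTypeR R) (W t \- W s) (mem_set mD').
  have m2 : measurable_fun setT (fun x : measurableTypeR R => (x ^+ 2)%:E).
    by apply/measurable_EFinP; exact: measurable_funX.
  have -> : (\int[P]_w ((W t \- W s) w ^+ 2)%:E =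
      \int[distribution P D]_x (x ^+ 2)%:E)%E.
    by rewrite ge0_integral_distribution// => x; rewrite lee_fin sqr_ge0.
  rewrite (_ : t - s = Num.sqrt (t - s) ^+ 2); last first.
    by rewrite sqr_sqrtr// subr_ge0 ltW.
  apply: le_trans (normal_prob_second_moment ts).
  rewrite le_eqVlt; apply/orP; left; apply/eqP.
  apply: (@eq_measure_integral _ _ _ setT
    (normal_prob 0 (Num.sqrt (t - s))) (distribution P D)) => A mA _.
  exact: law.
Qed.

End brownian_noise.

(** * Convergence in probability *)

Section convergence_in_probability.
Context {d : measure_display} {Omega : measurableType d} {R : realType}.
Variable P : probability Omega R.

Section complete.
Hypothesis P_complete : P.-negligible `<=` measurable.

Lemma complete_measurable_set (A B : set Omega) : measurable A ->
  {ae P, forall w, A w <-> B w} -> measurable B.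
Proof.
move=> mA AB.
have n1 : P.-negligible (B `\` A).
  by apply: negligibleS AB => w [Bw nAw] /= h; apply/nAw/h.
have n2 : P.-negligible (A `\` B).
  by apply: negligibleS AB => w [Aw nBw] /= h; apply/nBw/h.
rewrite (_ : B = (A `\` (A `\` B)) `|` (B `\` A)).
  by apply: measurableU; [apply: measurableD => //|]; exact: P_complete.
apply/seteqP; split => w /=.
- move=> Bw; have [Aw|nAw] := pselect (A w); last by right.
  by left; split => // -[].
- by move=> [[Aw /not_andP[//|/contrapT]]|[]].
Qed.

(** On a complete space a path functional may be replaced by an almost surely
    equal one under an integral, whatever its measurability looks like. *)
Lemma complete_measurable_fun d' (T : measurableType d') (f g : Omega -> T) :
  measurable_fun setT f -> {ae P, forall w, f w = g w} -> measurable_fun setT g.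
Proof.
move=> mf fg _ B mB; rewrite setTI.
apply: (@complete_measurable_set (f @^-1` B)).
  by rewrite -[X in measurable X]setTI; exact: mf.
by apply: filterS fg => w /= ->.
Qed.

End complete.

(** Continuity from above of [P], applied to the tails of the sequence. *)
Lemma ae_eventually_measure (A : nat -> set Omega) :
  (forall n, measurable (A n)) ->
  {ae P, forall w, \forall n \near \oo, ~ A n w} ->
  forall e : R, 0 < e -> \forall n \near \oo, (P (A n) <= e%:E)%E.
Proof.
move=> mA evA e e0.
have cv : (\int[P]_w (\1_(A n) w)%:E @[n --> \oo] --> \int[P]_w (cst 0 w))%E.
  have mf n : measurable_fun setT (fun w => (\1_(A n) w)%:E : \bar R).
    by apply/measurable_EFinP; exact: measurable_indic.
  have i1 : P.-integrable setT (fun=> 1%E : \bar R).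
    exact: finite_measure_integrable_cst.
  have c1 : {ae P, forall w, setT w ->
      (\1_(A n) w)%:E @[n --> \oo] --> (cst 0 w : \bar R)}%E.
    apply: filterS evA => w ev _; apply: cvg_near_cst.
    by apply: filterS ev => n nA; rewrite indicE memNset.
  have b1 : {ae P, forall w n, setT w -> (`|(\1_(A n) w)%:E| <= 1 :> \bar R)%E}.
    apply/aeW => w n _; rewrite indicE.
    by case: (w \in A n); rewrite ?abse1 ?abse0.
  by have [_ _] := dominated_convergence measurableT mf (measurable_cst 0%E) c1 i1 b1.
move: cv; rewrite integral0.
under eq_fun do rewrite integral_indic// setIT.
move=> /fine_cvgP[fin /cvgr0Pnorm_le /(_ e e0)].
move=> le; near=> n.
have fn : P (A n) \is a fin_num by apply: fin_num_measure.
rewrite -(fineK fn) lee_fin; apply: le_trans (ler_norm _) _.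
by near: n.
Unshelve. all: by end_near. Qed.

(** Convergence to [0] in probability, in Ky Fan's form: exceptional sets are
    only bounded, so that algebraic rules need no measurability of the
    sequence. *)
Definition cvgP0 (X : nat -> Omega -> R) := forall e : R, 0 < e ->
  \forall n \near \oo, exists B, [/\ measurable B, (P B <= e%:E)%E &
    forall w, ~ B w -> `|X n w| < e].

Lemma measureU_le (A B : set Omega) (a b : R) : measurable A -> measurable B ->
  (P A <= a%:E -> P B <= b%:E -> P (A `|` B) <= (a + b)%:E)%E.
Proof.
move=> mA mB Aa Bb; rewrite EFinD.
by apply: le_trans (leeD Aa Bb); exact: measureU2.
Qed.

Lemma cvgP0_le (X Y : nat -> Omega -> R) :
  (forall n w, `|X n w| <= `|Y n w|) -> cvgP0 Y -> cvgP0 X.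
Proof.
move=> XY cY e e0; apply: filterS (cY e e0) => n [B [mB Be BY]].
by exists B; split => // w /BY; exact: le_lt_trans.
Qed.

Lemma cvgP0D (X Y : nat -> Omega -> R) : cvgP0 X -> cvgP0 Y ->
  cvgP0 (fun n w => X n w + Y n w).
Proof.
move=> cX cY e e0; have e20 : 0 < e / 2 by lra.
near=> n.
have [A [mA Ae AX]] : exists B, [/\ measurable B, (P B <= (e / 2)%:E)%E &
  forall w, ~ B w -> `|X n w| < e / 2] by near: n; exact: cX.
have [B [mB Be BX]] : exists B, [/\ measurable B, (P B <= (e / 2)%:E)%E &
  forall w, ~ B w -> `|Y n w| < e / 2] by near: n; exact: cY.
exists (A `|` B); split; first exact: measurableU.
- by rewrite [e]splitr; exact: measureU_le.
- move=> w /not_orP[/AX Xw /BX Yw].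
  by apply: le_lt_trans (ler_normD _ _) _; rewrite [e]splitr; exact: ltrD.
Unshelve. all: by end_near. Qed.

Lemma rv_tight (Y : Omega -> R) : measurable_fun setT Y ->
  forall e : R, 0 < e -> exists K : R, exists B, [/\ 0 < K, measurable B,
    (P B <= e%:E)%E & forall w, ~ B w -> `|Y w| < K].
Proof.
move=> mY e e0; pose A n := [set w | n%:R <= `|Y w|].
have mA n : measurable (A n).
  rewrite -[A n]setTI; apply: (@measurable_fun_ler _ _ _ _ (fun=> n%:R)) => //.
  exact: measurableT_comp.
have : \forall n \near \oo, (P (A n) <= e%:E)%E.
  apply: ae_eventually_measure => //; apply/aeW => w.
  exists (Num.truncn `|Y w|).+1 => // n /= ln.
  rewrite /A/=; apply/negP; rewrite -ltNge.
  apply: lt_le_trans (truncnS_gt _) _.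
  by rewrite ler_nat.
move=> [N _ NA]; exists N.+1%:R, (A N.+1); split => //.
- by apply: NA => /=.
- by move=> w; rewrite /A/= => /negP; rewrite -ltNge.
Qed.

(** A random factor is bounded off a set of small probability. *)
Lemma cvgP0Mr (X : nat -> Omega -> R) (Y : Omega -> R) :
  measurable_fun setT Y -> cvgP0 X -> cvgP0 (fun n w => X n w * Y w).
Proof.
move=> mY cX e e0; have e20 : 0 < e / 2 by lra.
have [K [B [K0 mB Be BY]]] := rv_tight mY e20.
pose e' := Num.min (e / 2) (e / K).
have e'0 : 0 < e' by rewrite lt_min e20 divr_gt0.
apply: filterS (cX e' e'0) => n [A [mA Ae AX]].
exists (A `|` B); split; first exact: measurableU.
- rewrite [e]splitr; apply: measureU_le => //.
  by apply: le_trans Ae _; rewrite lee_fin ge_min lexx.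
- move=> w /not_orP[/AX Xw /BY Yw]; rewrite normrM.
  have Xw' : `|X n w| < e / K by apply: lt_le_trans Xw _; rewrite ge_min lexx orbT.
  have [->|X0] := eqVneq (X n w) 0; first by rewrite normr0 mul0r.
  have -> : e = (e / K) * K by rewrite divfK// gt_eqF.
  by rewrite ltr_pM.
Qed.

Lemma cvgP0Zl (X : nat -> Omega -> R) (c : R) : cvgP0 X ->
  cvgP0 (fun n w => c * X n w).
Proof.
move=> cX; apply: (cvgP0_le (Y := fun n w => X n w * c)); last exact: cvgP0Mr.
by move=> n w; rewrite mulrC.
Qed.

Lemma cvgP0N (X : nat -> Omega -> R) : cvgP0 X -> cvgP0 (fun n w => - X n w).
Proof. by apply: cvgP0_le => n w; rewrite normrN. Qed.

Lemma cvgP0_sub (X : nat -> Omega -> R) (phi : nat -> nat) :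
  phi @ \oo --> \oo -> cvgP0 X -> cvgP0 (fun n => X (phi n)).
Proof. by move=> cphi cX e e0; exact: (cphi _ (cX e e0)). Qed.

Lemma cvgP0_ae (X : nat -> Omega -> R) :
  (forall n, measurable_fun setT (X n)) ->
  {ae P, forall w, X n w @[n --> \oo] --> 0} -> cvgP0 X.
Proof.
move=> mX cX e e0; pose A n := [set w | e <= `|X n w|].
have mA n : measurable (A n).
  rewrite -[A n]setTI; apply: (@measurable_fun_ler _ _ _ _ (fun=> e)) => //.
  exact: measurableT_comp.
have : \forall n \near \oo, (P (A n) <= e%:E)%E.
  apply: ae_eventually_measure => //; apply: filterS cX => w.
  move=> /cvgr0Pnorm_lt /(_ e e0); apply: filterS => n.
  by rewrite /A/= => h; apply/negP; rewrite -ltNge.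
apply: filterS => n PA; exists (A n); split => // w.
by rewrite /A/= => /negP; rewrite -ltNge.
Qed.

Lemma cvg_in_probability_cvgP0 (X : nat -> Omega -> R) :
  (forall n, measurable_fun setT (X n)) ->
  cvg_to0_in_probability P (fun n w => (X n w)%:E) -> cvgP0 X.
Proof.
move=> mX cX e e0; have := cX e e0.
move=> /fine_cvgP[fin /cvgr0Pnorm_le /(_ e e0)] le; near=> n.
have mA : measurable [set w | (e%:E <= `|(X n w)%:E|)%E].
  rewrite -[X in measurable X]setTI.
  apply: emeasurable_fun_c_infty => //; apply: measurableT_comp => //.
  exact/measurable_EFinP.
exists [set w | (e%:E <= `|(X n w)%:E|)%E]; split => //.
- have fn : P [set w | (e%:E <= `|(X n w)%:E|)%E] \is a fin_num.
    exact: fin_num_measure.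
  rewrite -(fineK fn) lee_fin; apply: le_trans (ler_norm _) _.
  by near: n.
- by move=> w /= /negP; rewrite lee_fin -ltNge.
Unshelve. all: by end_near. Qed.

Lemma ae_cvg_in_probability (Z : nat -> Omega -> \bar R) :
  (forall n, measurable_fun setT (Z n)) ->
  {ae P, forall w, forall e : R, 0 < e -> \forall n \near \oo, (`|Z n w| < e%:E)%E} ->
  cvg_to0_in_probability P Z.
Proof.
move=> mZ cZ e e0; pose A n := [set w | (e%:E <= `|Z n w|)%E].
have mA n : measurable (A n).
  rewrite -[X in measurable X]setTI.
  by apply: emeasurable_fun_c_infty => //; exact: measurableT_comp.
apply/fine_cvgP; split; first by apply: nearW => n; apply: fin_num_measure; exact: mA.
apply/cvgr0Pnorm_le => r r0.
have : \forall n \near \oo, (P (A n) <= r%:E)%E.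
  apply: ae_eventually_measure => //; apply: filterS cZ => w /(_ e e0).
  by apply: filterS => n; rewrite /A/= => h; apply/negP; rewrite -ltNge.
apply: filterS => n; have fn : P (A n) \is a fin_num by exact: fin_num_measure.
by rewrite -[X in (X <= _)%E](fineK fn) lee_fin /= ger0_norm// fine_ge0.
Qed.

End convergence_in_probability.

(** * Riemann sums along a path *)

Section paths.
Context {R : realType}.
Notation mu := (@lebesgue_measure R).
Implicit Types (z : R -> R) (t : R).

(** Continuity of the restriction of [z] to [[0, t]], free of subspace
    topologies. *)
Definition continuous_upto z t := forall x, 0 <= x <= t -> forall e : R, 0 < e ->
  exists2 r : R, 0 < r &
    forall s, 0 <= s <= t -> `|s - x| < r -> `|z s - z x| < e.

Lemma continuous_path_upto z t : continuous_path z -> continuous_upto z t.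
Proof.
move=> /subspace_continuousP cz x /andP[x0 xt] e e0.
have /cz : `[0%R, +oo[%classic x by rewrite /= in_itv/= x0.
move=> /cvgrPdist_lt/(_ e e0) [r /= r0 zr]; exists r => // s /andP[s0 st] sx.
rewrite distrC; apply: zr; first by rewrite /ball_/= distrC.
by rewrite /= in_itv/= s0.
Qed.

Lemma continuous_upto_unif z t : continuous_upto z t -> forall e : R, 0 < e ->
  exists2 r : R, 0 < r & forall x s, 0 <= x <= t -> 0 <= s <= t ->
    `|s - x| < r -> `|z s - z x| < e.
Proof.
move=> cz e e0; have e20 : 0 < e / 2 by lra.
have /compact_near_coveringP/near_covering_withinP := @segment_compact R 0 t.
move=> /(_ R 0^'+ (fun r x => forall s, 0 <= s <= t -> `|s - x| < r ->
  `|z s - z x| < e)).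
case.
- move=> x; rewrite /= in_itv/= => x0t; have [r r0 zr] := cz x x0t _ e20.
  have r20 : 0 < r / 2 by lra.
  exists (ball x (r / 2), [set r' | r' < r / 2]).
    split; first exact: nbhsx_ballx.
    exact: nbhs_right_lt.
  move=> [x' r'] /= [xx' r'r] x't s st sx'.
  have x'x : `|x' - x| < r by move: xx'; rewrite /ball/= distrC; lra.
  have sx : `|s - x| < r.
    have := ler_normD (s - x') (x' - x); rewrite addrA subrK => h.
    by apply: le_lt_trans h _; move: xx'; rewrite /ball/= distrC; lra.
  have := zr s st sx; have := zr x' _ x'x.
  move=> /(_ ltac:(by move: x't; rewrite /= ?in_itv)) h1 h2.
  have -> : z s - z x' = (z s - z x) - (z x' - z x) by ring.
  by apply: le_lt_trans (ler_normB _ _) _; lra.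
- move=> r /= r0 /(_ (r / 2)) rP; exists (r / 2); first by lra.
  move=> x s xt st sx; apply: rP => //=.
  by rewrite /ball_/= sub0r normrN gtr0_norm; lra.
  by lra.
Qed.

(** Around each time the one-sided limits bound the path; compactness of
    [[0, t]] makes the bound global. *)
Lemma cadlag_bounded z t : right_continuous_path z -> left_limits_path z ->
  exists M : R, forall s, 0 <= s <= t -> `|z s| <= M.
Proof.
move=> rz lz.
have /compact_near_coveringP/near_covering_withinP := @segment_compact R 0 t.
move=> /(_ R (pinfty_nbhs R) (fun M x => `|z x| <= M)); case.
- move=> x; rewrite /= in_itv/= => /andP[x0 xt].
  have [r [r0 [M1 rM1]]] : exists r, 0 < r /\ exists M, forall s, x < s ->
      s < x + r -> `|z s| <= M.
    have /cvgrPdist_lt/(_ 1 ltr01) [r /= r0 zr] := rz x x0.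
    exists r; split => //; exists (`|z x| + 1) => s xs sxr.
    have := zr s; rewrite /ball_/= => /(_ _ xs) h.
    have /h : `|x - s| < r by rewrite distrC gtr0_norm; lra.
    move=> h1; have -> : z s = z x - (z x - z s) by ring.
    by apply: le_trans (ler_normB _ _) _; lra.
  have [l [l0 [M2 lM2]]] : exists r, 0 < r /\ exists M, forall s, 0 <= s ->
      x - r < s -> s < x -> `|z s| <= M.
    have [xle0|xgt0] := leP x 0.
      by exists 1; split => //; exists 0 => s s0 _ sx; exfalso; lra.
    have /cvgrPdist_lt/(_ 1 ltr01) [r' /= r'0 zr] := lz x xgt0.
    exists r'; split => //; exists (`|lim (z s @[s --> x^'-])| + 1) => s _ xs sxr.
    have := zr s; rewrite /ball_/= => /(_ _ sxr) h.
    have /h : `|x - s| < r' by rewrite gtr0_norm; lra.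
    set L := lim _ => h1; have -> : z s = L - (L - z s) by ring.
    by apply: le_trans (ler_normB _ _) _; lra.
  pose M := Num.max (Num.max M1 M2) `|z x|.
  exists (ball x (Num.min r l), [set M' | M < M']).
    split; last by apply: nbhs_pinfty_gt; exact: num_real.
    by apply: nbhsx_ballx; rewrite lt_min r0.
  move=> [s M'] /= [xs MM']; rewrite in_itv/= => /andP[s0 st].
  have [M1M' M2M' zM'] : [/\ M1 <= M', M2 <= M' & `|z x| <= M'].
    move: MM'; rewrite /M !gt_max => /andP[/andP[? ?] ?].
    by split; exact: ltW.
  move: xs; rewrite /ball/= lt_min => /andP[xr xl].
  have [sx|sx|->//] := ltgtP s x.
  - apply: le_trans M2M'; apply: lM2 => //.
    by move: xl; rewrite gtr0_norm; lra.
  - apply: le_trans M1M'; apply: rM1 => //.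
    by move: xr; rewrite ltr0_norm; lra.
- move=> M [_ MP]; exists (M + 1) => s st; apply: MP; first by lra.
  by rewrite /= in_itv.
Qed.

(** Darboux's criterion on the uniform grids of [[0, t]], in first power: the
    left Riemann sums of [z] converge, and so do those of its clamped square. *)
Definition small_osc z t := forall e : R, 0 < e -> \forall n \near \oo,
  exists b : nat -> R, [/\ forall i, 0 <= b i,
    (\sum_(i < n) b i) * (t / n%:R) <= e &
    forall i s, (i < n)%N -> i%:R * (t / n%:R) <= s <= i.+1%:R * (t / n%:R) ->
      `|z s - z (i%:R * (t / n%:R))| <= b i].

Lemma small_oscD z1 z2 t : 0 <= t -> small_osc z1 t -> small_osc z2 t ->
  small_osc (fun s => z1 s + z2 s) t.
Proof.
move=> t0 o1 o2 e e0; have e20 : 0 < e / 2 by lra.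
near=> n.
have [b1 [b10 b1e b1z]] : exists b : nat -> R, [/\ forall i, 0 <= b i,
    (\sum_(i < n) b i) * (t / n%:R) <= e / 2 &
    forall i s, (i < n)%N -> i%:R * (t / n%:R) <= s <= i.+1%:R * (t / n%:R) ->
      `|z1 s - z1 (i%:R * (t / n%:R))| <= b i] by near: n; exact: o1.
have [b2 [b20 b2e b2z]] : exists b : nat -> R, [/\ forall i, 0 <= b i,
    (\sum_(i < n) b i) * (t / n%:R) <= e / 2 &
    forall i s, (i < n)%N -> i%:R * (t / n%:R) <= s <= i.+1%:R * (t / n%:R) ->
      `|z2 s - z2 (i%:R * (t / n%:R))| <= b i] by near: n; exact: o2.
exists (fun i => b1 i + b2 i); split.
- by move=> i; rewrite addr_ge0.
- by rewrite big_split/= mulrDl; lra.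
- move=> i s ni si.
  rewrite (_ : _ - _ = (z1 s - z1 (i%:R * (t / n%:R))) +
    (z2 s - z2 (i%:R * (t / n%:R)))); last by ring.
  apply: le_trans (ler_normD _ _) _.
  by apply: lerD; [exact: b1z|exact: b2z].
Unshelve. all: by end_near. Qed.

Lemma small_oscZ z t (a : R) : 0 <= t -> small_osc z t ->
  small_osc (fun s => a * z s) t.
Proof.
move=> t0 o e e0; have a1 : 0 < `|a| + 1 by rewrite ltr_wpDl.
have e'0 : 0 < e / (`|a| + 1) by rewrite divr_gt0.
apply: filterS (o _ e'0) => n [b [b0 be bz]].
exists (fun i => `|a| * b i); split.
- by move=> i; rewrite mulr_ge0.
- rewrite -mulr_sumr -mulrA.
  have S0 : 0 <= (\sum_(i < n) b i) * (t / n%:R).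
    by rewrite mulr_ge0 ?sumr_ge0 ?divr_ge0.
  apply: (@le_trans _ _ ((`|a| + 1) * ((\sum_(i < n) b i) * (t / n%:R)))).
    by apply: ler_wpM2r => //; lra.
  by rewrite mulrC -ler_pdivlMr.
- by move=> i s ni si; rewrite -mulrBr normrM ler_wpM2l// bz.
Qed.

Lemma grid_bounds (n i : nat) t s : 0 <= t -> (i < n)%N ->
  i%:R * (t / n%:R) <= s <= i.+1%:R * (t / n%:R) ->
  [/\ 0 <= i%:R * (t / n%:R), 0 <= s & s <= t].
Proof.
move=> t0 ni /andP[isx si].
have h0 : 0 <= t / n%:R by rewrite divr_ge0.
have i0 : 0 <= i%:R * (t / n%:R) by rewrite mulr_ge0.
split => //; first exact: le_trans isx.
apply: le_trans si _; rewrite mulrCA -[leRHS]mulr1; apply: ler_wpM2l => //.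
have n0 : 0 < n%:R :> R by rewrite ltr0n; exact: leq_trans ni.
by rewrite ler_pdivrMr// mul1r ler_nat.
Qed.

Lemma small_osc_continuous z t : 0 <= t -> continuous_upto z t -> small_osc z t.
Proof.
move=> t0 cz e e0; have t1 : 0 < t + 1 by lra.
have e'0 : 0 < e / (t + 1) by rewrite divr_gt0.
have [r r0 zr] := continuous_upto_unif cz e'0.
near=> n.
have n0 : (0 < n)%N by near: n; exact: nbhs_infty_gt.
have n0R : 0 < n%:R :> R by rewrite ltr0n.
have hr : t / n%:R < r.
  rewrite ltr_pdivrMr// mulrC -ltr_pdivrMr//.
  by near: n; exact: nbhs_infty_gtr.
exists (fun=> e / (t + 1)); split.
- by move=> _; exact: ltW.
- rewrite sumr_const card_ord -[(e / (t + 1)) *+ n]mulr_natr.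
  have -> : e / (t + 1) * n%:R * (t / n%:R) = e * (t / (t + 1)).
    by field; rewrite !gt_eqF.
  by rewrite ler_piMr ?ltW// ltr_pdivrMr//; lra.
- move=> i s ni si; have [i0 s0 st] := grid_bounds t0 ni si.
  move: si => /andP[isx si].
  apply/ltW/zr; rewrite ?i0 ?s0 ?st//=; first exact: le_trans isx st.
  rewrite ger0_norm ?subr_ge0//.
  apply: le_lt_trans hr; rewrite lerBlDl; apply: le_trans si _.
  by rewrite -natr1 mulrDl mul1r.
Unshelve. all: by end_near. Qed.

(** The oscillations over the cells are increments, and these telescope: their
    sum times the mesh is [(z t - z 0) t / n]. *)
Lemma small_osc_nondecreasing z t : 0 <= t ->
  (forall s u, 0 <= s -> s <= u -> z s <= z u) -> small_osc z t.
Proof.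
move=> t0 nz e e0; near=> n.
have n0 : (0 < n)%N by near: n; exact: nbhs_infty_gt.
have n0R : 0 < n%:R :> R by rewrite ltr0n.
have h0 : 0 <= t / n%:R by rewrite divr_ge0.
have mono i : i%:R * (t / n%:R) <= i.+1%:R * (t / n%:R).
  by apply: ler_wpM2r => //; rewrite ler_nat.
exists (fun i => z (i.+1%:R * (t / n%:R)) - z (i%:R * (t / n%:R))); split.
- by move=> i; rewrite subr_ge0; apply: nz => //; rewrite mulr_ge0.
- rewrite -(big_mkord xpredT (fun i => z (i.+1%:R * _) - z (i%:R * (t / n%:R)))).
  rewrite telescope_sumr// mul0r (_ : n%:R * (t / n%:R) = t); last first.
    by rewrite mulrC divfK ?gt_eqF.
  have zt : 0 <= z t - z 0 by rewrite subr_ge0 nz.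
  rewrite mulrA ler_pdivrMr// [leRHS]mulrC -ler_pdivrMr//.
  by near: n; exact: nbhs_infty_ger.
- move=> i s ni /andP[isx si].
  have i0 : 0 <= i%:R * (t / n%:R) by rewrite mulr_ge0.
  rewrite ger0_norm ?subr_ge0 ?nz// lerD2r; apply: nz => //.
  exact: le_trans isx.
Unshelve. all: by end_near. Qed.

Definition left_step z (h : R) (n : nat) (s : R) :=
  \sum_(i < n) z (i%:R * h) * \1_(`]i%:R * h, i.+1%:R * h]%classic) s.

Lemma grid_cell (h : R) (n : nat) (s : R) : 0 < h -> 0 < s -> s <= n%:R * h ->
  exists2 i : 'I_n, i%:R * h < s <= i.+1%:R * h &
    forall j : 'I_n, j != i -> ~ (j%:R * h < s <= j.+1%:R * h).
Proof.
move=> h0 s0; elim: n => [|n ih]; first by rewrite mul0r leNgt s0.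
have [sn _|sn sn1] := leP s (n%:R * h).
  have [i si iu] := ih sn; exists (widen_ord (leqnSn n) i) => //= j ji.
  have [jn|jn] := ltnP j n.
    by apply: (iu (Ordinal jn)); apply: contra ji => /eqP ji; apply/eqP/val_inj/(congr1 val ji).
  have -> : j = n :> nat by apply/eqP; rewrite eqn_leq jn -ltnS ltn_ord.
  by move=> /andP[]; rewrite ltNge sn.
exists ord_max => /=; first by rewrite sn.
move=> j jn /andP[_ sj]; have {}jn : (j < n)%N.
  by rewrite ltn_neqAle -ltnS ltn_ord andbT; apply: contra jn => /eqP e; apply/eqP/val_inj.
have : j.+1%:R * h <= n%:R * h by rewrite ler_pM2r// ler_nat.
lra.
Qed.

Lemma sum_cell (h : R) (n : nat) (s : R) (c : nat -> R) (i : 'I_n) :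
  i%:R * h < s <= i.+1%:R * h ->
  (forall j : 'I_n, j != i -> ~ (j%:R * h < s <= j.+1%:R * h)) ->
  \sum_(j < n) c j * \1_(`]j%:R * h, j.+1%:R * h]%classic) s = c i.
Proof.
move=> si iu; rewrite (bigD1 i)//= big1 ?addr0.
  by rewrite indicE mem_set ?mulr1//= in_itv.
by move=> j ji; rewrite indicE memNset ?mulr0//= in_itv/=; exact: iu.
Qed.

Lemma measurable_left_step z (h : R) n : measurable_fun setT (left_step z h n).
Proof.
by apply: measurable_sum => i; exact: measurable_funM.
Qed.

Lemma integral_cells (h : R) (n : nat) (b : nat -> R) : 0 < h ->
  (forall i, 0 <= b i) ->
  (\int[mu]_(s in `]0%R, (n%:R * h)%R])
     (\sum_(i < n) b i * \1_(`](i%:R * h)%R, (i.+1%:R * h)%R]%classic) s)%R%:E =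
   ((\sum_(i < n) b i) * h)%R%:E)%E.
Proof.
move=> h0 b0.
have m i : measurable_fun setT (fun s : R =>
    (b i * \1_(`](i%:R * h)%R, (i.+1%:R * h)%R]%classic) s)%:E : \bar R).
  by apply/measurable_EFinP; exact: measurable_funM.
under eq_integral do rewrite -sumEFin.
rewrite ge0_integral_sum//; last 2 first.
- by move=> i; apply: measurable_funTS; exact: m.
- by move=> i s _; rewrite lee_fin mulr_ge0// indicE.
rewrite mulr_suml -sumEFin; apply: eq_bigr => i _.
under eq_integral do rewrite EFinM.
rewrite ge0_integralZl//; last 2 first.
- by apply/measurable_EFinP/measurable_funTS; exact: measurable_indic.
- by rewrite lee_fin.
rewrite integral_indic// EFinM; congr (_ * _)%E.
rewrite setIidl; last first.
  move=> s; rewrite /= !in_itv/= => /andP[isx si]; apply/andP; split.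
    by apply: le_lt_trans isx; rewrite mulr_ge0// ltW.
  by apply: le_trans si _; rewrite ler_pM2r// ler_nat.
rewrite /= lebesgue_measure_itv/= lte_fin ltr_pM2r// ltr_nat ltnSn.
by rewrite -EFinB -natr1 mulrDl mul1r addrAC subrr add0r.
Qed.

(** Riemann sums against the Lebesgue integral, in both forms in which they
    are used: for [z] itself, and for the mean square error of the step
    function that a simple integrand realizes. *)
Lemma left_step_error z t (M : R) : 0 <= t -> measurable_fun `[0, t]%classic z ->
  (forall s, 0 <= s <= t -> `|z s| <= M) -> small_osc z t ->
  forall e : R, 0 < e -> \forall n \near \oo,
    (\int[mu]_(s in `[0%R, t]) (`|left_step z (t / n%:R) n s - z s|)%:E <= e%:E)%E /\
    (\int[mu]_(s in `[0%R, t]) ((left_step z (t / n%:R) n s - z s) ^+ 2)%:E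
       <= (2 * M * e)%:E)%E.
Proof.
move=> t0 mz zM oz e e0.
have M0 : 0 <= M by apply: le_trans (zM 0 _); rewrite ?lexx.
have [t00|tn0] := eqVneq t 0.
  apply: nearW => n; subst t; rewrite set_itv1 !integral_set1.
  by rewrite lee_fin ltW// lee_fin !mulr_ge0// ltW.
have {}t0 : 0 < t by rewrite lt_neqAle eq_sym tn0.
near=> n.
have n0 : (0 < n)%N by near: n; exact: nbhs_infty_gt.
have n0R : 0 < n%:R :> R by rewrite ltr0n.
have [b [b0 be bz]] : exists b : nat -> R, [/\ forall i, 0 <= b i,
    (\sum_(i < n) b i) * (t / n%:R) <= e &
    forall i s, (i < n)%N -> i%:R * (t / n%:R) <= s <= i.+1%:R * (t / n%:R) ->
      `|z s - z (i%:R * (t / n%:R))| <= b i] by near: n; exact: oz.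
have hE : t = n%:R * (t / n%:R) by rewrite mulrC divfK// gt_eqF.
have h0 : 0 < t / n%:R by rewrite divr_gt0.
set h := t / n%:R in be bz hE h0 *.
pose B (s : R) := \sum_(i < n) b i * \1_(`]i%:R * h, i.+1%:R * h]%classic) s.
have mB : measurable_fun setT B.
  by apply: measurable_sum => i; exact: measurable_funM.
have key s : 0 < s <= t -> `|left_step z h n s - z s| <= B s /\
    (left_step z h n s - z s) ^+ 2 <= 2 * M * B s.
  move=> /andP[s0 st]; have [|i si iu] := @grid_cell h n s h0 s0.
    by rewrite -hE.
  rewrite /left_step (sum_cell (fun i => z (i%:R * h)) si iu) /B (sum_cell b si iu).
  have si' : i%:R * h <= s <= i.+1%:R * h by move: si => /andP[/ltW -> ->].
  have lb : `|z (i%:R * h) - z s| <= b i by rewrite distrC; exact: bz.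
  split => //; rewrite -real_normK ?num_real// expr2.
  apply: ler_pM => //; apply: le_trans (ler_normB _ _) _.
  have [i0 _ _] := grid_bounds (ltW t0) (ltn_ord i) si'.
  have zi : `|z (i%:R * h)| <= M.
    by apply: zM; rewrite i0/=; apply: le_trans st; case/andP : si'.
  have zs : `|z s| <= M by apply: zM; rewrite ltW.
  by lra.
have md : measurable_fun `[0, t]%classic (fun s => left_step z h n s - z s).
  apply: measurable_funB => //; apply: measurable_funTS.
  exact: measurable_left_step.
have sub : `]0, t]%classic `<=` `[0, t]%classic.
  by move=> s /=; rewrite !in_itv/= => /andP[/ltW -> ->].
have mB' : measurable_fun `]0%R, t]%classic (fun s => (B s)%:E).
  by apply/measurable_EFinP; exact: measurable_funTS.
have IB : (\int[mu]_(s in `]0%R, t]) (B s)%:E <= e%:E)%E.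
  have := integral_cells n h0 b0; rewrite -hE => ->.
  by rewrite lee_fin.
split.
- have m1 : measurable_fun `[0, t]%classic (fun s => (`|left_step z h n s - z s|)%:E).
    by apply/measurable_EFinP; exact: measurableT_comp.
  rewrite -integral_itv_obnd_cbnd; last exact: measurable_funS m1.
  apply: le_trans IB; apply: ge0_le_integral => //.
  + exact: measurable_funS m1.
  + by move=> s; rewrite /= in_itv/= => /key[].
- have m1 : measurable_fun `[0, t]%classic
      (fun s => ((left_step z h n s - z s) ^+ 2)%:E).
    by apply/measurable_EFinP; exact: measurable_funX.
  rewrite -integral_itv_obnd_cbnd; last exact: measurable_funS m1.
  apply: (@le_trans _ _ (\int[mu]_(s in `]0%R, t]) ((2 * M)%:E * (B s)%:E))%E).
    apply: ge0_le_integral => //.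
    + by move=> s _; rewrite lee_fin sqr_ge0.
    + exact: measurable_funS m1.
    + by apply: emeasurable_funM.
    + by move=> s; rewrite /= in_itv/= -EFinM lee_fin => /key[].
  rewrite ge0_integralZl//; last 2 first.
  + move=> s _; rewrite lee_fin sumr_ge0// => i _.
    by rewrite mulr_ge0// indicE.
  + by rewrite lee_fin mulr_ge0.
  rewrite [leRHS]EFinM; apply: lee_wpmul2l => //.
  by rewrite lee_fin mulr_ge0.
Unshelve. all: by end_near. Qed.

End paths.

(** * Time integrals of processes *)

Section time_integrals.
Context {d : measure_display} {Omega : measurableType d} {R : realType}.
Variable P : probability Omega R.
Notation mu := (@lebesgue_measure R).
Notation TO := (measurableTypeR R * Omega)%type.

(** Right-continuous processes are jointly measurable: they are limits of the
    processes frozen at the right end of the cells of a fine grid. *)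
Lemma right_continuous_measurable (Y : R -> Omega -> R) :
  (forall t, 0 <= t -> measurable_fun setT (Y t)) ->
  (forall w, right_continuous_path (Y ^~ w)) ->
  measurable_fun setT (fun z : TO => if 0 <= z.1 then Y z.1 z.2 else 0).
Proof.
move=> mY rY.
pose h n (z : TO) := \sum_(k < n.+1 * n.+1)
  Y (k.+1%:R / n.+1%:R) z.2 *
  \1_(`[(k%:R / n.+1%:R), (k.+1%:R / n.+1%:R)[%classic) z.1.
apply: (@measurable_fun_cvg _ _ _ _ h) => [n|[s w] _].
  apply: measurable_sum => k; apply: measurable_funM.
    apply: (measurableT_comp (f := Y (k.+1%:R / n.+1%:R))).
      by apply: mY; rewrite divr_ge0.
    exact: measurable_snd.
  have m1 : measurable_fun (T := measurableTypeR R) setT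
      (\1_(`[(k%:R / n.+1%:R), (k.+1%:R / n.+1%:R)[%classic) : R -> R).
    exact: measurable_indic.
  exact: (measurableT_comp m1 measurable_fst).
rewrite /=; case: ifPn => [s0|]; last first.
  rewrite -ltNge => s0; rewrite (_ : h ^~ _ = fun=> 0); first exact: cvg_cst.
  apply/funext => n; rewrite /h big1// => k _ /=.
  rewrite indicE memNset ?mulr0//= in_itv/= => /andP[ks _].
  have k0 : 0 <= k%:R / n.+1%:R :> R by rewrite divr_ge0.
  by have := le_lt_trans (le_trans k0 ks) s0; rewrite ltxx.
pose u n : R := (Num.truncn (s * n.+1%:R)).+1%:R / n.+1%:R.
have us n : s < u n by rewrite ltr_pdivlMr ?ltr0n// truncnS_gt.
have su n : u n <= s + n.+1%:R^-1.
  rewrite ler_pdivrMr ?ltr0n// mulrDl mulVf ?gt_eqF ?ltr0n// -natr1 lerD2r.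
  by rewrite truncn_le mulr_ge0.
have uE : \forall n \near \oo, h n (s, w) = Y (u n) w.
  near=> n; rewrite /h/=.
  have kn : (Num.truncn (s * n.+1%:R) < n.+1 * n.+1)%N.
    rewrite truncn_lt_nat ?mulr_ge0// natrM ltr_pM2r ?ltr0n//.
    by near: n; exists (Num.truncn s) => // n /= sn; apply: lt_le_trans (truncnS_gt _) _;
      rewrite ler_nat ltnS.
  rewrite (bigD1 (Ordinal kn))//= big1 ?addr0.
    rewrite indicE mem_set ?mulr1//= in_itv/= us andbT.
    by rewrite ler_pdivrMr ?ltr0n// truncn_le mulr_ge0.
  move=> k kE; rewrite indicE memNset ?mulr0//= in_itv/=.
  rewrite ler_pdivrMr ?ltr0n// ltr_pdivlMr ?ltr0n// => H.
  by move/eqP : kE; apply; apply/val_inj => /=; rewrite (truncn_def H).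
apply: (@cvg_trans _ (Y (u n) w @[n --> \oo])).
  by apply: near_eq_cvg; apply: filterS uE => n ->.
have cu : u n @[n --> \oo] --> s^'+.
  move=> A [e /= e0 eA]; suff : \forall n \near \oo, A (u n) by [].
  near=> n; apply: eA; [|exact: us].
  rewrite /ball_/= distrC gtr0_norm ?subr_gt0 ?us//.
  rewrite ltrBlDl; apply: le_lt_trans (su n) _; rewrite ltrD2l.
  by near: n; exact: near_infty_natSinv_lt (PosNum e0).
exact: cvg_comp cu (rY w s s0).
Unshelve. all: by end_near. Qed.

(** The paths that fail to be right-continuous form a null set, on which the
    process is replaced by [0]. *)
Lemma joint_version (Y : R -> Omega -> R) : P.-negligible `<=` measurable ->
  (forall t, 0 <= t -> measurable_fun setT (Y t)) ->
  {ae P, forall w, right_continuous_path (Y ^~ w)} ->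
  exists Y' : TO -> R, measurable_fun setT Y' /\
    {ae P, forall w, forall t, 0 <= t -> Y' (t, w) = Y t w}.
Proof.
move=> Pc mY rY; pose O := [set w | right_continuous_path (Y ^~ w)].
have mO : measurable O.
  by rewrite -(setCK O); apply: measurableC; exact: Pc.
pose Y0 t w := Y t w * \1_O w.
exists (fun z : TO => if 0 <= z.1 then Y0 z.1 z.2 else 0); split.
  apply: right_continuous_measurable.
    move=> t t0; apply: measurable_funM; first exact: mY.
    exact: measurable_indic.
  move=> w t t0; rewrite /Y0; have [Ow|nOw] := pselect (O w).
    by rewrite indicE mem_set// mulr1; under eq_fun do rewrite mulr1; exact: Ow.
  by rewrite indicE memNset// mulr0; under eq_fun do rewrite mulr0; exact: cvg_cst.
apply: filterS rY => w Ow t t0; rewrite /= t0 /Y0 indicE mem_set ?mulr1//.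
Qed.

Definition strip (T : R) : set TO := `[0, T]%classic `*` setT.

Lemma measurable_strip T : measurable (strip T).
Proof. exact: measurableX. Qed.
Hint Resolve measurable_strip : core.

Lemma strip_patch T (f : TO -> \bar R) s w :
  (f \_ (strip T)) (s, w) = ((fun s => f (s, w)) \_ `[0, T]%classic) s.
Proof.
rewrite /patch; congr (if _ then _ else _).
by apply/idP/idP => /set_mem h; apply/mem_set; [case: h|split].
Qed.

Lemma strip_tonelli T (f : TO -> \bar R) : measurable_fun setT f ->
  (forall z, 0 <= f z)%E ->
  (\int[mu \x P]_(z in strip T) f z =
   \int[P]_w \int[mu]_(s in `[0%R, T]) f (s, w))%E.
Proof.
move=> mf f0; rewrite integral_mkcond fubini_tonelli2.
- apply: eq_integral => w _; rewrite [RHS]integral_mkcond /fubini_G.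
  by apply: eq_integral => s _; rewrite strip_patch.
- by apply/(measurable_restrictT _ _).1 => //; exact: measurable_funTS.
- by move=> z; rewrite /patch; case: ifP.
Qed.

Lemma strip_tonelli' T (f : TO -> \bar R) : measurable_fun setT f ->
  (forall z, 0 <= f z)%E ->
  (\int[mu \x P]_(z in strip T) f z =
   \int[mu]_(s in `[0%R, T]) \int[P]_w f (s, w))%E.
Proof.
move=> mf f0; rewrite integral_mkcond fubini_tonelli1.
- rewrite [RHS]integral_mkcond; apply: eq_integral => s _; rewrite /fubini_F.
  rewrite /patch; case: ifPn => sT.
    apply: eq_integral => w _; rewrite ifT//.
    by move: sT; rewrite !inE /strip/=.
  apply: integral0_eq => w _; rewrite ifF//; apply/negbTE; move: sT.
  by rewrite !notin_setE /strip/= => h [].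
- by apply/(measurable_restrictT _ _).1 => //; exact: measurable_funTS.
- by move=> z; rewrite /patch; case: ifP.
Qed.

Lemma measurable_path_integral T (f : TO -> \bar R) : measurable_fun setT f ->
  (forall z, 0 <= f z)%E ->
  measurable_fun setT (fun w => \int[mu]_(s in `[0%R, T]) f (s, w))%E.
Proof.
move=> mf f0.
have mp : measurable_fun setT (f \_ (strip T)).
  by apply/(measurable_restrictT _ _).1 => //; exact: measurable_funTS.
have p0 z : (0 <= (f \_ (strip T)) z)%E by rewrite /patch; case: ifP.
have := @measurable_fun_fubini_tonelli_G _ _ _ _ _ mu _ mp p0.
rewrite /fubini_G; apply: eq_measurable_fun => w _.
by rewrite [RHS]integral_mkcond; apply: eq_integral => s _; rewrite strip_patch.
Qed.

(** The real-valued inner integral is [0] by convention when it diverges, which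
    happens on a null set only. *)
Lemma strip_fubini T (f : TO -> R) : measurable_fun setT f ->
  (\int[mu \x P]_(z in strip T) (`|f z|)%:E < +oo)%E ->
  [/\ P.-integrable setT
        (fun w => (\int[mu]_(s in `[0%R, T]) f (s, w))%R%:E),
      (\int[P]_w (\int[mu]_(s in `[0%R, T]) f (s, w))%R%:E =
       \int[mu \x P]_(z in strip T) (f z)%:E)%E &
      (mu \x P)%E.-integrable (strip T) (EFin \o f)].
Proof.
move=> mf finf.
have mF : measurable_fun setT (EFin \o f) by exact/measurable_EFinP.
have iS : (mu \x P)%E.-integrable (strip T) (EFin \o f).
  by apply/integrableP; split => //; exact: measurable_funTS.
pose F := (EFin \o f) \_ (strip T).
have iF : (mu \x P)%E.-integrable setT F.
  by rewrite /F -integrable_mkcond.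
have GE w : fubini_G mu F w = (\int[mu]_(s in `[0%R, T]) (f (s, w))%:E)%E.
  rewrite /fubini_G [RHS]integral_mkcond; apply: eq_integral => s _.
  by rewrite /F strip_patch.
have iG : P.-integrable setT (fubini_G mu F).
  apply/integrableP; split; first exact: measurable_fubini_G iF.
  have mFF : measurable_fun setT F by exact: measurable_int iF.
  have Hfin := (@integrable21ltyP _ _ _ _ _ mu P F mFF).1 iF.
  apply: le_lt_trans Hfin.
  have mA : measurable_fun setT (abse \o F) by exact: measurableT_comp.
  apply: ge0_le_integral => //.
  - by apply: measurableT_comp => //; exact: measurable_fubini_G iF.
  - by apply: (@measurable_fun_fubini_tonelli_G _ _ _ _ _ mu (abse \o F)) => // z; exact: abse_ge0.
  - move=> w _; apply: le_abse_integral => //.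
    exact: (@measurable_fun_pair1 _ _ _ _ _ _ F w mFF).
have ae_fin : {ae P, forall w, (\int[mu]_(s in `[0%R, T]) f (s, w))%R%:E =
    fubini_G mu F w}.
  have := integrable_ae measurableT iG; apply: filterS => w /(_ I) fin.
  by rewrite /Rintegral -GE fineK.
have mR : measurable_fun setT
    (fun w => (\int[mu]_(s in `[0%R, T]) f (s, w))%R%:E).
  apply/measurable_EFinP; rewrite (_ : (fun _ => _) = fine \o fubini_G mu F).
    apply: measurableT_comp; last exact: measurable_int iG.
    exact: (fine_measurable measurableT).
  by apply/funext => w; rewrite /= GE.
split => //.
- apply/integrableP; split => //; move/integrableP : iG => [mG].
  apply: le_lt_trans; rewrite le_eqVlt; apply/orP; left; apply/eqP.
  apply: ae_eq_integral => //; try by apply: measurableT_comp.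
  by apply: filterS ae_fin => w h _; rewrite h.
- transitivity (\int[P]_w fubini_G mu F w)%E.
    apply: ae_eq_integral => //; first exact: measurable_int iG.
    by apply: filterS ae_fin => w h _.
  by rewrite integral21_prod_meas1// [RHS]integral_mkcond.
Qed.

End time_integrals.

(** * The Ito integral as a limit of Riemann sums *)

Section clamp.
Context {R : realType}.

Definition clamp (M x : R) := Num.max (- M) (Num.min M x).

Lemma clamp_le (M x : R) : 0 <= M -> `|clamp M x| <= M.
Proof.
move=> M0; rewrite ler_norml /clamp le_max lexx/= ge_max ge_min lexx andbT.
by lra.
Qed.

Lemma clamp_id (M x : R) : `|x| <= M -> clamp M x = x.
Proof.
rewrite ler_norml => /andP[xM Mx]; rewrite /clamp (min_idPr _)//.
by rewrite (max_idPr _).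
Qed.

Lemma clamp_lip (M x y : R) : 0 <= M -> `|clamp M x - clamp M y| <= `|x - y|.
Proof.
move=> M0; rewrite /clamp /Num.max /Num.min ler_norml.
have := ler_norm (x - y); have := ler_norm (y - x); rewrite (distrC y x).
by do ![case: ifPn]; rewrite -?leNgt => *; lra.
Qed.

Lemma clamp_norm_le (M x : R) : 0 <= M -> `|clamp M x| <= `|x|.
Proof.
move=> M0; have := @clamp_lip M x 0 M0.
by rewrite (@clamp_id M 0) ?normr0// !subr0.
Qed.

Lemma measurable_clamp (M : R) : measurable_fun setT (clamp M).
Proof. by apply: measurable_maxr => //; exact: measurable_minr. Qed.

End clamp.

Section measurable_wrt_theory.
Context {d : measure_display} {Omega : measurableType d} {R : realType}.
Variable G : set (set Omega).
Hypothesis sG : sigma_algebra setT G.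

Lemma measurable_wrtP (f : Omega -> R) : measurable_wrt G f <->
  measurable_fun (T := g_sigma_algebraType G) setT f.
Proof.
have GE : <<s G>> = G by exact: sigma_algebra_id.
split=> [Gf _ B mB|mf B mB].
  by rewrite setTI /measurable/= GE; exact: Gf.
by have := mf measurableT B mB; rewrite setTI /measurable/= GE.
Qed.

Lemma measurable_wrtD f g : measurable_wrt G f -> measurable_wrt G g ->
  measurable_wrt G (fun w => f w + g w : R).
Proof.
by move=> /measurable_wrtP mf /measurable_wrtP mg; apply/measurable_wrtP/measurable_funD.
Qed.

Lemma measurable_wrtB f g : measurable_wrt G f -> measurable_wrt G g ->
  measurable_wrt G (fun w => f w - g w : R).
Proof.
by move=> /measurable_wrtP mf /measurable_wrtP mg; apply/measurable_wrtP/measurable_funB.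
Qed.

Lemma measurable_wrtM f g : measurable_wrt G f -> measurable_wrt G g ->
  measurable_wrt G (fun w => f w * g w : R).
Proof.
by move=> /measurable_wrtP mf /measurable_wrtP mg; apply/measurable_wrtP/measurable_funM.
Qed.

Lemma measurable_wrt_cst (c : R) : measurable_wrt G (fun=> c).
Proof. exact/measurable_wrtP/measurable_cst. Qed.

Lemma measurable_wrt_sum (n : nat) (f : nat -> Omega -> R) :
  (forall i, (i < n)%N -> measurable_wrt G (f i)) ->
  measurable_wrt G (fun w => \sum_(i < n) f i w).
Proof.
elim: n => [_|n ih mf].
  by under [X in measurable_wrt _ X]eq_fun do rewrite big_ord0; exact: measurable_wrt_cst.
under [X in measurable_wrt _ X]eq_fun do rewrite big_ord_recr/=.
by apply: measurable_wrtD; [apply: ih => i /ltnW|]; exact: mf.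
Qed.

Lemma measurable_wrt_comp (phi : R -> R) f : measurable_fun setT phi ->
  measurable_wrt G f -> measurable_wrt G (fun w => phi (f w)).
Proof.
by move=> mphi /measurable_wrtP mf; apply/measurable_wrtP; exact: (measurableT_comp mphi mf).
Qed.

End measurable_wrt_theory.

Section ito_riemann_sums.
Context {d : measure_display} {Omega : measurableType d} {R : realType}.
Variables (P : probability Omega R) (F0m : set (set Omega)).
Variables (F : R -> set (set Omega)) (W : R -> Omega -> R).
Hypothesis F_usual : usual_filtration P F0m F.
Hypothesis W_bm : brownian_motion P F W.
Notation mu := (@lebesgue_measure R).
Notation TO := (measurableTypeR R * Omega)%type.
Implicit Types Z : R -> Omega -> R.

Lemma usual_complete : P.-negligible `<=` measurable.
Proof.
move=> N /(uf_complete F_usual)/(uf_incr0m F_usual).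
exact: (uf_sub F_usual (lexx 0)).
Qed.

Lemma adapted_measurable Z : adapted F Z ->
  forall t, 0 <= t -> measurable_fun setT (Z t).
Proof.
move=> aZ t t0; apply: (@measurable_wrtW _ _ _ (F t)); last exact: aZ.
exact: (uf_sub F_usual).
Qed.


(** The path regularity that makes left Riemann sums converge. *)
Definition tame Z := {ae P, forall w, forall t, 0 <= t ->
  (exists M, forall s, 0 <= s <= t -> `|Z s w| <= M) /\ small_osc (Z ^~ w) t}.

Definition rsum Z (h : R) (n : nat) (w : Omega) :=
  \sum_(k < n) Z (k%:R * h) w * (W (k.+1%:R * h) w - W (k%:R * h) w).

Lemma measurable_rsum Z (h : R) n : adapted F Z -> 0 <= h ->
  measurable_fun setT (rsum Z h n).
Proof.
move=> aZ h0; apply: measurable_sum => k; apply: measurable_funM.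
  by apply: (adapted_measurable aZ); rewrite mulr_ge0.
by apply: measurable_funB; apply: (adapted_measurable (bm_adapted W_bm));
  rewrite mulr_ge0.
Qed.

(** Choosing the clamped left Riemann sums as approximating simple processes
    identifies the Ito integral as a limit of Riemann sums; the clamping only
    serves to make the coefficients bounded, and is eventually inactive along
    each path. *)
Lemma ito_rsum Z (t : R) (I : Omega -> R) : 0 <= t -> adapted F Z ->
  {ae P, forall w, right_continuous_path (Z ^~ w)} -> tame Z ->
  measurable_fun setT I -> is_ito_integral P F W Z t I ->
  cvgP0 P (fun n w => rsum Z (t / n%:R) n w - I w).
Proof.
move=> t0 aZ rZ tZ mI [_ ito].
pose tau n i := i%:R * (t / n%:R) : R.
have tau0 n i : 0 <= tau n i by rewrite mulr_ge0// divr_ge0.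
pose Hn n := SimpleProcess n (tau n) (fun i w => clamp n%:R (Z (tau n i) w)).
have mW s : 0 <= s -> measurable_fun setT (W s).
  exact: (adapted_measurable (bm_adapted W_bm)).
have mZ s : 0 <= s -> measurable_fun setT (Z s) by exact: adapted_measurable.
have mc n i : measurable_fun setT (fun w => clamp n%:R (Z (tau n i) w)).
  by apply: (measurableT_comp (@measurable_clamp R n%:R)); exact: mZ.
have [Z' [mZ' ZZ']] := joint_version usual_complete mZ rZ.
have Hap : approximates P F Hn Z t.
  split.
    move=> n; split => /=.
    - exact: tau0.
    - by move=> i _; apply: ler_wpM2r; rewrite ?divr_ge0// ler_nat.
    - move=> i _; apply: measurable_wrt_comp; last exact: aZ.
        exact: (uf_sigma F_usual).
      exact: measurable_clamp.
    - by move=> i _; exists n%:R => w; exact: clamp_le.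
  apply: ae_cvg_in_probability.
    move=> n; apply: (@complete_measurable_fun _ _ _ _ usual_complete _ _
      (fun w => \int[mu]_(s in `[0%R, t])
         ((simple_value (Hn n) s w - Z' (s, w)) ^+ 2)%:E)%E).
      apply: (@measurable_path_integral _ _ _ t
        (fun z : TO => ((simple_value (Hn n) z.1 z.2 - Z' z) ^+ 2)%:E)); last first.
        by move=> z; rewrite lee_fin sqr_ge0.
      apply/measurable_EFinP; apply: measurable_funX; apply: measurable_funB => //.
      apply: measurable_sum => k; apply: measurable_funM.
        exact: (measurableT_comp (mc n k) measurable_snd).
      have m1 : measurable_fun (T := measurableTypeR R) setT
          (\1_(`]tau n k, tau n k.+1]%classic) : R -> R).
        exact: measurable_indic.
      exact: (measurableT_comp m1 measurable_fst).
    apply: filterS ZZ' => w ZZ'w; apply: eq_integral => s.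
    by rewrite inE/= in_itv/= => /andP[s0 _]; rewrite ZZ'w.
  apply: filterS2 tZ ZZ' => w tZw ZZ'w e e0.
  have [[M ZM] oZ] := tZw t t0.
  have M0 : 0 <= M by apply: le_trans (ZM 0 _); rewrite ?lexx.
  have mZw : measurable_fun `[0, t]%classic (Z ^~ w).
    apply: (@eq_measurable_fun _ _ _ _ _ (fun s => Z' (s, w))).
      by move=> s; rewrite inE/= in_itv/= => /andP[s0 _]; rewrite ZZ'w.
    apply: measurable_funTS; exact: (@measurable_fun_pair1 _ _ _ _ _ _ Z' w mZ').
  have e'0 : 0 < e / (4 * (M + 1)) by rewrite divr_gt0// mulr_gt0//; lra.
  have err := left_step_error t0 mZw ZM oZ e'0.
  near=> n.
  have [_ L2] : (\int[mu]_(s in `[0%R, t])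
      (`|left_step (Z ^~ w) (t / n%:R) n s - Z s w|)%:E <= (e / (4 * (M + 1)))%:E)%E /\
    (\int[mu]_(s in `[0%R, t])
      ((left_step (Z ^~ w) (t / n%:R) n s - Z s w) ^+ 2)%:E
       <= (2 * M * (e / (4 * (M + 1))))%:E)%E by near: n; exact: err.
  have Mn : M <= n%:R by near: n; exact: nbhs_infty_ger.
  rewrite gee0_abs; last by apply: integral_ge0 => s _; rewrite lee_fin sqr_ge0.
  rewrite [ltLHS](_ : _ = \int[mu]_(s in `[0%R, t])
      ((left_step (Z ^~ w) (t / n%:R) n s - Z s w) ^+ 2)%:E)%E; last first.
    apply: eq_integral => s _; congr ((_ - _) ^+ 2)%:E; rewrite /simple_value /left_step /=.
    apply: eq_bigr => i _; congr (_ * _); apply: clamp_id; apply: le_trans Mn.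
    apply: ZM; rewrite tau0/=.
    have [|_ _ it] // := @grid_bounds R n i t (tau n i) t0 (ltn_ord i).
    by rewrite /tau lexx/= ler_wpM2r ?divr_ge0// ler_nat.
  apply: le_lt_trans L2 _; rewrite lte_fin.
  rewrite (_ : 2 * M * (e / (4 * (M + 1))) = e * (M / (2 * (M + 1)))); last first.
    by field; rewrite gt_eqF//; lra.
  by rewrite gtr_pMr// ltr_pdivrMr; lra.
have cI : cvgP0 P (fun n w => simple_integral W (Hn n) t w - I w).
  apply: cvg_in_probability_cvgP0; last exact: ito.
  move=> n; apply: measurable_funB => //; apply: measurable_sum => k.
  apply: measurable_funM; first exact: mc.
  by apply: measurable_funB; apply: mW; rewrite le_min t0 andbT tau0.
have cS : cvgP0 P (fun n w => rsum Z (t / n%:R) n w - simple_integral W (Hn n) t w).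
  apply: cvgP0_ae.
    move=> n; apply: measurable_funB; first by apply: measurable_rsum => //; exact: divr_ge0.
    apply: measurable_sum => k.
    apply: measurable_funM; first exact: mc.
    by apply: measurable_funB; apply: mW; rewrite le_min t0 andbT tau0.
  apply: filterS tZ => w /(_ t t0) [[M ZM] _].
  apply: cvg_near_cst; near=> n.
  have Mn : M <= n%:R by near: n; exact: nbhs_infty_ger.
  apply/eqP; rewrite subr_eq0; apply/eqP.
  apply: eq_bigr => i _ /=.
  have le_i : tau n i <= tau n i.+1 by rewrite ler_wpM2r ?divr_ge0// ler_nat.
  have [_ _ it] : [/\ 0 <= tau n i, 0 <= tau n i & tau n i <= t].
    by apply: (@grid_bounds R n i t (tau n i) t0 (ltn_ord i)); rewrite /tau lexx.
  have [_ _ i1t] : [/\ 0 <= tau n i, 0 <= tau n i.+1 & tau n i.+1 <= t].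
    by apply: (@grid_bounds R n i t (tau n i.+1) t0 (ltn_ord i)); rewrite /tau lexx andbT.
  rewrite !(min_idPl _)// clamp_id//.
  by apply: le_trans Mn; apply: ZM; rewrite tau0.
apply: cvgP0_le (cvgP0D cS cI) => n w.
by rewrite addrA subrK.
Unshelve. all: by end_near. Qed.

End ito_riemann_sums.

(** * Mean-square stability of the Euler scheme *)

Section euler_stability.
Context {d : measure_display} {Omega : measurableType d} {R : realType}.
Variables (P : probability Omega R) (F0m : set (set Omega)).
Variables (F : R -> set (set Omega)) (W : R -> Omega -> R).
Hypothesis F_usual : usual_filtration P F0m F.
Hypothesis W_bm : brownian_motion P F W.
Variables delta sigma : R.

Definition L2sq (f : Omega -> R) : \bar R := (\int[P]_w (f w ^+ 2)%:E)%E.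

Lemma L2sq_ge0 f : (0 <= L2sq f)%E.
Proof. by apply: integral_ge0 => w _; rewrite lee_fin sqr_ge0. Qed.

Lemma L2sq_le_comb (f U V : Omega -> R) (a b u v : R) : 0 <= a -> 0 <= b ->
  measurable_fun setT f -> measurable_fun setT U -> measurable_fun setT V ->
  (forall w, f w ^+ 2 <= a * U w ^+ 2 + b * V w ^+ 2) ->
  (L2sq U <= u%:E)%E -> (L2sq V <= v%:E)%E -> (L2sq f <= (a * u + b * v)%:E)%E.
Proof.
move=> a0 b0 mf mU mV le Uu Vv.
have m2 (g : Omega -> R) : measurable_fun setT g ->
    measurable_fun setT (fun w => (g w ^+ 2)%:E).
  by move=> mg; apply/measurable_EFinP; exact: measurable_funX.
apply: (@le_trans _ _ (\int[P]_w (a%:E * (U w ^+ 2)%:E + b%:E * (V w ^+ 2)%:E))%E).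
  apply: ge0_le_integral => //.
  - by move=> w _; rewrite lee_fin sqr_ge0.
  - exact: m2.
  - apply: emeasurable_funD; apply: emeasurable_funM => //; exact: m2.
  - by move=> w _; rewrite -!EFinM -EFinD lee_fin.
rewrite ge0_integralD//; last 4 first.
- by move=> w _; rewrite -EFinM lee_fin mulr_ge0// sqr_ge0.
- by apply: emeasurable_funM => //; exact: m2.
- by move=> w _; rewrite -EFinM lee_fin mulr_ge0// sqr_ge0.
- by apply: emeasurable_funM => //; exact: m2.
rewrite !ge0_integralZl//; try by [exact: m2 | move=> w _; rewrite lee_fin sqr_ge0].
by rewrite EFinD !EFinM; apply: leeD; apply: lee_wpmul2l.
Qed.

Definition euler_const (T : R) := 1 + delta ^+ 2 * (1 + T) + 8 * sigma ^+ 2.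

Lemma euler_const_ge0 T : 0 <= T -> 0 <= euler_const T.
Proof.
move=> T0; rewrite /euler_const.
have := sqr_ge0 delta; have := sqr_ge0 sigma => s2 d2.
by rewrite !addr_ge0// mulr_ge0// addr_ge0.
Qed.

(** With [h = t - s], the drift costs [(1 + h) U^2 + delta^2 (h + h^2) V^2] in
    square mean and the noise [8 sigma^2 h V^2], the cross term being killed by
    symmetry. *)
Lemma euler_step (s t T u v : R) (U V : Omega -> R) : 0 <= s -> s < t -> t - s <= T ->
  measurable_wrt (F s) U -> measurable_wrt (F s) V ->
  (L2sq U <= u%:E)%E -> (L2sq V <= v%:E)%E ->
  (L2sq (fun w => U w + V w * (- delta * (t - s) + sigma * (W t w - W s w)))%R <=
   ((1 + euler_const T * (t - s)) * u + euler_const T * (t - s) * v)%:E)%E.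
Proof.
move=> s0 st hT mU mV Uu Vv; pose h := t - s.
have h0 : 0 < h by rewrite subr_gt0.
have sF := uf_sigma F_usual s0; have Fm := uf_sub F_usual s0.
have nW := brownian_noise (uf_sub F_usual) W_bm s0 st.
pose Q w := U w - delta * h * V w; pose V' w := sigma * V w.
have mc c f : measurable_wrt (F s) f -> measurable_wrt (F s) (fun w => c * f w).
  by move=> mf; apply: measurable_wrtM => //; exact: measurable_wrt_cst.
have mQ : measurable_wrt (F s) Q by apply: measurable_wrtB => //; exact: mc.
have mV' : measurable_wrt (F s) V' by exact: mc.
have step := noise_step Fm nW mQ mV' (measurable_wrtM sF mQ mV').
rewrite (_ : L2sq _ = L2sq (fun w => Q w + V' w * (W t \- W s) w)); last first.
  apply: eq_integral => w _; congr ((_ ^+ 2)%:E).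
  by rewrite /Q /V' /h/=; ring.
apply: le_trans step _.
have gm f : measurable_wrt (F s) f -> measurable_fun setT f by exact: measurable_wrtW.
have Q2 : (L2sq Q <= ((1 + h) * u + (delta ^+ 2 * (h + h ^+ 2)) * v)%:E)%E.
  apply: (@L2sq_le_comb Q U V (1 + h) (delta ^+ 2 * (h + h ^+ 2))) => //.
  - by rewrite addr_ge0// ltW.
  - by rewrite mulr_ge0 ?sqr_ge0// addr_ge0 ?sqr_ge0// ltW.
  - exact: gm.
  - exact: gm.
  - exact: gm.
  - move=> w; rewrite /Q.
    have := sqr_ge0 (U w + delta * V w) => /(ler_wpM2l (ltW h0)).
    rewrite mulr0; set a := U w; set b := V w => k; lra.
have V2 : (L2sq V' <= (sigma ^+ 2 * v + 0 * v)%:E)%E.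
  apply: (@L2sq_le_comb V' V V (sigma ^+ 2) 0) => //.
  - exact: sqr_ge0.
  - exact: gm.
  - exact: gm.
  - exact: gm.
  - by move=> w; rewrite /V' exprMn mul0r addr0.
have V20 : (0 <= (8 * h)%:E)%E by rewrite lee_fin mulr_ge0// ltW.
apply: le_trans (leeD Q2 (lee_wpmul2l V20 V2)) _.
rewrite -EFinM -EFinD lee_fin /euler_const -/h.
have u0 : 0 <= u by rewrite -lee_fin; exact: le_trans (L2sq_ge0 U) Uu.
have v0 : 0 <= v by rewrite -lee_fin; exact: le_trans (L2sq_ge0 V) Vv.
have d2 := sqr_ge0 delta; have s2 := sqr_ge0 sigma.
have T0 : 0 <= T by apply: le_trans hT; exact: ltW.
have E1 : 0 <= (T - h) * (h * (delta ^+ 2 * v)).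
  apply: mulr_ge0; first by rewrite subr_ge0.
  by apply: mulr_ge0; [exact: ltW|exact: mulr_ge0].
have E2 : 0 <= (delta ^+ 2 * (1 + T) + 8 * sigma ^+ 2) * (h * u).
  apply: mulr_ge0; last by rewrite mulr_ge0// ltW.
  by rewrite addr_ge0// mulr_ge0// addr_ge0.
have E3 : 0 <= h * v by rewrite mulr_ge0// ltW.
lra.
Qed.

Section blocks.
Variables (h T : R) (m : nat) (c : nat -> Omega -> R).
Hypothesis h_gt0 : 0 < h.
Hypothesis h_le : h <= T.
Hypothesis c_meas : forall k, measurable_wrt (F (k%:R * h)) (c k).
Notation C := (euler_const T).

Definition incr (k : nat) (w : Omega) : R :=
  - delta * h + sigma * (W (k.+1%:R * h) w - W (k%:R * h) w).

(** The Euler recursion on blocks of [m] steps: the feedback coefficient is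
    frozen over a block while the forcing [c] keeps moving. *)
Fixpoint block_err (i : nat) (w : Omega) : R :=
  if i is j.+1 then
    block_err j w + \sum_(l < m)
      (block_err j w + (c (j * m + l) w - c (j * m)%N w)) * incr (j * m + l) w
  else 0.

(* The recursion interrupted after [j] steps of the block [i]. *)
Let inner i j w := block_err i w + \sum_(l < j)
  (block_err i w + (c (i * m + l) w - c (i * m)%N w)) * incr (i * m + l) w.

Let grid_ge0 k : 0 <= k%:R * h. Proof. by rewrite mulr_ge0// ltW. Qed.

Let grid_le (k l : nat) : (k <= l)%N -> k%:R * h <= l%:R * h.
Proof. by move=> kl; rewrite ler_pM2r// ler_nat. Qed.

Let wrtW k l (f : Omega -> R) : (k <= l)%N -> measurable_wrt (F (k%:R * h)) f ->
  measurable_wrt (F (l%:R * h)) f.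
Proof.
by move=> kl mf B mB; apply: (uf_incr F_usual (grid_ge0 k) (grid_le kl)); exact: mf.
Qed.

Lemma incr_wrt k : measurable_wrt (F (k.+1%:R * h)) (incr k).
Proof.
have sF := uf_sigma F_usual (grid_ge0 k.+1).
have aW := bm_adapted W_bm.
apply: measurable_wrtD => //; first exact: measurable_wrt_cst.
apply: measurable_wrtM => //; first exact: measurable_wrt_cst.
apply: measurable_wrtB => //; first exact: aW.
by apply: (wrtW (leqnSn k)); exact: aW.
Qed.

Let inner_wrt i j : measurable_wrt (F ((i * m)%:R * h)) (block_err i) ->
  measurable_wrt (F ((i * m + j)%:R * h)) (inner i j).
Proof.
move=> mb; have sF k := uf_sigma F_usual (grid_ge0 k).
apply: (measurable_wrtD (sF _)); first by apply: wrtW mb; exact: leq_addr.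
apply: (measurable_wrt_sum (sF _) (f := fun l w => (block_err i w +
  (c (i * m + l) w - c (i * m)%N w)) * incr (i * m + l) w)) => l lj.
apply: (measurable_wrtM (sF _)).
  apply: (measurable_wrtD (sF _)); first by apply: wrtW mb; exact: leq_addr.
  apply: (measurable_wrtB (sF _)).
    by apply: (wrtW _ (c_meas (i * m + l))); rewrite leq_add2l ltnW.
  by apply: (wrtW _ (c_meas (i * m))); exact: leq_addr.
by apply: (wrtW _ (@incr_wrt (i * m + l))); rewrite -addnS leq_add2l.
Qed.

Lemma block_err_wrt i : measurable_wrt (F ((i * m)%:R * h)) (block_err i).
Proof.
elim: i => [|i ih].
  by apply: measurable_wrt_cst; rewrite mul0n; exact: (uf_sigma F_usual (grid_ge0 0)).
by rewrite mulSnr; exact: (@inner_wrt i m ih).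
Qed.

Variable b : nat -> nat -> R.
Hypothesis b_bound : forall i l,
  (L2sq (fun w => c (i * m + l)%N w - c (i * m)%N w)%R <= (b i l)%:E)%E.

Let b_ge0 i l : 0 <= b i l.
Proof. by rewrite -lee_fin; exact: le_trans (L2sq_ge0 _) (b_bound i l). Qed.

Let Ch := C * h.
Let Ch0 : 0 <= Ch.
Proof.
by apply: mulr_ge0; [apply: euler_const_ge0; apply: le_trans h_le|]; exact: ltW.
Qed.

Let inner_bound i j (a : R) : (L2sq (block_err i) <= a%:E)%E ->
  (L2sq (inner i j) <=
   ((1 + 3 * Ch) ^+ j * (a + 2 * Ch * \sum_(l < j) b i l))%:E)%E.
Proof.
move=> ba; have a0 : 0 <= a by rewrite -lee_fin; exact: le_trans (L2sq_ge0 _) ba.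
elim: j => [|j ih].
  rewrite big_ord0 mulr0 addr0 expr0 mul1r; apply: le_trans ba.
  rewrite le_eqVlt; apply/orP; left; apply/eqP; apply: eq_integral => w _.
  by rewrite /inner big_ord0 addr0.
pose V w := block_err i w + (c (i * m + j) w - c (i * m)%N w).
have kE : (i * m + j).+1%:R * h - (i * m + j)%:R * h = h.
  by rewrite -natr1 mulrDl mul1r addrAC subrr add0r.
have mV : measurable_wrt (F ((i * m + j)%:R * h)) V.
  have sF k := uf_sigma F_usual (grid_ge0 k).
  apply: (measurable_wrtD (sF _)).
    by apply: wrtW (block_err_wrt i); exact: leq_addr.
  apply: (measurable_wrtB (sF _)); first exact: c_meas.
  by apply: (wrtW _ (c_meas (i * m))); exact: leq_addr.
have mU := @inner_wrt i j (block_err_wrt i).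
have Fsub k : F (k%:R * h) `<=` measurable by exact: (uf_sub F_usual).
have V2 : (L2sq V <= (2 * a + 2 * b i j)%:E)%E.
  apply: (@L2sq_le_comb V (block_err i)
    (fun w => c (i * m + j) w - c (i * m)%N w) 2 2) => //.
  - exact: measurable_wrtW mV.
  - exact: measurable_wrtW (block_err_wrt i).
  - by apply: measurable_funB; exact: measurable_wrtW (c_meas _).
  - move=> w; rewrite /V; set x := block_err i w; set y := c _ w - c _ w.
    by have := sqr_ge0 (x - y); lra.
have lt1 : (i * m + j)%:R * h < (i * m + j).+1%:R * h by rewrite ltr_pM2r// ltr_nat.
have hT : (i * m + j).+1%:R * h - (i * m + j)%:R * h <= T by rewrite kE.
have := euler_step (grid_ge0 _) lt1 hT mU mV ih V2.
rewrite kE -/Ch => step.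
have -> : L2sq (inner i j.+1) = L2sq (fun w => inner i j w + V w *
    (- delta * h + sigma * (W ((i * m + j).+1%:R * h) w - W ((i * m + j)%:R * h) w))).
  apply: eq_integral => w _; congr ((_ ^+ 2)%:E).
  by rewrite /inner big_ord_recr/= addrA.
apply: le_trans step _; rewrite lee_fin big_ord_recr/= exprS.
set q := (1 + 3 * Ch) ^+ j; set S := \sum_(l < j) b i l.
have Ch0' : 0 <= Ch := Ch0.
have bij := b_ge0 i j.
have q1 : 1 <= q by rewrite exprn_ege1//; lra.
have S0 : 0 <= S by rewrite sumr_ge0.
have aA : a <= q * (a + 2 * Ch * S).
  have CS : 0 <= Ch * S by exact: mulr_ge0.
  have aS : a <= a + 2 * Ch * S by lra.
  by apply: le_trans aS _; rewrite ler_peMl//; lra.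
have E1 : 0 <= Ch * (q * (a + 2 * Ch * S) - a) by rewrite mulr_ge0// subr_ge0.
have E2 : 0 <= Ch * b i j * (q * (1 + 3 * Ch) - 1).
  apply: mulr_ge0; first exact: mulr_ge0.
  by rewrite subr_ge0 mulr_ege1//; lra.
lra.
Qed.

(** A discrete Gronwall argument: one step multiplies the square mean by at most
    [1 + 3 C h] and adds [2 C h] times that of the forcing. *)
Lemma block_err_bound i : (L2sq (block_err i) <=
  ((1 + 3 * Ch) ^+ (i * m) * (2 * Ch * \sum_(i' < i) \sum_(l < m) b i' l))%:E)%E.
Proof.
elim: i => [|i ih].
  rewrite big_ord0 !mulr0 /L2sq; under eq_integral do rewrite /= expr0n/=.
  by rewrite integral0.
apply: le_trans (@inner_bound i m _ ih) _.
have Ch0' : 0 <= Ch := Ch0.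
rewrite lee_fin big_ord_recr/= mulSn exprD -[leRHS]mulrA; apply: ler_wpM2l.
  by rewrite exprn_ge0//; lra.
rewrite mulrDr mulrDr; apply: lerD => //.
rewrite ler_peMl//; first rewrite -mulrA mulr_ge0// mulr_ge0// sumr_ge0//.
by rewrite exprn_ege1//; lra.
Qed.

End blocks.

End euler_stability.

(** * Lower bounds for the Euler scheme, and consistency *)

Section euler_lower_bound.
Context {R : realType}.

Lemma expR_le1D (x : R) : - 2^-1 <= x -> expR (x - 2 * x ^+ 2) <= 1 + x.
Proof.
move=> x2; pose y := 2 * x ^+ 2 - x.
have y1 : 0 < 1 + y by rewrite /y; have := sqr_ge0 (2 * x - 1); nra.
have -> : x - 2 * x ^+ 2 = - y by rewrite /y; ring.
rewrite expRN; apply: (@le_trans _ _ (1 + y)^-1).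
  by rewrite lef_pV2 ?posrE ?expR_gt0// expR_ge1Dx.
rewrite -[(1 + y)^-1]mul1r ler_pdivrMr// /y.
rewrite (_ : (1 + x) * _ = 1 + x ^+ 2 * (1 + 2 * x)); last by ring.
by rewrite lerDl mulr_ge0 ?sqr_ge0//; lra.
Qed.

(** A linear Euler scheme whose factors are all positive dominates the pure
    exponential started from [zeta], whatever nondecreasing input [a] it is
    fed. *)
Lemma euler_scheme_ge (z G a : nat -> R) (zeta : R) (N : nat) :
  0 <= zeta -> 0 <= a 0%N -> z 0%N = zeta + a 0%N ->
  (forall i, (i < N)%N -> z i.+1 = z i * (1 + G i) + (a i.+1 - a i)) ->
  (forall i, (i < N)%N -> a i <= a i.+1) ->
  (forall i, (i < N)%N -> `|G i| <= 2^-1) ->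
  zeta * expR (\sum_(i < N) (G i - 2 * G i ^+ 2)) <= z N.
Proof.
move=> z0 a0 zE; elim: N => [|N ih] zS aS GS.
  by rewrite big_ord0 expR0 mulr1 zE; lra.
have {}ih : zeta * expR (\sum_(i < N) (G i - 2 * G i ^+ 2)) <= z N.
  by apply: ih => i iN; [apply: zS|apply: aS|apply: GS]; exact: ltnW.
rewrite big_ord_recr/= expRD zS//.
have := GS N (ltnSn N); rewrite ler_norml => /andP[G1 G2].
have e1 := expR_le1D G1.
have e0 := expR_ge0 (G N - 2 * G N ^+ 2).
have aN : 0 <= a N.+1 - a N by rewrite subr_ge0 aS.
set S := expR (\sum_(i < N) _) in ih *.
apply: (@le_trans _ _ (z N * (1 + G N))); last by lra.
rewrite mulrA; apply: ler_pM => //.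
by rewrite mulr_ge0// expR_ge0.
Qed.

End euler_lower_bound.

Section euler_consistency.
Context {d : measure_display} {Omega : measurableType d} {R : realType}.
Variables (P : probability Omega R) (F0m : set (set Omega)).
Variables (F : R -> set (set Omega)) (W : R -> Omega -> R).
Hypothesis F_usual : usual_filtration P F0m F.
Hypothesis W_bm : brownian_motion P F W.
Variables delta sigma : R.
Notation incr := (incr W delta sigma).
Notation block_err := (block_err W delta sigma).
Implicit Types (Z A : R -> Omega -> R) (zeta : Omega -> R).

Lemma markov_ge0 (g : Omega -> R) (a u : R) : measurable_fun setT g ->
  (forall w, 0 <= g w) -> 0 < a -> (\int[P]_w (g w)%:E <= u%:E)%E ->
  (P [set w | (a <= g w)%R] <= (u / a)%:E)%E.
Proof.
move=> mg g0 a0 gu; pose A := [set w | a <= g w].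
have mA : measurable A.
  by rewrite -[A]setTI; exact: (@measurable_fun_ler _ _ _ _ (fun=> a)).
have : (a%:E * P A <= u%:E)%E.
  have -> : P A = (\int[P]_w (\1_A w)%:E)%E by rewrite integral_indic// setIT.
  apply: le_trans gu; rewrite -ge0_integralZl//; last 2 first.
  - by apply/measurable_EFinP; exact: measurable_indic.
  - by rewrite lee_fin ltW.
  apply: ge0_le_integral => //.
  - by move=> w _; rewrite mule_ge0// lee_fin// ltW.
  - by apply: emeasurable_funM => //; apply/measurable_EFinP; exact: measurable_indic.
  - by apply/measurable_EFinP.
  - move=> w _; rewrite -EFinM lee_fin indicE.
    by have [/set_mem|_] := boolP (w \in A); rewrite ?mulr1// mulr0.
have PA : P A \is a fin_num by exact: fin_num_measure.
by rewrite -(fineK PA) -EFinM !lee_fin ler_pdivlMr// mulrC.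
Qed.

Definition euler_sum Z (h : R) (n : nat) (w : Omega) :=
  \sum_(k < n) Z (k%:R * h) w * incr h k w.

(** [Z] solves [dZ = - delta Z dt + sigma Z dW + dA] from [zeta] in the sense
    that its left Riemann sums converge in probability. In this form the
    equation is visibly linear in [(Z, A, zeta)]. *)
Record euler_consistent Z A zeta : Prop := EulerConsistent {
  ec_adapted : adapted F Z ;
  ec_tame : tame P Z ;
  ec_cvg : forall T, 0 <= T -> cvgP0 P (fun n w =>
    Z T w - zeta w - A T w - euler_sum Z (T / n%:R) n w) }.

Lemma euler_consistent_comb Z1 Z2 A1 A2 zeta1 zeta2 (a b : R) :
  euler_consistent Z1 A1 zeta1 -> euler_consistent Z2 A2 zeta2 ->
  euler_consistent (fun t w => a * Z1 t w + b * Z2 t w)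
    (fun t w => a * A1 t w + b * A2 t w)
    (fun w => a * zeta1 w + b * zeta2 w).
Proof.
move=> [aZ1 tZ1 cZ1] [aZ2 tZ2 cZ2]; split.
- move=> t t0; have sF := uf_sigma F_usual t0.
  by apply: (measurable_wrtD sF); apply: (measurable_wrtM sF) => //;
    [exact: measurable_wrt_cst|exact: aZ1|exact: measurable_wrt_cst|exact: aZ2].
- apply: filterS2 tZ1 tZ2 => w h1 h2 t t0.
  have [[M1 ZM1] o1] := h1 t t0; have [[M2 ZM2] o2] := h2 t t0; split.
    exists (`|a| * M1 + `|b| * M2) => s st; apply: le_trans (ler_normD _ _) _.
    rewrite !normrM; apply: lerD; apply: ler_wpM2l => //; [exact: ZM1|exact: ZM2].
  by apply: small_oscD => //; exact: small_oscZ.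
- move=> T T0; have := cvgP0D (cvgP0Zl a (cZ1 T T0)) (cvgP0Zl b (cZ2 T T0)).
  apply: cvgP0_le => n w.
  rewrite (_ : euler_sum _ _ n w = a * euler_sum Z1 (T / n%:R) n w +
    b * euler_sum Z2 (T / n%:R) n w).
    by rewrite le_eqVlt; apply/orP; left; apply/eqP; congr (`|_|); ring.
  rewrite /euler_sum !mulr_sumr -big_split/=; apply: eq_bigr => k _; ring.
Qed.

(** All grids are controlled at once, because the path is bounded on [[0, t]]. *)
Lemma tame_tight Z (t : R) : 0 <= t -> adapted F Z -> tame P Z ->
  forall e : R, 0 < e -> exists M : R, exists B, [/\ 0 < M, measurable B,
    (P B <= e%:E)%E & forall w, ~ B w -> forall n k, (k <= n)%N ->
      `|Z (k%:R * (t / n%:R)) w| <= M].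
Proof.
move=> t0 aZ tZ e e0.
pose A N := \bigcup_n \bigcup_k [set w | (k <= n)%N /\
  N%:R < `|Z (k%:R * (t / n%:R)) w|].
have mA N : measurable (A N).
  apply: bigcup_measurable => n _; apply: bigcup_measurable => k _.
  have [kn|kn] := boolP (k <= n)%N; last first.
    by rewrite (_ : [set _ | _] = set0)// -subset0 => w [].
  rewrite (_ : [set _ | _] = setT `&` [set w | N%:R < `|Z (k%:R * (t / n%:R)) w|]).
    apply: (@measurable_fun_ltr _ _ _ _ (fun=> N%:R)) => //.
    apply: measurableT_comp => //; apply: (adapted_measurable F_usual aZ).
    by rewrite mulr_ge0// divr_ge0.
  by apply/seteqP; split => w /= [].
have : \forall N \near \oo, (P (A N) <= e%:E)%E.
  apply: ae_eventually_measure => //; apply: filterS tZ => w /(_ t t0)[[M ZM] _].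
  near=> N => -[n _ [k _ [kn]]]; apply/negP; rewrite -leNgt.
  apply: (@le_trans _ _ M); last by near: N; exact: nbhs_infty_ger.
  apply: ZM; rewrite mulr_ge0 ?divr_ge0//=.
  have [->|n0] := posnP n; first by rewrite invr0 mulr0 mulr0.
  by rewrite mulrA ler_pdivrMr ?ltr0n// mulrC ler_wpM2l// ler_nat.
move=> [N _ NA]; exists N.+1%:R, (A N.+1); split => //; first by apply: NA => /=.
move=> w nA n k kn; rewrite leNgt; apply/negP => h; apply: nA.
by exists n => //; exists k.
Unshelve. all: by end_near. Qed.

(** Uniform continuity of the Brownian path makes every factor of a fine enough
    scheme lie in [[1/2, 3/2]]. *)
Lemma wiener_small_incr (t : R) : 0 <= t -> forall e : R, 0 < e ->
  \forall N \near \oo, exists B, [/\ measurable B, (P B <= e%:E)%E &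
    forall w, ~ B w -> forall i, (i < N)%N -> `|incr (t / N%:R) i w| <= 2^-1].
Proof.
move=> t0 e e0; have aW := bm_adapted W_bm.
pose A N := \bigcup_(i in `I_N) [set w | 2^-1 < `|incr (t / N%:R) i w|].
have mi N i : measurable_fun setT (incr (t / N%:R) i).
  have g0 k : 0 <= k%:R * (t / N%:R) by rewrite mulr_ge0// divr_ge0.
  apply: measurable_funD => //; apply: measurable_funM => //.
  by apply: measurable_funB; exact: (adapted_measurable F_usual aW).
have mA N : measurable (A N).
  apply: bigcup_measurable => i _.
  rewrite -[X in measurable X]setTI.
  apply: (@measurable_fun_ltr _ _ _ _ (fun=> 2^-1)) => //.
  exact: measurableT_comp.
have : \forall N \near \oo, (P (A N) <= e%:E)%E.
  apply: ae_eventually_measure => //.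
  apply: filterS (bm_continuous W_bm) => w /continuous_path_upto cw.
  have s1 : 0 < `|sigma| + 1 by rewrite ltr_wpDl.
  have s4 : 0 < 4^-1 / (`|sigma| + 1) by rewrite divr_gt0.
  have [r r0 Wr] := continuous_upto_unif (cw t) s4.
  near=> N.
  have N0 : (0 < N)%N by near: N; exact: nbhs_infty_gt.
  have N0R : 0 < N%:R :> R by rewrite ltr0n.
  have hr : t / N%:R < r.
    rewrite ltr_pdivrMr// mulrC -ltr_pdivrMr//.
    by near: N; exact: nbhs_infty_gtr.
  have hd : `|delta| * (t / N%:R) <= 4^-1.
    rewrite mulrA ler_pdivrMr// [leRHS]mulrC -ler_pdivrMr//.
    by near: N; exact: nbhs_infty_ger.
  have h0 : 0 <= t / N%:R by rewrite divr_ge0.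
  move=> [i /= iN]; apply/negP; rewrite -leNgt.
  have mono : i%:R * (t / N%:R) <= i.+1%:R * (t / N%:R).
    by rewrite ler_wpM2r// ler_nat.
  have [i0 _ it] : [/\ 0 <= i%:R * (t / N%:R), 0 <= i%:R * (t / N%:R) &
      i%:R * (t / N%:R) <= t].
    by apply: grid_bounds => //; rewrite lexx.
  have [_ i10 i1t] : [/\ 0 <= i%:R * (t / N%:R), 0 <= i.+1%:R * (t / N%:R) &
      i.+1%:R * (t / N%:R) <= t].
    by apply: grid_bounds => //; rewrite lexx andbT.
  have := Wr (i%:R * (t / N%:R)) (i.+1%:R * (t / N%:R)).
  rewrite i0 it i10 i1t => /(_ isT isT).
  have -> : i.+1%:R * (t / N%:R) - i%:R * (t / N%:R) = t / N%:R.
    by rewrite -natr1 mulrDl mul1r addrAC subrr add0r.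
  rewrite ger0_norm// => /(_ hr) => /ltW WW.
  rewrite /incr; apply: le_trans (ler_normD _ _) _.
  rewrite [X in X + _]normrM normrN (ger0_norm h0) [X in _ + X]normrM.
  have h4 : `|sigma| * `|W (i.+1%:R * (t / N%:R)) w - W (i%:R * (t / N%:R)) w| <= 4^-1.
    apply: (@le_trans _ _ (`|sigma| * (4^-1 / (`|sigma| + 1)))).
      exact: ler_wpM2l.
    rewrite mulrCA ler_piMr// ler_pdivrMr//; lra.
  lra.
apply: filterS => N PA; exists (A N); split => // w nA i iN.
rewrite leNgt; apply/negP => hi; apply: nA.
by exists i.
Unshelve. all: by end_near. Qed.

(** Markov's inequality: the mean of the quadratic variation is at most [8 t],
    on every grid. *)
Lemma wiener_quadratic_variation (t K : R) (N : nat) : 0 < t -> 0 < K -> (0 < N)%N ->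
  exists B, [/\ measurable B, (P B <= (8 * t / K)%:E)%E & forall w, ~ B w ->
    \sum_(i < N) (W (i.+1%:R * (t / N%:R)) w - W (i%:R * (t / N%:R)) w) ^+ 2 <= K].
Proof.
move=> t0 K0 N0; have aW := bm_adapted W_bm.
have N0R : 0 < N%:R :> R by rewrite ltr0n.
pose D (i : nat) w := W (i.+1%:R * (t / N%:R)) w - W (i%:R * (t / N%:R)) w.
have h0 : 0 < t / N%:R by rewrite divr_gt0.
have mD i : measurable_fun setT (D i).
  by apply: measurable_funB; apply: (adapted_measurable F_usual aW);
    rewrite mulr_ge0// ltW.
pose S w := \sum_(i < N) D i w ^+ 2.
have mS : measurable_fun setT S.
  by apply: measurable_sum => i; exact: measurable_funX.
exists [set w | K <= S w]; split.
- rewrite -[X in measurable X]setTI.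
  exact: (@measurable_fun_ler _ _ _ _ (fun=> K)).
- apply: markov_ge0 => //.
    by move=> w; apply: sumr_ge0 => i _; exact: sqr_ge0.
  under eq_integral do rewrite -sumEFin.
  rewrite ge0_integral_sum//; last 2 first.
  + by move=> i; apply/measurable_EFinP; exact: measurable_funX.
  + by move=> i w _; rewrite lee_fin sqr_ge0.
  rewrite (_ : 8 * t = \sum_(i < N) 8 * (t / N%:R)); last first.
    rewrite sumr_const card_ord -[(8 * _) *+ N]mulr_natr.
    by field; rewrite gt_eqF.
  rewrite -sumEFin; apply: lee_sum => i _.
  have i0 : 0 <= i%:R * (t / N%:R) by rewrite mulr_ge0// ltW.
  have i1 : i%:R * (t / N%:R) < i.+1%:R * (t / N%:R) by rewrite ltr_pM2r// ltr_nat.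
  have := noise_var (brownian_noise (uf_sub F_usual) W_bm i0 i1).
  rewrite [X in 8 * X](_ : _ = t / N%:R)//.
  by rewrite -[in X in X - _]natr1 mulrDl mul1r addrAC subrr add0r.
- by move=> w /= /negP; rewrite -ltNge => /ltW.
Qed.

End euler_consistency.

(** * Comparison from below *)

Section two_grids.
Context {R : realType}.

(** [lin_rec G th] solves [y_(i+1) = y_i (1 + G_i) + (th_(i+1) - th_i)]. *)
Fixpoint lin_rec (G th : nat -> R) (i : nat) : R :=
  if i is j.+1 then lin_rec G th j * (1 + G j) + (th j.+1 - th j) else th 0%N.

Lemma sum_blocks (m i : nat) (f : nat -> R) :
  \sum_(k < i.+1 * m) f k = \sum_(k < i * m) f k + \sum_(l < m) f (i * m + l)%N.
Proof.
have -> : (i.+1 * m = i * m + m)%N by rewrite mulSnr.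
by rewrite big_split_ord/=.
Qed.

(** The error of the coarse Euler scheme splits into the block recursion driven
    by the oscillation of [c], and the propagated consistency error [th]. *)
Lemma euler_error_split (m N : nat) (c x G th a zc fb : nat -> R) :
  (forall i, (i <= N)%N -> zc i = th i + a i + \sum_(k < i * m) c k * x k) ->
  (forall i, (i < N)%N -> G i = \sum_(l < m) x (i * m + l)%N) ->
  (forall i, (i < N)%N -> zc i = c (i * m)%N) -> fb 0%N = 0 ->
  (forall i, fb i.+1 = fb i + \sum_(l < m)
     (fb i + (c (i * m + l)%N - c (i * m)%N)) * x (i * m + l)%N) ->
  forall i, (i <= N)%N -> zc i - lin_rec G a i = fb i + lin_rec G th i.
Proof.
move=> zE GE zc0 fb0 fbS; elim=> [_|i ih iN].
  by rewrite zE// mul0n big_ord0 fb0 /=; ring.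
have {}ih := ih (ltnW iN).
have S1 : \sum_(l < m) (fb i + (c (i * m + l)%N - c (i * m)%N)) * x (i * m + l)%N =
    (fb i - c (i * m)%N) * G i + \sum_(l < m) c (i * m + l)%N * x (i * m + l)%N.
  rewrite GE// mulr_sumr -big_split/=; apply: eq_bigr => l _; ring.
have S2 := zE i.+1 iN.
rewrite (sum_blocks m i (fun k => c k * x k)) /= in S2.
have S3 := zE i (ltnW iN).
rewrite fbS S1 /=.
set s := \sum_(l < m) _ in S2 *; set S := \sum_(k < i * m) _ in S2 S3.
have -> : zc i.+1 = zc i + s + (th i.+1 - th i) + (a i.+1 - a i).
  by rewrite S2 S3; ring.
rewrite -(zc0 i iN).
have E : lin_rec G a i = zc i - fb i - lin_rec G th i by rewrite -addrA -opprD -ih; ring.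
by rewrite E; ring.
Qed.

End two_grids.

Section lower_bound.
Context {d : measure_display} {Omega : measurableType d} {R : realType}.
Variables (P : probability Omega R) (F0m : set (set Omega)).
Variables (F : R -> set (set Omega)) (W : R -> Omega -> R).
Hypothesis F_usual : usual_filtration P F0m F.
Hypothesis W_bm : brownian_motion P F W.
Variables delta sigma : R.
Notation inc := (incr W delta sigma).
Notation bke := (block_err W delta sigma).
Notation esm := (euler_sum W delta sigma).
Notation L2sq := (L2sq P).

Variables (Z A : R -> Omega -> R) (zeta : Omega -> R) (t : R).
Hypothesis ecZ : euler_consistent P F W delta sigma Z A zeta.
Hypothesis t_gt0 : 0 < t.

(* The consistency error at the coarse time [i], on the fine grid. *)
Let theta (N m i : nat) (w : Omega) := Z (i%:R * (t / N%:R)) w - zeta w -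
  A (i%:R * (t / N%:R)) w - esm Z (t / (N * m)%:R) (i * m) w.

Let theta_cvg N i : (0 < N)%N -> cvgP0 P (fun m => theta N m i).
Proof.
move=> N0; have Ti0 : 0 <= i%:R * (t / N%:R) by rewrite mulr_ge0// divr_ge0// ltW.
have := ec_cvg ecZ Ti0.
have [->|i0] := posnP i.
  apply: cvgP0_le => m w; rewrite /theta mul0r mul0r.
  rewrite /euler_sum !big1 ?lexx// => k _.
  - by rewrite /incr !mulr0 subrr mulr0 add0r mulr0.
  - by move: k => [k /=]; rewrite mul0n.
move=> H; have phi_cvg : (fun m => (i * m)%N) @ \oo --> \oo.
  move=> B [n _ nB]; exists n => // m /= nm; apply: nB => /=.
  by apply: leq_trans nm _; rewrite leq_pmull.
have := cvgP0_sub phi_cvg H; apply: cvgP0_le => m w.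
rewrite le_eqVlt; apply/orP; left; apply/eqP; rewrite /theta; congr (`| _ - esm Z _ _ w|).
have [->|m0] := posnP m; first by rewrite !muln0 !invr0 !mulr0.
rewrite !natrM; field.
by rewrite !pnatr_eq0 -!lt0n N0 m0 i0.
Qed.

Let G N i w := inc (t / N%:R) i w.

Let mG N i : measurable_fun setT (G N i).
Proof.
have g0 k : 0 <= k%:R * (t / N%:R) by rewrite mulr_ge0// divr_ge0// ltW.
apply: measurable_funD => //; apply: measurable_funM => //.
by apply: measurable_funB; exact: (adapted_measurable F_usual (bm_adapted W_bm)).
Qed.

(** With the coarse grid fixed, the propagated error is a fixed finite
    combination of consistency errors, and these vanish as the fine grid is
    refined. *)
Let prop_cvg N i : (0 < N)%N ->
  cvgP0 P (fun m w => lin_rec (G N ^~ w) (theta N m ^~ w) i).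
Proof.
move=> N0; elim: i => [|i ih] /=; first exact: theta_cvg.
apply: cvgP0D.
  by apply: cvgP0Mr => //; exact: measurable_funD.
by apply: cvgP0D; [exact: theta_cvg|exact/cvgP0N/theta_cvg].
Qed.

Lemma grid_eq N m i : (0 < m)%N ->
  (i * m)%:R * (t / (N * m)%:R) = i%:R * (t / N%:R).
Proof.
move=> m0; have [->|N0] := posnP N; first by rewrite mul0n !invr0 !mulr0.
by rewrite !natrM; field; rewrite !pnatr_eq0 -!lt0n N0 m0.
Qed.

Section level.
Variable M : R.
Hypothesis M_gt0 : 0 < M.

Definition clamped (N m k : nat) (w : Omega) := clamp M (Z (k%:R * (t / (N * m)%:R)) w).

Lemma clamped_wrt N m k : measurable_wrt (F (k%:R * (t / (N * m)%:R))) (clamped N m k).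
Proof.
have k0 : 0 <= k%:R * (t / (N * m)%:R) by rewrite mulr_ge0// divr_ge0// ltW.
apply: (measurable_wrt_comp (uf_sigma F_usual k0)); first exact: measurable_clamp.
exact: (ec_adapted ecZ).
Qed.

Lemma measurable_clamped N m k : measurable_fun setT (clamped N m k).
Proof.
apply: measurable_wrtW (clamped_wrt N m k); apply: (uf_sub F_usual).
by rewrite mulr_ge0// divr_ge0// ltW.
Qed.

(** The clamped path oscillates little inside the coarse cells; clamping bounds
    this quantity, so that its mean tends to [0] by dominated convergence. *)
Definition block_osc (N m : nat) (w : Omega) := \sum_(i < N) \sum_(l < m)
  (clamped N m (i * m + l) w - clamped N m (i * m) w) ^+ 2 * (t / (N * m)%:R).

Lemma block_osc_ge0 N m w : 0 <= block_osc N m w.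
Proof.
apply: sumr_ge0 => i _; apply: sumr_ge0 => l _.
by rewrite mulr_ge0 ?sqr_ge0// divr_ge0// ltW.
Qed.

Lemma measurable_block_osc N m : measurable_fun setT (block_osc N m).
Proof.
apply: measurable_sum => i; apply: measurable_sum => l.
by apply: measurable_funM => //; apply: measurable_funX;
  apply: measurable_funB; exact: measurable_clamped.
Qed.

Lemma clamped_norm_le N m k w : `|clamped N m k w| <= M.
Proof. by apply: clamp_le; exact: ltW. Qed.

Let sum_mesh N m (b : R) : (0 < N)%N -> (0 < m)%N ->
  \sum_(i < N) \sum_(l < m) b * (t / (N * m)%:R) = b * t.
Proof.
move=> N0 m0; rewrite !sumr_const !card_ord -[_ *+ m *+ N]mulrnA.
rewrite -[(b * _) *+ _]mulr_natr mulnC natrM; field.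
by rewrite !pnatr_eq0 -!lt0n N0 m0.
Qed.

Lemma block_osc_le N m w : (0 < N)%N -> (0 < m)%N -> block_osc N m w <= (2 * M) ^+ 2 * t.
Proof.
move=> N0 m0; rewrite -(sum_mesh _ N0 m0); apply: ler_sum => i _; apply: ler_sum => l _.
apply: ler_wpM2r; first by rewrite divr_ge0// ltW.
rewrite -real_normK ?num_real//; apply: lerXn2r; rewrite ?nnegrE//.
  by rewrite mulr_ge0// ltW.
apply: le_trans (ler_normB _ _) _.
by have := clamped_norm_le N m (i * m + l) w; have := clamped_norm_le N m (i * m) w; lra.
Qed.

Lemma block_osc_cvg (mm : nat -> nat) : (forall N, (0 < mm N)%N) ->
  forall e : R, 0 < e -> \forall N \near \oo,
    (\int[P]_w (block_osc N (mm N) w)%:E <= e%:E)%E.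
Proof.
move=> mm0 e e0.
pose D N w := block_osc N.+1 (mm N.+1) w.
have c1 : {ae P, forall w, setT w ->
    (D N w)%:E @[N --> \oo] --> (cst 0 w : \bar R)}%E.
  apply: filterS (ec_tame ecZ) => w /(_ t (ltW t_gt0))[_ oZ] _.
  apply/fine_cvgP; split; first exact: nearW.
  apply/cvgr0Pnorm_le => r r0 /=.
  have M2 : 0 < 2 * M by rewrite mulr_gt0.
  have r'0 : 0 < r / (2 * M) by rewrite divr_gt0.
  have [n0 _ oN] := oZ _ r'0.
  exists n0 => // N /= n0N; rewrite ger0_norm; last exact: block_osc_ge0.
  have [b [b0 be bz]] := oN N.+1 (leq_trans n0N (leqnSn N)).
  have N0R : 0 < N.+1%:R :> R by [].
  set m := mm N.+1; have m0 : (0 < m)%N by exact: mm0.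
  apply: (@le_trans _ _ (\sum_(i < N.+1) \sum_(l < m)
      (2 * M * b i) * (t / (N.+1 * m)%:R))).
    apply: ler_sum => i _; apply: ler_sum => l _.
    apply: ler_wpM2r; first by rewrite divr_ge0// ltW.
    rewrite -real_normK ?num_real// expr2; apply: ler_pM => //.
      apply: le_trans (ler_normB _ _) _.
      by have := clamped_norm_le N.+1 m (i * m + l) w;
        have := clamped_norm_le N.+1 m (i * m) w; lra.
    apply: le_trans (clamp_lip _ _ (ltW M_gt0)) _.
    rewrite (grid_eq N.+1 i m0); apply: bz => //.
    have h0 : 0 <= t / (N.+1 * m)%:R by rewrite divr_ge0// ltW.
    rewrite -(grid_eq N.+1 i m0) -(grid_eq N.+1 i.+1 m0); apply/andP; split.
      by rewrite ler_wpM2r// ler_nat leq_addr.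
    by rewrite ler_wpM2r// ler_nat mulSnr leq_add2l ltnW.
  rewrite (_ : \sum_(i < _) _ = 2 * M * ((\sum_(i < N.+1) b i) * (t / N.+1%:R))).
    by rewrite mulrC -ler_pdivlMr.
  rewrite mulr_suml mulr_sumr; apply: eq_bigr => i _.
  rewrite sumr_const card_ord -[(_ * (t / _)) *+ m]mulr_natr natrM.
  have m0R : m%:R != 0 :> R by rewrite pnatr_eq0 -lt0n.
  have N1R : N.+1%:R != 0 :> R by rewrite pnatr_eq0.
  set q := N.+1%:R in N1R *; field.
  by apply/andP; split.
have mf N : measurable_fun setT (EFin \o D N)
  by apply/measurable_EFinP; exact: measurable_block_osc.
have i1 : P.-integrable setT (fun=> ((2 * M) ^+ 2 * t)%:E).
  exact: finite_measure_integrable_cst.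
have b1 : {ae P, forall w N, setT w -> (`|(EFin \o D N) w| <= ((2 * M) ^+ 2 * t)%:E)%E}.
  apply/aeW => w N _; rewrite gee0_abs ?lee_fin ?block_osc_ge0//.
  by apply: block_osc_le => //; exact: mm0.
have [_ _] := dominated_convergence measurableT mf (measurable_cst 0%E) c1 i1 b1.
rewrite integral0 => /fine_cvgP[[n1 _ fin] /cvgr0Pnorm_le /(_ e e0) [n2 _ le]].
exists (maxn n1 n2).+1 => // -[//|N] /=; rewrite ltnS geq_max => /andP[h1 h2].
have fN := fin N h1.
rewrite -[X in (X <= _)%E](fineK fN) lee_fin.
by apply: le_trans (ler_norm _) _; exact: (le N h2).
Qed.

Definition clamped_err N m i w := bke (t / (N * m)%:R) m (clamped N m) i w.

Lemma measurable_clamped_err N m i : (0 < N)%N -> (0 < m)%N ->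
  measurable_fun setT (clamped_err N m i).
Proof.
move=> N0 m0; have h0 : 0 < t / (N * m)%:R.
  by rewrite divr_gt0// ltr0n muln_gt0 N0.
apply: (measurable_wrtW _ (@block_err_wrt _ _ _ _ _ _ _ F_usual W_bm delta sigma
  (t / (N * m)%:R) m (clamped N m) h0 (clamped_wrt N m) i)).
by apply: (uf_sub F_usual); rewrite mulr_ge0// ltW.
Qed.

Lemma clamped_err_bound N m (u : R) : (0 < N)%N -> (0 < m)%N ->
  (\int[P]_w (block_osc N m w)%:E <= u%:E)%E ->
  (L2sq (clamped_err N m N) <= (expR (3 * euler_const delta sigma t * t) *
     (2 * euler_const delta sigma t * u))%:E)%E.
Proof.
move=> N0 m0 ou; pose C := euler_const delta sigma t.
have C0 : 0 <= C by apply: euler_const_ge0; exact: ltW.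
pose h := t / (N * m)%:R.
have h0 : 0 < h by rewrite divr_gt0// ltr0n muln_gt0 N0.
have ht : h <= t.
  rewrite ler_pdivrMr ?ltr0n ?muln_gt0 ?N0//; apply: ler_peMr; first exact: ltW.
  by rewrite ler1n muln_gt0 N0.
have mdc i l : measurable_fun setT (fun w =>
  ((clamped N m (i * m + l) w - clamped N m (i * m) w) ^+ 2)%:E).
  by apply/measurable_EFinP; apply: measurable_funX;
    apply: measurable_funB; exact: measurable_clamped.
pose b i l := fine (L2sq (fun w => clamped N m (i * m + l) w - clamped N m (i * m) w)).
have bfin i l : L2sq (fun w => clamped N m (i * m + l) w - clamped N m (i * m) w) \is a fin_num.
  rewrite ge0_fin_numE ?L2sq_ge0//.
  apply: (@le_lt_trans _ _ (\int[P]_w ((2 * M) ^+ 2)%:E)%E); last first.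
    by rewrite integral_cst//= probability_setT mule1 ltry.
  apply: ge0_le_integral => //.
  - by move=> w _; rewrite lee_fin sqr_ge0.
  - move=> w _; rewrite lee_fin -real_normK ?num_real//.
    apply: lerXn2r; rewrite ?nnegrE//; first by rewrite mulr_ge0// ltW.
    apply: le_trans (ler_normB _ _) _.
    by have := clamped_norm_le N m (i * m + l) w; have := clamped_norm_le N m (i * m) w; lra.
have bb i l : (L2sq (fun w => clamped N m (i * m + l)%N w - clamped N m (i * m)%N w)%R <=
  (b i l)%:E)%E.
  by rewrite /b fineK.
have := block_err_bound F_usual W_bm delta sigma h0 ht (clamped_wrt N m) bb N.
move/le_trans; apply; rewrite lee_fin -/C -/h.
have hb : h * (\sum_(i < N) \sum_(l < m) b i l) <= u.
  rewrite -lee_fin; apply: le_trans ou.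
  rewrite /block_osc; under eq_integral do rewrite -sumEFin.
  rewrite ge0_integral_sum//; last 2 first.
  - move=> i; apply/measurable_EFinP; apply: measurable_sum => l.
    by apply: measurable_funM => //; apply: measurable_funX;
      apply: measurable_funB; exact: measurable_clamped.
  - move=> i w _; rewrite lee_fin; apply: sumr_ge0 => l _.
    by rewrite mulr_ge0 ?sqr_ge0// ltW.
  rewrite mulr_sumr -sumEFin; apply: lee_sum => i _.
  under eq_integral do rewrite -sumEFin.
  rewrite ge0_integral_sum//; last 2 first.
  - move=> l; apply/measurable_EFinP.
    by apply: measurable_funM => //; apply: measurable_funX;
      apply: measurable_funB; exact: measurable_clamped.
  - by move=> l w _; rewrite lee_fin mulr_ge0 ?sqr_ge0// ltW.
  rewrite mulr_sumr -sumEFin; apply: lee_sum => l _.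
  under eq_integral do rewrite mulrC EFinM.
  rewrite ge0_integralZl//; last 2 first.
  - by move=> w _; rewrite lee_fin sqr_ge0.
  - by rewrite lee_fin ltW.
  by rewrite EFinM fineK.
have S0 : 0 <= \sum_(i < N) \sum_(l < m) b i l.
  by apply: sumr_ge0 => i _; apply: sumr_ge0 => l _; rewrite fine_ge0// L2sq_ge0.
apply: ler_pM.
- by rewrite exprn_ge0// addr_ge0// !mulr_ge0// ltW.
- by rewrite !mulr_ge0// ltW.
- apply: (@le_trans _ _ (expR (3 * (C * h)) ^+ (N * m))).
    apply: lerXn2r; rewrite ?nnegrE ?expR_ge0//; last exact: expR_ge1Dx.
    by rewrite addr_ge0// !mulr_ge0// ltW.
  rewrite -expRM_natl ler_expR le_eqVlt; apply/orP; left; apply/eqP.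
  by rewrite /h; field; rewrite !pnatr_eq0 -!lt0n N0 m0.
- rewrite -mulrA -mulrA -mulrA ler_wpM2l// ler_wpM2l//.
Qed.

End level.

Hypothesis A_nondecr : {ae P, forall w, forall s u, 0 <= s -> s <= u -> A s w <= A u w}.
Hypothesis A_ge0 : {ae P, forall w, 0 <= A 0 w}.

(** A bound for [delta t + 2 \sum G_i ^ 2] when the quadratic variation of [W] on
    the grid is at most [K]. *)
Definition log_loss (K : R) := delta * t + 4 * delta ^+ 2 * t ^+ 2 + 4 * sigma ^+ 2 * K.

Lemma sum_incr (N : nat) w (K : R) : (0 < N)%N ->
  \sum_(i < N) (W (i.+1%:R * (t / N%:R)) w - W (i%:R * (t / N%:R)) w) ^+ 2 <= K ->
  sigma * (W t w - W 0 w) - log_loss K <=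
    \sum_(i < N) (inc (t / N%:R) i w - 2 * inc (t / N%:R) i w ^+ 2).
Proof.
move=> N0 QK; have N0R : 0 < N%:R :> R by rewrite ltr0n.
pose D i := W (i.+1%:R * (t / N%:R)) w - W (i%:R * (t / N%:R)) w.
apply: (@le_trans _ _ (\sum_(i < N) ((- delta * (t / N%:R) + sigma * D i) -
    (4 * delta ^+ 2 * (t / N%:R) ^+ 2 + 4 * sigma ^+ 2 * D i ^+ 2)))); last first.
  apply: ler_sum => i _; rewrite /incr -/(D i).
  have := sqr_ge0 (delta * (t / N%:R) + sigma * D i).
  set x := t / N%:R; set y := D i => h; nra.
rewrite sumrB !big_split/= -!mulr_sumr !sumr_const card_ord.
have -> : \sum_(i < N) D i = W t w - W 0 w.
  rewrite -(big_mkord xpredT D) telescope_sumr// mul0r.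
  by rewrite mulrC divfK// gt_eqF.
have hN : N%:R^-1 *+ N = 1 :> R by rewrite -[LHS]mulr_natr mulVf ?gt_eqF.
have h2 : 4 * delta ^+ 2 * (t / N%:R * t) <= 4 * delta ^+ 2 * t ^+ 2.
  apply: ler_wpM2l; first by rewrite mulr_ge0 ?sqr_ge0.
  rewrite expr2 ler_pM2r// ler_pdivrMr//; apply: ler_peMr; first exact: ltW.
  by rewrite ler1n.
have h3 : 4 * sigma ^+ 2 * \sum_(i < N) D i ^+ 2 <= 4 * sigma ^+ 2 * K.
  by rewrite ler_wpM2l// mulr_ge0// sqr_ge0.
rewrite hN !mulr1 /log_loss; lra.
Qed.

(** Positivity by comparison, on two grids. On the coarse grid the Euler scheme
    driven by [A] has positive factors and dominates an exponential.
    The equation, however, only says that consistency errors vanish in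
    probability as the mesh tends to [0], which does not survive summation over
    a grid that is refined at the same time. So the Riemann sums are taken on a
    second grid, [m] times finer, with [m] chosen after [N]: the errors at the
    coarse times are then finitely many and vanish. The price is the oscillation
    of [Z] inside the coarse cells; it is adapted, so its effect is bounded in
    square mean by [block_err_bound]. [K] controls the quadratic variation, [e]
    the discretization. *)
Lemma consistent_lower_bound (K e : R) : 0 < K -> 0 < e ->
  exists B, [/\ measurable B, (P B <= (8 * t / K + e)%:E)%E & forall w, ~ B w ->
    0 <= zeta w ->
    zeta w * expR (sigma * (W t w - W 0 w) - log_loss K) - e <= Z t w].
Proof.
move=> K0 e0; have e40 : 0 < e / 4 by lra.
have [M [B1 [M0 mB1 PB1 hB1]]] :=
  tame_tight F_usual (ltW t_gt0) (ec_adapted ecZ) (ec_tame ecZ) e40.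
(* the refinement factor of the fine grid, as a function of the coarse grid *)
have /choice[mm mmP] : forall N, exists m, (0 < m)%N /\ ((0 < N)%N ->
    exists B, [/\ measurable B, (P B <= (e / 4)%:E)%E & forall w, ~ B w ->
      `|lin_rec (G N ^~ w) (theta N m ^~ w) N| < e / 4]).
  move=> N; have [->|N0] := posnP N; first by exists 1%N.
  have [m0 _ H] := @prop_cvg N N N0 (e / 4) e40.
  by exists m0.+1; split => // _; apply: H => /=.
have mm0 N : (0 < mm N)%N by have [] := mmP N.
pose C := euler_const delta sigma t.
pose E := expR (3 * C * t) * (2 * C) + 1.
have C0 : 0 <= C by apply: euler_const_ge0; exact: ltW.
have E0 : 0 < E by rewrite ltr_wpDl// mulr_ge0// ?expR_ge0// mulr_ge0.
(* so that Markov's inequality at the level [(e / 4) ^ 2] leaves [e / 4] *)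
have u0 : 0 < (e / 4) ^+ 3 / E by rewrite divr_gt0// exprn_gt0.
have [n1 _ N1] := block_osc_cvg M0 mm0 u0.
have [n2 _ N2] := wiener_small_incr F_usual W_bm delta sigma (ltW t_gt0) e40.
pose N := (maxn n1 n2).+1; have N0 : (0 < N)%N by [].
have [B2 [mB2 PB2 hB2]] := N2 N (leq_trans (leq_maxr n1 n2) (leqnSn _)).
have oscN := N1 N (leq_trans (leq_maxl n1 n2) (leqnSn _)).
have [B3 [mB3 PB3 hB3]] := wiener_quadratic_variation F_usual W_bm t_gt0 K0 N0.
have [_ /(_ N0)[B4 [mB4 PB4 hB4]]] := mmP N.
set m := mm N in oscN B4 mB4 PB4 hB4.
have m0 : (0 < m)%N := mm0 N.
pose f := bke (t / (N * m)%:R) m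
  (fun k w => clamp M (Z (k%:R * (t / (N * m)%:R)) w)) N.
have mf : measurable_fun setT f := @measurable_clamped_err M N m N N0 m0.
have fL2 : (L2sq f <= ((e / 4) ^+ 3)%:E)%E.
  apply: le_trans (clamped_err_bound M0 N0 m0 oscN) _.
  rewrite lee_fin -/C.
  rewrite (_ : _ * _ = (e / 4) ^+ 3 * (expR (3 * C * t) * (2 * C) / E)); last by ring.
  apply: ler_piMr; first by rewrite ltW// exprn_gt0.
  by rewrite ler_pdivrMr// mul1r /E; lra.
pose B5 := [set w | (e / 4) ^+ 2 <= f w ^+ 2].
have mf2 : measurable_fun setT (fun w => f w ^+ 2) by exact: measurable_funX.
have mB5 : measurable B5.
  by rewrite -[B5]setTI; exact: (@measurable_fun_ler _ _ _ _ (fun=> (e / 4) ^+ 2)).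
have PB5 : (P B5 <= (e / 4)%:E)%E.
  have e42 : 0 < (e / 4) ^+ 2 by rewrite exprn_gt0.
  have := markov_ge0 mf2 (fun w => sqr_ge0 (f w)) e42 fL2.
  by rewrite (_ : _ / _ = e / 4)// exprSr mulrAC divff ?mul1r// gt_eqF.
have [B6 [mB6 PB6 hB6]] : P.-negligible (~` [set w |
    (forall s u, 0 <= s -> s <= u -> A s w <= A u w) /\ 0 <= A 0 w]).
  by apply: filterS2 A_nondecr A_ge0 => w.
have PB6' : (P B6 <= 0%:E)%E by rewrite PB6.
exists (B1 `|` B2 `|` B4 `|` B5 `|` B3 `|` B6); split.
- by do ![apply: measurableU => //].
- rewrite (_ : 8 * t / K + e = e / 4 + e / 4 + e / 4 + e / 4 + 8 * t / K + 0); last by lra.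
  by do ![apply: measureU_le => //; try by do ![apply: measurableU => //]].
move=> w; do ![move/not_orP => []]; move=> nB1 nB2 nB4 nB5 nB3 nB6 z0.
have [Amono A0] : (forall s u, 0 <= s -> s <= u -> A s w <= A u w) /\ 0 <= A 0 w.
  by apply: contrapT => h; apply: nB6; exact: hB6.
have ZM := hB1 w nB1; have GS := hB2 w nB2; have QK := hB3 w nB3.
have gN := hB4 w nB4.
have fN : `|f w| < e / 4.
  rewrite ltNge; apply/negP => h; apply: nB5; rewrite /B5/=.
  rewrite -[leRHS]real_normK ?num_real//; apply: lerXn2r => //; rewrite nnegrE//.
  exact: ltW.
pose a i := zeta w + A (i%:R * (t / N%:R)) w.
have h0 : 0 <= t / N%:R by rewrite divr_ge0// ltW.
have lower : zeta w * expR (\sum_(i < N) (G N i w - 2 * G N i w ^+ 2)) <=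
    lin_rec (G N ^~ w) a N.
  apply: (@euler_scheme_ge _ (lin_rec (G N ^~ w) a) (G N ^~ w)
      (fun i => A (i%:R * (t / N%:R)) w)) => //.
  - by rewrite mul0r.
  - by move=> i _ /=; rewrite /a; congr (_ + _); ring.
  - move=> i _; apply: Amono; first exact: mulr_ge0.
    by apply: ler_wpM2r => //; rewrite ler_nat.
have tN : N%:R * (t / N%:R) = t by rewrite mulrC divfK// pnatr_eq0.
have split : Z t w - lin_rec (G N ^~ w) a N =
    f w + lin_rec (G N ^~ w) (theta N m ^~ w) N.
  rewrite -[in Z t w]tN.
  apply: (@euler_error_split _ m N
    (fun k => clamp M (Z (k%:R * (t / (N * m)%:R)) w))
    (fun k => inc (t / (N * m)%:R) k w) (G N ^~ w) (theta N m ^~ w) a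
    (fun i => Z (i%:R * (t / N%:R)) w)
    (fun i => bke (t / (N * m)%:R) m
      (fun k w => clamp M (Z (k%:R * (t / (N * m)%:R)) w)) i w)) => //.
  - move=> i iN; rewrite (_ : \sum_(k < _) _ = esm Z (t / (N * m)%:R) (i * m) w).
      by rewrite /theta /a; ring.
    apply: eq_bigr => k _; rewrite clamp_id//; apply: ZM.
    by apply: leq_trans (ltnW (ltn_ord k)) _; rewrite leq_mul2r iN orbT.
  - move=> i iN; rewrite /G /incr big_split/= sumr_const card_ord -mulr_sumr.
    have -> : \sum_(l < m) (W ((i * m + l).+1%:R * (t / (N * m)%:R)) w -
        W ((i * m + l)%:R * (t / (N * m)%:R)) w) =
        W (i.+1%:R * (t / N%:R)) w - W (i%:R * (t / N%:R)) w.
      rewrite -(big_mkord xpredT (fun l => W ((i * m + l).+1%:R * (t / (N * m)%:R)) w -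
        W ((i * m + l)%:R * (t / (N * m)%:R)) w)).
      under eq_bigr do rewrite -addnS.
      rewrite (telescope_sumr (fun l => W ((i * m + l)%:R * (t / (N * m)%:R)) w))//.
      by rewrite addn0 -mulSnr !grid_eq.
    congr (_ + _); rewrite -[RHS]mulr_natr natrM.
    by field; rewrite !pnatr_eq0 -!lt0n N0 m0.
  - move=> i iN; rewrite clamp_id ?grid_eq// -(@grid_eq N m)//; apply: ZM.
    by rewrite leq_mul2r ltnW ?orbT.
have S := sum_incr N0 QK.
have ZL : zeta w * expR (sigma * (W t w - W 0 w) - log_loss K) <=
    lin_rec (G N ^~ w) a N.
  by apply: le_trans lower; rewrite ler_wpM2l// ler_expR.
move: fN gN; rewrite !ltr_norml => /andP[f1 f2] /andP[g1 g2].
lra.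
Qed.

End lower_bound.

(** * Sign of a consistent process *)

Section path_integral.
Context {R : realType}.
Notation mu := (@lebesgue_measure R).
Implicit Types (z : R -> R) (t M : R).

Lemma bounded_integrable_itv z t M : 0 <= t -> measurable_fun `[0, t]%classic z ->
  (forall s, 0 <= s <= t -> `|z s| <= M) ->
  mu.-integrable `[0, t]%classic (EFin \o z).
Proof.
move=> t0 mz zM; apply: measurable_bounded_integrable => //.
  rewrite /= lebesgue_measure_itv/=; case: ifP => _; last by rewrite ltry.
  by rewrite -EFinB ltry.
exists M; split; first exact: num_real.
move=> M' MM' s /=; rewrite in_itv/= => st.
by apply: le_trans (zM s st) _; exact: ltW.
Qed.

Lemma continuous_path_integral z t M : 0 <= t -> measurable_fun `[0, t]%classic z ->
  (forall s, 0 <= s <= t -> `|z s| <= M) ->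
  continuous_upto (fun s => \int[mu]_(u in `[0, s]) z u) t.
Proof.
move=> t0 mz zM x /andP[x0 xt] e e0.
have M0 : 0 <= M by apply: le_trans (zM 0 _); rewrite ?lexx.
have M1 : 0 < M + 1 by lra.
have lip a b : 0 <= a -> a <= b -> b <= t ->
    `|(\int[mu]_(u in `[0, b]) z u) - (\int[mu]_(u in `[0, a]) z u)| <= M * (b - a).
  move=> a0 ab bt.
  have sub1 : `[0, b]%classic `<=` `[0, t]%classic.
    by move=> s /=; rewrite !in_itv/= => /andP[-> /le_trans]; exact.
  have iz : mu.-integrable `[0, b]%classic (EFin \o z).
    by apply: integrableS (bounded_integrable_itv t0 mz zM).
  have sub2 : `]a, b]%classic `<=` `[0, b]%classic.
    by move=> s /=; rewrite !in_itv/= => /andP[/ltW/(le_trans a0) -> ->].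
  have iz2 : mu.-integrable `]a, b]%classic (EFin \o z) by exact: integrableS iz.
  rewrite Rintegral_itvB ?bnd_simp//.
  apply: le_trans (le_normr_Rintegral _ iz2) _ => //.
  have fin : (mu `]a, b]%classic < +oo)%E.
    by rewrite /= lebesgue_measure_itv/=; case: ifP => _; rewrite ?ltry// -EFinB ltry.
  apply: (@le_trans _ _ (\int[mu]_(u in `]a, b]) M)).
    apply: le_Rintegral => //.
    - exact: (integrable_norm iz2).
    - apply/integrableP; split; first exact: measurable_cst.
      under eq_integral do rewrite /= (ger0_norm M0).
      by rewrite integral_cst// lte_mul_pinfty// ?lee_fin.
    - move=> s; rewrite /= in_itv/= => /andP[sa sb]; apply: zM; apply/andP; split.
        exact: le_trans (ltW sa).
      exact: le_trans bt.
  rewrite Rintegral_cst// /= lebesgue_measure_itv/= lte_fin.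
  by move: ab; rewrite le_eqVlt => /predU1P[->|->//]; rewrite ltxx subrr.
exists (e / (M + 1)); first by rewrite divr_gt0.
move=> s /andP[s0 st] sx; apply: (@le_lt_trans _ _ (M * `|s - x|)).
  have [sx'|/ltW xs] := leP s x.
    by rewrite distrC [`|s - x|]distrC [`|x - s|]ger0_norm ?subr_ge0//; exact: lip.
  by rewrite [`|s - x|]ger0_norm ?subr_ge0//; exact: lip.
apply: (@le_lt_trans _ _ ((M + 1) * `|s - x|)); first by rewrite ler_wpM2r//; lra.
by rewrite mulrC -ltr_pdivlMr.
Qed.

Lemma riemann_sum_error z t (M e : R) (n : nat) : 0 <= t ->
  measurable_fun `[0, t]%classic z ->
  (forall s, 0 <= s <= t -> `|z s| <= M) -> (0 < n)%N ->
  (\int[mu]_(s in `[0%R, t]) (`|left_step z (t / n%:R) n s - z s|)%:E <= e%:E)%E ->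
  `|(t / n%:R) * (\sum_(k < n) z (k%:R * (t / n%:R))) -
    (\int[mu]_(s in `[0, t]) z s)| <= e.
Proof.
move=> t0 mz zM n0 err.
have iz := bounded_integrable_itv t0 mz zM.
have [t00|tn0] := eqVneq t 0.
  have E0 : `[t, t]%classic = [set t] by rewrite set_itv1.
  subst t; rewrite !mul0r sub0r normrN set_itv1 Rintegral_set1 normr0.
  by rewrite -lee_fin; apply: le_trans err; exact: integral_ge0.
have {}t0 : 0 < t by rewrite lt_neqAle eq_sym tn0.
have n0R : 0 < n%:R :> R by rewrite ltr0n.
set h := t / n%:R in err *.
have h0 : 0 < h by rewrite divr_gt0.
have hE : t = n%:R * h by rewrite mulrC divfK// gt_eqF.
pose cell (i : nat) : set (measurableTypeR R) := `](i%:R * h)%R, (i.+1%:R * h)%R]%classic.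
have mc i : measurable (cell i) by exact: measurable_itv.
have fin : (mu `[0%R, t]%classic < +oo)%E.
  by rewrite /= lebesgue_measure_itv/=; case: ifP => _; rewrite ?ltry// -EFinB ltry.
have ic i : mu.-integrable `[0, t]%classic (EFin \o (\1_(cell i) : R -> R)).
  apply: measurable_bounded_integrable => //.
  exists 1; split; first exact: num_real.
  move=> x x1 s /= _; rewrite indicE; apply: le_trans (ltW x1).
  by case: (s \in cell i); rewrite ?normr1 ?normr0.
have isz i : mu.-integrable `[0, t]%classic
    (fun s => (z (i%:R * h))%:E * (\1_(cell i) s)%:E)%E.
  by apply: (integrableZl _ _ (ic i)).
have icell (i : 'I_n) : (\int[mu]_(s in `[0%R, t]) (\1_(cell i) s)%:E = h%:E)%E.
  rewrite integral_indic// setIidl.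
    rewrite /= lebesgue_measure_itv/= lte_fin ltr_pM2r// ltr_nat ltnSn -EFinB.
    by congr EFin; rewrite -natr1; ring.
  move=> s; rewrite /cell /= !in_itv/= => /andP[a b]; apply/andP; split.
    by apply: le_trans (ltW a); rewrite mulr_ge0// ltW.
  by apply: le_trans b _; rewrite hE ler_pM2r// ler_nat.
have step : (\int[mu]_(s in `[0%R, t]) (left_step z h n s)%:E =
    (h * \sum_(k < n) z (k%:R * h))%:E)%E.
  transitivity (\int[mu]_(s in `[0%R, t])
     \sum_(i < n) ((z (i%:R * h))%:E * (\1_(cell i) s)%:E))%E.
    apply: eq_integral => s _; rewrite /left_step -sumEFin.
    by apply: eq_bigr => i _; rewrite EFinM.
  rewrite integral_sum// mulr_sumr -sumEFin; apply: eq_bigr => i _.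
  rewrite integralZl//; last exact: ic.
  transitivity ((z (i%:R * h))%:E * h%:E)%E; last by rewrite -EFinM mulrC.
  by congr (_ * _)%E; exact: icell.
have il : mu.-integrable `[0, t]%classic (EFin \o left_step z h n).
  rewrite (_ : _ \o _ = (fun s => \sum_(i < n)
     ((z (i%:R * h))%:E * (\1_(cell i) s)%:E))%E).
    by apply: integrable_sum.
  apply/funext => s; rewrite /left_step /= -sumEFin.
  by apply: eq_bigr => i _; rewrite EFinM.
have -> : h * (\sum_(k < n) z (k%:R * h)) = \int[mu]_(s in `[0, t]) left_step z h n s.
  by rewrite /Rintegral step.
rewrite -RintegralB//.
have ild : mu.-integrable `[0, t]%classic (EFin \o (fun s => left_step z h n s - z s)).
  have mt : measurable (`[0, t]%classic : set (measurableTypeR R)) by exact: measurable_itv.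
  exact: (integrableB mt il iz).
rewrite -lee_fin EFin_normr_Rintegral//.
by apply: le_trans err; apply: le_abse_integral => //; exact: measurable_int ild.
Qed.

End path_integral.

Section consequences.
Context {d : measure_display} {Omega : measurableType d} {R : realType}.
Variables (P : probability Omega R) (F0m : set (set Omega)).
Variables (F : R -> set (set Omega)) (W : R -> Omega -> R).
Hypothesis F_usual : usual_filtration P F0m F.
Hypothesis W_bm : brownian_motion P F W.
Variables delta sigma : R.
Notation mu := (@lebesgue_measure R).
Notation esm := (euler_sum W delta sigma).
Notation consistent := (euler_consistent P F W delta sigma).

(** Let [V] be [Z t] minus the exponential of [consistent_lower_bound]. Where
    [0 <= zeta], one has [- e <= V] off a set of probability [8 t / K + e]. As
    the events [- e <= V < 0] decrease to the empty set with [e], negative values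
    of [V] there have probability at most [8 t / K], and [K] is arbitrary. *)
Lemma consistent_sign (Z A : R -> Omega -> R) (zeta : Omega -> R) (t : R) :
  consistent Z A zeta -> measurable_fun setT zeta ->
  {ae P, forall w, forall s u, 0 <= s -> s <= u -> A s w <= A u w} ->
  {ae P, forall w, 0 <= A 0 w} -> 0 < t ->
  {ae P, forall w, (0 <= zeta w -> 0 <= Z t w) /\ (0 < zeta w -> 0 < Z t w)}.
Proof.
move=> cZ mz A1 A2 t0.
have mZ : measurable_fun setT (Z t).
  by apply: (adapted_measurable F_usual (ec_adapted cZ)); exact: ltW.
have mW s : 0 <= s -> measurable_fun setT (W s).
  exact: (adapted_measurable F_usual (bm_adapted W_bm)).
pose N := [set w | (0 <= zeta w /\ Z t w < 0) \/ (0 < zeta w /\ Z t w <= 0)].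
have mN : measurable N.
  rewrite (_ : N = ((setT `&` [set w | 0 <= zeta w]) `&` (setT `&` [set w | Z t w < 0]))
    `|` ((setT `&` [set w | 0 < zeta w]) `&` (setT `&` [set w | Z t w <= 0]))).
    apply: measurableU; apply: measurableI.
    - exact: (@measurable_fun_ler _ _ _ _ (fun=> 0)).
    - exact: (@measurable_fun_ltr _ _ _ _ _ (fun=> 0)).
    - exact: (@measurable_fun_ltr _ _ _ _ (fun=> 0)).
    - exact: (@measurable_fun_ler _ _ _ _ _ (fun=> 0)).
  by apply/seteqP; split => w; rewrite /N/=; tauto.
suff PN : P N = 0%E.
  exists N; split => // w /= h; rewrite /N/=; apply: contrapT => h'; apply: h.
  by split => z0; [rewrite leNgt|rewrite ltNge]; apply/negP => zt; apply: h'; tauto.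
apply/eqP; rewrite eq_le measure_ge0 andbT; apply/lee_addgt0Pr => e e0; rewrite add0e.
pose K := 8 * t / (e / 4).
have K0 : 0 < K by rewrite divr_gt0 ?mulr_gt0//; lra.
pose V w := Z t w - zeta w * expR (sigma * (W t w - W 0 w) - log_loss delta sigma t K).
have mV : measurable_fun setT V.
  apply: measurable_funB => //; apply: measurable_funM => //.
  apply: measurableT_comp => //; apply: measurable_funB => //.
  by apply: measurable_funM => //; apply: measurable_funB; apply: mW => //; exact: ltW.
pose D n := [set w | - n.+1%:R^-1 <= V w /\ V w < 0].
have mD n : measurable (D n).
  rewrite (_ : D n = (setT `&` [set w | - n.+1%:R^-1 <= V w]) `&` (setT `&` [set w | V w < 0])).
    apply: measurableI; first exact: (@measurable_fun_ler _ _ _ _ (fun=> _)).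
    exact: (@measurable_fun_ltr _ _ _ _ _ (fun=> 0)).
  by apply/seteqP; split => w; rewrite /D/=; tauto.
have e40 : 0 < e / 4 by lra.
have [n _ PD] : \forall n \near \oo, (P (D n) <= (e / 4)%:E)%E.
  apply: ae_eventually_measure => //; apply/aeW => w.
  have [V0|V0] := ltP (V w) 0; last first.
    by apply: nearW => n [_]; rewrite ltNge V0.
  have V0' : 0 < - V w by rewrite oppr_gt0.
  near=> n => -[+ _]; apply/negP; rewrite -ltNge ltrNr.
  by near: n; exact: (near_infty_natSinv_lt (PosNum V0')).
have {}PD := PD n (leqnn n).
pose e1 := Num.min (e / 4) n.+1%:R^-1.
have e10 : 0 < e1 by rewrite lt_min e40/= invr_gt0.
have [B [mB PB hB]] := consistent_lower_bound F_usual W_bm cZ t0 A1 A2 K0 e10.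
apply: (@le_trans _ _ (P (B `|` D n))).
  apply: le_measure; rewrite ?inE//; first exact: measurableU.
  move=> w Nw; have [Bw|nBw] := pselect (B w); [by left|right].
  have z0 : 0 <= zeta w by case: Nw => -[] // /ltW.
  have := hB w nBw z0.
  have e0w := expR_gt0 (sigma * (W t w - W 0 w) - log_loss delta sigma t K).
  have V0 : V w < 0.
    rewrite /V; case: Nw => -[zz Zt].
      have := mulr_ge0 zz (ltW e0w); lra.
    have := mulr_gt0 zz e0w; lra.
  move=> h; split => //.
  have e1n : e1 <= n.+1%:R^-1 by rewrite /e1 ge_min lexx orbT.
  by apply: (@le_trans _ _ (- e1)); rewrite ?lerN2// /V lerBrDr addrC.
have e14 : e1 <= e / 4 by rewrite /e1 ge_min lexx.
have KE : 8 * t / K = e / 4.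
  by rewrite /K; field; rewrite ?gt_eqF//; lra.
apply: le_trans (measureU_le mB (mD n) PB PD) _.
rewrite lee_fin KE; lra.
Unshelve. all: by end_near. Qed.

Lemma ae_and (Q1 Q2 : Omega -> Prop) : {ae P, forall w, Q1 w} ->
  {ae P, forall w, Q2 w} -> {ae P, forall w, Q1 w /\ Q2 w}.
Proof. by apply: filterS2 => w. Qed.

Lemma ae_rat (Q : rat -> Omega -> Prop) : (forall q, {ae P, forall w, Q q w}) ->
  {ae P, forall w, forall q, Q q w}.
Proof.
move=> aQ.
have : {ae P, forall w, forall n, forall q, pickle q = n -> Q q w}.
  apply: ae_foralln => n; have [[q <-]|nq] := pselect (exists q : rat, pickle q = n).
    by apply: filterS (aQ q) => w Qw q' /(pcan_inj pickleK) ->.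
  by apply/aeW => w q qn; exfalso; apply: nq; exists q.
by apply: filterS => w h q; exact: (h (pickle q)).
Qed.

(** Right-continuity upgrades a sign known at each positive time to all times
    at once. *)
Lemma right_continuous_ge0 (Z : R -> Omega -> R) :
  {ae P, forall w, right_continuous_path (Z ^~ w)} ->
  (forall t, 0 < t -> {ae P, forall w, 0 <= Z t w}) ->
  {ae P, forall w, forall t, 0 <= t -> 0 <= Z t w}.
Proof.
move=> rZ Z0.
have : {ae P, forall w, forall q : rat, 0 < ratr q :> R -> 0 <= Z (ratr q) w}.
  apply: ae_rat => q; have [q0|q0] := ltP 0 (ratr q : R).
    by apply: filterS (Z0 _ q0) => w h _.
  exact/aeW.
apply: filterS2 rZ => w rZw Zq t t0; rewrite leNgt; apply/negP => Zt.
have Zt' : 0 < - Z t w by rewrite oppr_gt0.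
have /cvgrPdist_lt/(_ _ Zt') [r /= r0 Zr] := rZw t t0.
have /rat_in_itvoo[q] : t < t + r by rewrite ltrDl.
rewrite in_itv/= => /andP[tq qr].
have := Zr (ratr q); rewrite /ball_/= distrC gtr0_norm ?subr_gt0//.
rewrite ltrBlDl => /(_ qr tq).
have := Zq q (le_lt_trans t0 tq); rewrite distrC => Zq0.
by rewrite ger0_norm; lra.
Qed.

Section state.
Variables (nu X : R -> Omega -> R) (xi : Omega -> R).
Hypothesis nu_adm : admissible P F nu.
Hypothesis X_sde : solves_sde P F W xi delta sigma nu X.
Hypothesis m_xi : measurable_fun setT xi.

Let m_nu t : 0 <= t -> measurable_fun setT (nu t).
Proof. exact: (adapted_measurable F_usual (adm_adapted nu_adm)). Qed.

Lemma state_measurable t : 0 <= t -> measurable_fun setT (X t).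
Proof. exact: (adapted_measurable F_usual (sde_adapted X_sde)). Qed.

Lemma state_bounded : {ae P, forall w, forall t : R, exists M,
  forall s, 0 <= s <= t -> `|X s w| <= M}.
Proof.
apply: filterS2 (sde_right_continuous X_sde) (sde_left_limits X_sde) => w rX lX t.
exact: cadlag_bounded.
Qed.

Lemma state_path_measurable : {ae P, forall w, forall t : R,
  measurable_fun `[0, t]%classic (X ^~ w)}.
Proof.
have [X' [mX' XX']] := joint_version (usual_complete F_usual) state_measurable
  (sde_right_continuous X_sde).
apply: filterS XX' => w XX'w t.
apply: (@eq_measurable_fun _ _ _ _ _ (fun s => X' (s, w))).
  by move=> s; rewrite inE/= in_itv/= => /andP[s0 _]; rewrite XX'w.
by apply: measurable_funTS; exact: (@measurable_fun_pair1 _ _ _ _ _ _ X' w mX').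
Qed.

(** The only discontinuities of a state path come from its monotone control. *)
Lemma state_tame : tame P X.
Proof.
have [I [_ cI _ eqX]] := sde_equation X_sde.
have H1 := ae_and state_bounded state_path_measurable.
have H2 := ae_and cI eqX.
have H3 := ae_and H1 H2.
apply: filterS2 H3 (adm_incr nu_adm) => w [[bX mX] [cIw eqw]] incr t t0.
have [M XM] := bX t; split; first by exists M.
pose c s := xi w - delta * (\int[mu]_(u in `[0, s]) X u w) + sigma * I s w.
have oc : small_osc c t.
  apply: small_oscD => //; last first.
    by apply: small_oscZ => //; apply: small_osc_continuous => //; exact: continuous_path_upto.
  apply: (@small_oscD _ (fun=> xi w) (fun s => - (delta * _))) => //.
    by apply: small_osc_nondecreasing.
  under [X in small_osc X]eq_fun do rewrite -mulNr.
  apply: small_oscZ => //; apply: small_osc_continuous => //.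
  exact: (continuous_path_integral t0 (mX t) XM).
have on : small_osc (nu ^~ w) t by apply: small_osc_nondecreasing => // s u; exact: incr.
have ocn := small_oscD t0 oc on.
move=> e e0; apply: filterS2 (nbhs_infty_gt 0) (ocn e e0) => n n0 [b [b0 be bz]].
exists b; split => // i s iN si; have [i0 s0 _] := grid_bounds t0 iN si.
by rewrite !eqw//; exact: bz.
Qed.

(** The drift integral is a limit of Riemann sums path by path, and the stochastic
    integral is one in probability. *)
Lemma state_consistent : consistent X nu xi.
Proof.
split; [exact: sde_adapted X_sde|exact: state_tame|].
move=> T T0; have [I [aI cI ito eqX]] := sde_equation X_sde.
have mI t : 0 <= t -> measurable_fun setT (I t) by exact: (adapted_measurable F_usual aI).
have rs := ito_rsum F_usual W_bm T0 (sde_adapted X_sde)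
  (sde_right_continuous X_sde) state_tame (mI T T0) (ito T T0).
pose drift n w := (T / n%:R) * \sum_(k < n) X (k%:R * (T / n%:R)) w.
pose D n w := X T w - xi w - nu T w - sigma * I T w + delta * drift n w.
have cD : cvgP0 P D.
  apply: cvgP0_ae.
    move=> n; apply: measurable_funD.
      apply: measurable_funB; last by apply: measurable_funM => //; exact: mI.
      apply: measurable_funB; last exact: m_nu.
      by apply: measurable_funB => //; exact: state_measurable.
    apply: measurable_funM => //; apply: measurable_funM => //.
    apply: measurable_sum => k; apply: state_measurable.
    by rewrite mulr_ge0// divr_ge0.
  have H1 := ae_and state_bounded state_path_measurable.
  have H2 := ae_and state_tame eqX.
  apply: filterS2 H1 H2 => w [bX mX] [tX eqw].
  have [M XM] := bX T; have [_ oX] := tX T T0.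
  apply/cvgr0Pnorm_le => e e0.
  have d1 : 0 < `|delta| + 1 by rewrite ltr_wpDl.
  have e'0 : 0 < e / (`|delta| + 1) by rewrite divr_gt0.
  have err := left_step_error T0 (mX T) XM oX e'0.
  apply: filterS2 (nbhs_infty_gt 0) err => n n0 [err1 _].
  have := riemann_sum_error T0 (mX T) XM n0 err1.
  rewrite /D eqw// -/(drift n w) => h.
  rewrite (_ : _ + _ = delta * (drift n w - \int[mu]_(s in `[0, T]) X s w)); last by ring.
  rewrite normrM; apply: (@le_trans _ _ (`|delta| * (e / (`|delta| + 1)))).
    exact: ler_wpM2l.
  rewrite mulrCA; apply: ler_piMr; first exact: ltW.
  rewrite ler_pdivrMr//; lra.
have := cvgP0D cD (cvgP0N (cvgP0Zl sigma rs)); apply: cvgP0_le => n w.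
rewrite le_eqVlt; apply/orP; left; apply/eqP; congr (`|_|).
have -> : esm X (T / n%:R) n w = - delta * drift n w + sigma * rsum W X (T / n%:R) n w.
  rewrite /euler_sum /drift /rsum /incr !mulr_sumr -big_split/=.
  by apply: eq_bigr => k _; ring.
rewrite /D; ring.
Qed.

End state.

End consequences.

(** * The state map *)

Section state_map.
Context {d : measure_display} {Omega : measurableType d} {R : realType}.
Variables (P : probability Omega R) (F0m : set (set Omega)).
Variables (F : R -> set (set Omega)) (W : R -> Omega -> R).
Hypothesis F_usual : usual_filtration P F0m F.
Hypothesis W_bm : brownian_motion P F W.
Variables (xi : Omega -> R) (delta sigma : R).
Hypothesis m_xi : measurable_fun setT xi.
Notation mu := (@lebesgue_measure R).
Notation TO := (measurableTypeR R * Omega)%type.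
Notation sde := (solves_sde P F W xi delta sigma).

(** Solutions depend affinely on the control; in particular they are unique.
    The difference of two candidates solves the homogeneous equation from [0],
    and so does its opposite: both are nonnegative. *)
Lemma state_affine (nu1 nu2 nu3 X1 X2 X3 : R -> Omega -> R) (a b : R) :
  admissible P F nu1 -> admissible P F nu2 -> admissible P F nu3 ->
  sde nu1 X1 -> sde nu2 X2 -> sde nu3 X3 -> a + b = 1 ->
  (forall t w, nu3 t w = a * nu1 t w + b * nu2 t w) ->
  {ae P, forall w, forall t, 0 <= t -> X3 t w = a * X1 t w + b * X2 t w}.
Proof.
move=> n1 n2 n3 s1 s2 s3 ab nuE.
have c1 := state_consistent F_usual W_bm n1 s1 m_xi.
have c2 := state_consistent F_usual W_bm n2 s2 m_xi.
have c3 := state_consistent F_usual W_bm n3 s3 m_xi.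
pose D e t w := e * X3 t w + (- e) * (a * X1 t w + b * X2 t w).
have D0 e : {ae P, forall w, forall t, 0 <= t -> 0 <= D e t w}.
  apply: right_continuous_ge0.
    have r3 := sde_right_continuous s3.
    have r12 := ae_and (sde_right_continuous s1) (sde_right_continuous s2).
    apply: filterS2 r3 r12 => w r3 [r1 r2] t t0; apply: cvgD.
      by apply: cvgMr; exact: r3.
    apply: cvgMr; apply: cvgD; apply: cvgMr; [exact: r1|exact: r2].
  move=> t t0.
  have cD := euler_consistent_comb F_usual e (- e) c3
    (euler_consistent_comb F_usual a b c1 c2).
  have mz : measurable_fun setT (fun w => e * xi w + (- e) * (a * xi w + b * xi w)).
    by apply: measurable_funD; apply: measurable_funM => //; apply: measurable_funD;
      apply: measurable_funM.
  have A0 s w : e * nu3 s w + (- e) * (a * nu1 s w + b * nu2 s w) = 0.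
    by rewrite nuE; ring.
  have m1 : {ae P, forall w, forall s u, 0 <= s -> s <= u ->
      e * nu3 s w + (- e) * (a * nu1 s w + b * nu2 s w) <=
      e * nu3 u w + (- e) * (a * nu1 u w + b * nu2 u w)}.
    by apply/aeW => w s u _ _; rewrite !A0.
  have m2 : {ae P, forall w, 0 <= e * nu3 0 w + (- e) * (a * nu1 0 w + b * nu2 0 w)}.
    by apply/aeW => w; rewrite A0.
  apply: filterS (consistent_sign F_usual W_bm cD mz m1 m2 t0) => w [+ _]; apply.
  by rewrite -mulrDl ab mul1r mulNr subrr.
apply: filterS2 (D0 1) (D0 (-1)) => w h1 h2 t t0.
have := h1 t t0; have := h2 t t0; rewrite /D; lra.
Qed.

Variables (nu X : R -> Omega -> R).
Hypothesis nu_adm : admissible P F nu.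
Hypothesis X_sde : sde nu X.
Hypothesis xi_gt0 : {ae P, forall w, 0 < xi w}.

Lemma control_ge0 : {ae P, forall w, 0 <= nu 0 w}.
Proof. by apply: filterS (adm_ge0 nu_adm) => w; exact. Qed.

Lemma state_gt0 t : 0 < t -> {ae P, forall w, 0 < X t w}.
Proof.
move=> t0; have cX := state_consistent F_usual W_bm nu_adm X_sde m_xi.
have S := consistent_sign F_usual W_bm cX m_xi (adm_incr nu_adm) control_ge0 t0.
by apply: filterS2 S xi_gt0 => w [_ +] ?; exact.
Qed.

Lemma state_ge0 : {ae P, forall w, forall t, 0 <= t -> 0 <= X t w}.
Proof.
apply: right_continuous_ge0; first exact: sde_right_continuous X_sde.
by move=> t t0; apply: filterS (state_gt0 t0) => w /ltW.
Qed.

(** Strict positivity is known at each positive time, off a null set that depends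
    on the time; by Tonelli it holds [dt (x) dP] almost everywhere. *)
Lemma state_version : exists Y : TO -> R, [/\ measurable_fun setT Y,
  forall z, 0 <= Y z,
  {ae P, forall w, forall t, 0 <= t -> Y (t, w) = X t w} &
  {ae (mu \x P)%E, forall z, 0 <= z.1 -> 0 < Y z}].
Proof.
have [Y0 [mY0 Y0E]] := joint_version (usual_complete F_usual)
  (state_measurable F_usual X_sde) (sde_right_continuous X_sde).
pose Y z := Num.max (Y0 z) 0.
have mY : measurable_fun setT Y by exact: measurable_maxr.
have YE : {ae P, forall w, forall t, 0 <= t -> Y (t, w) = X t w}.
  apply: filterS2 Y0E state_ge0 => w h1 h2 t t0.
  by rewrite /Y h1// (max_idPl _)//; exact: h2.
exists Y; split => //.
  by move=> z; rewrite /Y le_max lexx orbT.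
pose N : set TO := [set z | 0 < z.1 /\ Y z <= 0].
have mN : measurable N.
  rewrite (_ : N = (setT `&` [set z : TO | 0 < z.1]) `&` (setT `&` [set z | Y z <= 0])).
    apply: measurableI.
      have m1 : measurable_fun setT (fst : TO -> R) by exact: measurable_fst.
      exact: (@measurable_fun_ltr _ _ _ _ (fun=> 0)).
    exact: (@measurable_fun_ler _ _ _ _ _ (fun=> 0)).
  by apply/seteqP; split => z; rewrite /N/=; tauto.
pose N0 : set TO := [set 0] `*` setT.
have mN0 : measurable N0 by apply: measurableX.
have PN : (mu \x P)%E N = 0%E.
  rewrite /product_measure1; apply: integral0_eq => s _ /=.
  have [s0|s0] := ltP 0 s; last first.
    rewrite (_ : xsection N s = set0) ?measure0//.
    by rewrite -subset0 => w; rewrite /xsection/= inE /N/= => -[]; rewrite ltNge s0.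
  apply/negligibleP; first exact: measurable_xsection.
  apply: negligibleS (ae_and YE (state_gt0 s0)) => w.
  rewrite /xsection/= inE /N/= => -[_ Y0w] [h1 h2].
  by move: Y0w; rewrite (h1 s (ltW s0)) leNgt h2.
have PN0 : (mu \x P)%E N0 = 0%E.
  rewrite /N0 product_measure1E// [X in (X * _)%E](_ : _ = 0%E) ?mul0e//.
  exact: lebesgue_measure_set1.
have nN : (mu \x P)%E.-negligible N by exists N; split; [exact: mN|exact: PN|].
have nN0 : (mu \x P)%E.-negligible N0 by exists N0; split; [exact: mN0|exact: PN0|].
have [Q [mQ Q0 QS]] := negligibleU nN nN0.
exists Q; split => // -[s w] /= h; apply: QS.
have [s0|s0] := eqVneq s 0; first by right; rewrite /N0/=.
left; rewrite /N/=; apply: contrapT => h'; apply: h => s0'.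
rewrite ltNge; apply/negP => Yn; apply: h'; split => //.
by rewrite lt_neqAle eq_sym s0.
Qed.

End state_map.

(** * Growth of the control *)

Section control_growth.
Context {d : measure_display} {Omega : measurableType d} {R : realType}.
Variables (P : probability Omega R) (F0m : set (set Omega)).
Variables (F : R -> set (set Omega)) (W : R -> Omega -> R).
Hypothesis F_usual : usual_filtration P F0m F.
Hypothesis W_bm : brownian_motion P F W.
Notation mu := (@lebesgue_measure R).
Notation TO := (measurableTypeR R * Omega)%type.
Notation L2sq := (L2sq P).

Lemma measure_strip (T : R) : 0 < T -> (mu \x P)%E (strip T) = T%:E.
Proof.
move=> T0; rewrite /strip product_measure1E// [X in (_ * X)%E]probability_setT mule1.
rewrite [LHS](_ : _ = lebesgue_measure (`[0, T]%classic : set R))//.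
by rewrite lebesgue_measure_itv/= lte_fin T0 -EFinB subr0.
Qed.

Lemma small_osc_lip (z f : R -> R) (t L : R) : 0 <= t -> 0 <= L ->
  (forall s u, `|f s - f u| <= L * `|z s - z u|) -> small_osc z t -> small_osc f t.
Proof.
move=> t0 L0 fz o e e0; have L1 : 0 < L + 1 by lra.
have e'0 : 0 < e / (L + 1) by rewrite divr_gt0.
apply: filterS (o _ e'0) => n [b [b0 be bz]].
exists (fun i => L * b i); split.
- by move=> i; rewrite mulr_ge0.
- rewrite -mulr_sumr -mulrA.
  have S0 : 0 <= (\sum_(i < n) b i) * (t / n%:R).
    by rewrite mulr_ge0 ?sumr_ge0 ?divr_ge0.
  apply: (@le_trans _ _ ((L + 1) * ((\sum_(i < n) b i) * (t / n%:R)))).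
    by apply: ler_wpM2r => //; lra.
  by rewrite mulrC -ler_pdivlMr.
- move=> i s ni si; apply: le_trans (fz _ _) _.
  by rewrite ler_wpM2l// bz.
Qed.

(** The steps of [noise_step] add up to a discrete Ito isometry. *)
Lemma riemann_sum_L2 (c : nat -> Omega -> R) (h : R) (n : nat) : 0 < h ->
  (forall k, measurable_wrt (F (k%:R * h)) (c k)) ->
  (L2sq (fun w => \sum_(k < n) c k w * (W (k.+1%:R * h) w - W (k%:R * h) w))%R <=
   \sum_(k < n) (8 * h)%:E * L2sq (c k))%E.
Proof.
move=> h0 mc; have aW := bm_adapted W_bm.
have g0 k : 0 <= k%:R * h by rewrite mulr_ge0// ltW.
have gle (k l : nat) : (k <= l)%N -> k%:R * h <= l%:R * h.
  by move=> kl; rewrite ler_pM2r// ler_nat.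
have up (k l : nat) (f : Omega -> R) : (k <= l)%N -> measurable_wrt (F (k%:R * h)) f ->
    measurable_wrt (F (l%:R * h)) f.
  by move=> kl mf B mB; apply: (uf_incr F_usual (g0 k) (gle _ _ kl)); exact: mf.
elim: n => [|n ih].
  rewrite big_ord0 /L2sq; under eq_integral do rewrite big_ord0 expr0n/=.
  by rewrite integral0.
pose S w := \sum_(k < n) c k w * (W (k.+1%:R * h) w - W (k%:R * h) w).
have sF := uf_sigma F_usual (g0 n); have Fm := uf_sub F_usual (g0 n).
have mS : measurable_wrt (F (n%:R * h)) S.
  apply: (measurable_wrt_sum sF (f := fun k w => c k w *
    (W (k.+1%:R * h) w - W (k%:R * h) w))) => k kn.
  apply: (measurable_wrtM sF); first by apply: up (mc k); exact: ltnW.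
  apply: (measurable_wrtB sF); first by apply: up (aW _ (g0 _)).
  by apply: up (aW _ (g0 _)); exact: ltnW.
have lt1 : n%:R * h < n.+1%:R * h by rewrite ltr_pM2r// ltr_nat.
have hE : n.+1%:R * h - n%:R * h = h by rewrite -natr1; ring.
have nW := brownian_noise (uf_sub F_usual) W_bm (g0 n) lt1.
rewrite hE in nW.
have := noise_step Fm nW mS (mc n) (measurable_wrtM sF mS (mc n)).
rewrite big_ord_recr/= => step.
have -> : L2sq (fun w => \sum_(k < n.+1) c k w * (W (k.+1%:R * h) w - W (k%:R * h) w)) =
    (\int[P]_w ((S w + c n w * (W (n.+1%:R * h) \- W (n%:R * h)) w) ^+ 2)%:E)%E.
  by apply: eq_integral => w _; rewrite big_ord_recr/=.
apply: le_trans step _; apply: leeD => //; exact: ih.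
Qed.

Variables (xi : Omega -> R) (delta sigma : R) (nu X : R -> Omega -> R).
Hypothesis nu_adm : admissible P F nu.
Hypothesis X_sde : solves_sde P F W xi delta sigma nu X.
Variable Y : TO -> R.
Hypothesis mY : measurable_fun setT Y.
Hypothesis YX : {ae P, forall w, forall t, 0 <= t -> Y (t, w) = X t w}.

Let mX t : 0 <= t -> measurable_fun setT (X t).
Proof. exact: (state_measurable F_usual X_sde). Qed.

(** At a fixed level [M] the Riemann sums are bounded, so that dominated
    convergence compares them with the time integral. *)
Lemma clamped_riemann_mean (T M Q : R) : 0 < T -> 0 < M ->
  (\int[mu \x P]_(z in strip T) (Y z ^+ 2)%:E <= Q%:E)%E ->
  \forall n \near \oo, (\int[P]_w
    ((T / n%:R) * \sum_(k < n) clamp M (X (k%:R * (T / n%:R)) w) ^+ 2)%:E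
      <= (Q + 1)%:E)%E.
Proof.
move=> T0 M0 YQ; have T0' := ltW T0.
pose f z := clamp M (Y z) ^+ 2.
have mf : measurable_fun setT f.
  by apply: measurable_funX; exact: (measurableT_comp (measurable_clamp M) mY).
have f_le z : f z <= Y z ^+ 2.
  rewrite /f -[leLHS]real_normK ?num_real// -[leRHS]real_normK ?num_real//.
  by apply: lerXn2r; rewrite ?nnegrE//; apply: clamp_norm_le; exact: ltW.
have f_le2 x : clamp M x ^+ 2 <= M ^+ 2.
  rewrite -[leLHS]real_normK ?num_real//.
  apply: lerXn2r; rewrite ?nnegrE//; first exact: ltW.
  by apply: clamp_le; exact: ltW.
have fQ : (\int[mu \x P]_(z in strip T) (f z)%:E <= Q%:E)%E.
  apply: le_trans YQ; apply: ge0_le_integral => //.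
  - exact: measurable_strip.
  - by move=> z _; rewrite lee_fin sqr_ge0.
  - by apply/measurable_EFinP/measurable_funTS.
  - by apply/measurable_EFinP/measurable_funTS; exact: measurable_funX.
  - by move=> z _; rewrite lee_fin.
have fin : (\int[mu \x P]_(z in strip T) (`|f z|)%:E < +oo)%E.
  under eq_integral do rewrite ger0_norm ?sqr_ge0//.
  by apply: le_lt_trans fQ _; rewrite ltry.
have [iJ JE _] := strip_fubini mf fin.
pose J w := \int[mu]_(s in `[0, T]) f (s, w).
pose r n w := (T / n%:R) * \sum_(k < n) clamp M (X (k%:R * (T / n%:R)) w) ^+ 2.
have mr n : measurable_fun setT (EFin \o r n).
  apply/measurable_EFinP; apply: measurable_funM => //; apply: measurable_sum => k.
  apply: measurable_funX; apply: (measurableT_comp (measurable_clamp M)).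
  by apply: mX; rewrite mulr_ge0// divr_ge0.
have rJ : {ae P, forall w, setT w -> (r n w)%:E @[n --> \oo] --> (J w)%:E}.
  have H1 := ae_and (state_bounded X_sde) (state_path_measurable F_usual X_sde).
  have H2 := ae_and YX (state_tame F_usual nu_adm X_sde).
  apply: filterS2 H1 H2 => w [bX mXw] [YXw tX] _.
  have [_ oX] := tX T T0'.
  pose z s := clamp M (X s w) ^+ 2.
  have mz : measurable_fun `[0, T]%classic z.
    apply: measurable_funX; apply: (measurable_comp measurableT) => //.
    exact: measurable_clamp.
  have zM s : 0 <= s <= T -> `|z s| <= M ^+ 2.
    by move=> _; rewrite /z ger0_norm ?sqr_ge0.
  have oz : small_osc z T.
    apply: (@small_osc_lip (X ^~ w) z T (2 * M)) => //.
      by rewrite mulr_ge0// ltW.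
    move=> s u; rewrite /z subr_sqr normrM mulrC; apply: ler_pM => //.
      apply: le_trans (ler_normD _ _) _.
      have := clamp_le (X s w) (ltW M0); have := clamp_le (X u w) (ltW M0); lra.
    by apply: clamp_lip; exact: ltW.
  have JwE : J w = \int[mu]_(s in `[0, T]) z s.
    apply: eq_Rintegral => s; rewrite inE/= in_itv/= => /andP[s0 _].
    by rewrite /f YXw.
  apply: cvg_EFin; first exact: nearW.
  apply/cvgrPdist_le => e e0.
  have err := left_step_error T0' mz zM oz e0.
  apply: filterS2 (nbhs_infty_gt 0) err => n n0 [err1 _].
  by rewrite distrC JwE; exact: riemann_sum_error T0' mz zM n0 err1.
have rb : {ae P, forall w n, setT w -> (`|(EFin \o r n) w| <= (M ^+ 2 * T)%:E)%E}.
  apply/aeW => w n _; rewrite gee0_abs ?lee_fin; last first.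
    by rewrite mulr_ge0 ?divr_ge0//; apply: sumr_ge0 => k _; exact: sqr_ge0.
  rewrite /r; have [->|n0] := posnP n.
    by rewrite big_ord0 mulr0 mulr_ge0 ?sqr_ge0.
  apply: (@le_trans _ _ (T / n%:R * \sum_(k < n) M ^+ 2)).
    by rewrite ler_wpM2l ?divr_ge0//; apply: ler_sum => k _.
  rewrite sumr_const card_ord -[_ *+ n]mulr_natr le_eqVlt; apply/orP; left; apply/eqP.
  by field; rewrite pnatr_eq0 -lt0n.
have i1 : P.-integrable setT (fun=> (M ^+ 2 * T)%:E).
  exact: finite_measure_integrable_cst.
have mJ : measurable_fun setT (fun w => (J w)%:E) by exact: measurable_int iJ.
have [_ _] := dominated_convergence measurableT mr mJ rJ i1 rb.
have JQ : (\int[P]_w (J w)%:E <= Q%:E)%E by rewrite JE.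
have Jfin : (\int[P]_w (J w)%:E)%E \is a fin_num by exact: integrable_fin_num.
have Q0 : fine (\int[P]_w (J w)%:E)%E <= Q by rewrite -lee_fin fineK.
rewrite -(fineK Jfin) => /fine_cvgP[fn /cvgrPdist_le /(_ 1 ltr01)] cv.
apply: filterS2 fn cv => n fn; rewrite /= => h.
rewrite -[X in (X <= _)%E](fineK fn) lee_fin.
move: h; rewrite ler_norml => /andP[h _].
by set A := fine (\int[P]_x (r n x)%:E)%E in h *; lra.
Qed.

(** Truncating at [K] and then along the grid, the first moment of the
    stochastic integral is controlled by the mean square of the state: off an
    exceptional set it is close to a Riemann sum, whose square mean is known, and
    on that set the truncated integral is at most [K]. *)
Lemma ito_abs_bound (T Q : R) (I : Omega -> R) : 0 < T -> measurable_fun setT I ->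
  is_ito_integral P F W X T I ->
  (\int[mu \x P]_(z in strip T) (Y z ^+ 2)%:E <= Q%:E)%E ->
  (\int[P]_w (`|I w|)%:E <= (10 + 8 * Q)%:E)%E.
Proof.
move=> T0 mI ito YQ; have T0' := ltW T0.
have aX := sde_adapted X_sde.
have tX := state_tame F_usual nu_adm X_sde.
have rs := ito_rsum F_usual W_bm T0' aX (sde_right_continuous X_sde) tX mI ito.
pose g (K : nat) w := Num.min `|I w| K%:R.
have mg K : measurable_fun setT (g K).
  by apply: measurable_minr => //; exact: measurableT_comp.
have g0 K w : 0 <= g K w by rewrite le_min normr_ge0/=.
have gbound K : (\int[P]_w (g K w)%:E <= (10 + 8 * Q)%:E)%E.
  apply/lee_addgt0Pr => e e0.
  (* two exceptional sets of probability [e'], on which [g] is only known to be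
     at most [K], contribute at most [e] *)
  pose e' := e / (2 * K%:R + 1).
  have K1 : 0 < 2 * K%:R + 1 :> R by rewrite ltr_wpDl// mulr_ge0.
  have e'0 : 0 < e' by rewrite divr_gt0.
  have [M [B1 [M0 mB1 PB1 hB1]]] := tame_tight F_usual T0' aX tX e'0.
  pose e1 := Num.min e' 1; have e10 : 0 < e1 by rewrite lt_min e'0/=.
  have [n1 _ N1] := rs e1 e10.
  have [n2 _ N2] := clamped_riemann_mean T0 M0 YQ.
  pose n := (maxn n1 n2).+1; have n0 : (0 < n)%N by [].
  have [B2 [mB2 PB2 hB2]] := N1 n (leq_trans (leq_maxl _ _) (leqnSn _)).
  have rn := N2 n (leq_trans (leq_maxr _ _) (leqnSn _)).
  have n0R : 0 < n%:R :> R by rewrite ltr0n.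
  set h := T / n%:R in hB1 hB2 rn; have h0 : 0 < h by rewrite divr_gt0.
  pose c k w := clamp M (X (k%:R * h) w).
  have g0k k : 0 <= k%:R * h by rewrite mulr_ge0// ltW.
  have mc k : measurable_wrt (F (k%:R * h)) (c k).
    apply: (measurable_wrt_comp (uf_sigma F_usual (g0k k))).
      exact: measurable_clamp.
    exact: aX.
  have mc' k : measurable_fun setT (c k).
    by apply: measurable_wrtW (mc k); exact: (uf_sub F_usual).
  pose S w := \sum_(k < n) c k w * (W (k.+1%:R * h) w - W (k%:R * h) w).
  have mS : measurable_fun setT S.
    apply: measurable_sum => k; apply: measurable_funM => //.
    by apply: measurable_funB; exact: (adapted_measurable F_usual (bm_adapted W_bm)).
  have S2 : (L2sq S <= (8 * (Q + 1))%:E)%E.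
    apply: le_trans (riemann_sum_L2 n h0 mc) _.
    have e8 : (0 <= 8%:E :> \bar R)%E by rewrite lee_fin.
    rewrite [leRHS]EFinM; apply: le_trans (lee_wpmul2l e8 rn).
    rewrite le_eqVlt; apply/orP; left; apply/eqP.
    under [in RHS]eq_integral do rewrite mulr_sumr -sumEFin.
    rewrite ge0_integral_sum//; last 2 first.
    - move=> k; apply/measurable_EFinP; apply: measurable_funM => //.
      by apply: measurable_funX; exact: mc'.
    - by move=> k w _; rewrite lee_fin mulr_ge0 ?sqr_ge0// ltW.
    rewrite ge0_sume_distrr; last first.
      move=> k _; apply: integral_ge0 => w _.
      by rewrite lee_fin mulr_ge0 ?sqr_ge0// ltW.
    apply: eq_bigr => k _.
    under [in RHS]eq_integral do rewrite EFinM.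
    rewrite ge0_integralZl//; last 3 first.
    - by apply/measurable_EFinP; apply: measurable_funX; exact: mc'.
    - by move=> w _; rewrite lee_fin sqr_ge0.
    - by rewrite lee_fin ltW.
    by rewrite muleA -EFinM.
  pose B := B1 `|` B2; have mB : measurable B by exact: measurableU.
  have PB : (P B <= (e' + e')%:E)%E.
    apply: measureU_le => //; apply: le_trans PB2 _.
    by rewrite lee_fin ge_min lexx.
  have pw w : g K w <= 2 + S w ^+ 2 + K%:R * \1_B w.
    have S20 := sqr_ge0 (S w).
    have [Bw|nBw] := pselect (B w).
      rewrite indicE mem_set// mulr1; have : g K w <= K%:R by rewrite ge_min lexx orbT.
      lra.
    rewrite indicE memNset// mulr0 addr0.
    move/not_orP : nBw => [nB1 nB2].
    have -> : S w = rsum W X h n w.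
      apply: eq_bigr => k _; rewrite /c clamp_id//; apply: hB1 => //.
      exact: ltnW.
    have := hB2 w nB2; set x := rsum W X h n w => xI.
    have : e1 <= 1 by rewrite ge_min lexx orbT.
    have : g K w <= `|I w| by rewrite ge_min lexx.
    have : `|I w| <= `|x| + `|x - I w|.
      have := ler_normB x (x - I w).
      by rewrite (_ : x - (x - I w) = I w) //; ring.
    have : `|x| <= 1 + x ^+ 2.
      by rewrite -[x ^+ 2]real_normK ?num_real//; have := sqr_ge0 (`|x| - 1); nra.
    lra.
  have m2 : measurable_fun setT (fun w => (2 + S w ^+ 2)%:E).
    by apply/measurable_EFinP; apply: measurable_funD => //; exact: measurable_funX.
  have m3 : measurable_fun setT (fun w => (K%:R * \1_B w)%:E : \bar R).
    by apply/measurable_EFinP; apply: measurable_funM => //; exact: measurable_indic.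
  apply: (@le_trans _ _ (\int[P]_w ((2 + S w ^+ 2)%:E + (K%:R * \1_B w)%:E))%E).
    apply: ge0_le_integral => //.
    - by move=> w _; rewrite lee_fin.
    - by apply/measurable_EFinP.
    - exact: emeasurable_funD.
    - by move=> w _; rewrite -EFinD lee_fin.
  rewrite ge0_integralD//; last first.
    by move=> w _; rewrite lee_fin addr_ge0// sqr_ge0.
  have -> : (\int[P]_w (2 + S w ^+ 2)%:E = 2%:E + L2sq S)%E.
    under eq_integral do rewrite EFinD.
    rewrite ge0_integralD//; last 2 first.
    - by move=> w _; rewrite lee_fin sqr_ge0.
    - by apply/measurable_EFinP; exact: measurable_funX.
    by rewrite integral_cst//= probability_setT mule1.
  have -> : (\int[P]_w (K%:R * \1_B w)%:E = K%:R%:E * P B)%E.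
    under eq_integral do rewrite EFinM.
    rewrite ge0_integralZl//; last first.
      by apply/measurable_EFinP; exact: measurable_indic.
    by rewrite integral_indic// setIT.
  have K0 : (0 <= K%:R%:E :> \bar R)%E by rewrite lee_fin.
  apply: le_trans (leeD (leeD2l 2%:E S2) (lee_wpmul2l K0 PB)) _.
  rewrite -EFinM -!EFinD lee_fin.
  have : K%:R * (e' + e') <= e.
    rewrite /e' -mulrDl mulrA ler_pdivrMr//.
    have -> : K%:R * (e + e) = e * (2 * K%:R) by ring.
    by rewrite ler_pM2l//; lra.
  lra.
have mgE K : measurable_fun setT (fun w => (g K w)%:E) by apply/measurable_EFinP.
have gE0 (K : nat) w : setT w -> (0 <= (g K w)%:E)%E by move=> _; rewrite lee_fin.
have nd w : setT w -> nondecreasing_seq (fun K => (g K w)%:E).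
  move=> _ K K' KK'; rewrite lee_fin le_min ge_min lexx/=.
  by rewrite ge_min ler_nat KK' orbT.
rewrite (eq_integral (fun w => limn (fun K => (g K w)%:E))); last first.
  move=> w _; apply/esym/cvg_lim => //; apply: cvg_near_cst.
  near=> K; rewrite /g (min_idPl _)//.
  by near: K; exact: nbhs_infty_ger.
rewrite monotone_convergence//.
apply: lime_le.
  by apply: ereal_nondecreasing_is_cvgn => K K' KK';
    apply: ge0_le_integral => //; [exact: gE0|move=> w wT; exact: (nd w wT K K' KK')].
exact: nearW.
Unshelve. all: by end_near. Qed.

Hypothesis delta_gt0 : 0 < delta.
Hypothesis sigma_gt0 : 0 < sigma.
Hypothesis xi_gt0 : {ae P, forall w, 0 < xi w}.
Hypothesis Y_ge0 : forall z, 0 <= Y z.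

(** A control whose state has bounded mean square on average can only spend at
    a bounded average rate: [nu_T <= nu_u], and [nu_u] is read off the equation
    at a time [u] averaged over [[T, T + 1]]. *)
Lemma control_growth (C0 : R) : 0 <= C0 ->
  (forall T, 0 < T -> (\int[mu \x P]_(z in strip T) (Y z ^+ 2)%:E <= (C0 * T)%:E)%E) ->
  exists C : R, forall T, 1 <= T -> (\int[P]_w (nu T w)%:E <= (C * T)%:E)%E.
Proof.
move=> C00 Y2.
have [I [aI cI ito eqX]] := sde_equation X_sde.
have mI t : 0 <= t -> measurable_fun setT (I t) by exact: (adapted_measurable F_usual aI).
have mYE : measurable_fun setT (EFin \o Y) by apply/measurable_EFinP.
have YE0 z : (0 <= (EFin \o Y) z)%E by rewrite lee_fin.
have Y1 T : 0 < T -> (\int[mu \x P]_(z in strip T) (Y z)%:E <= ((1 + C0) * T)%:E)%E.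
  move=> T0; apply: (@le_trans _ _
      (\int[mu \x P]_(z in strip T) (1 + (Y z ^+ 2)%:E))%E).
    apply: ge0_le_integral => //.
    - exact: measurable_strip.
    - by move=> z _; rewrite lee_fin.
    - exact: measurable_funTS.
    - apply: emeasurable_funD => //; apply/measurable_EFinP/measurable_funTS.
      exact: measurable_funX.
    - move=> z _; rewrite -EFinD lee_fin.
      have := sqr_ge0 (Y z - 1); have := Y_ge0 z; nra.
  rewrite ge0_integralD//; last 3 first.
  - exact: measurable_strip.
  - by move=> z _; rewrite lee_fin sqr_ge0.
  - by apply/measurable_EFinP/measurable_funTS; exact: measurable_funX.
  rewrite mulrDl mul1r EFinD; apply: leeD; last exact: Y2.
  rewrite integral_cst ?mul1e; last exact: measurable_strip.
  by rewrite le_eqVlt; apply/orP; left; apply/eqP; exact: measure_strip.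
have pathY T : 0 < T -> (\int[P]_w (\int[mu]_(s in `[0%R, T]) Y (s, w))%R%:E
    <= ((1 + C0) * T)%:E)%E /\
    P.-integrable setT (fun w => (\int[mu]_(s in `[0%R, T]) Y (s, w))%R%:E).
  move=> T0; have fin : (\int[mu \x P]_(z in strip T) (`|Y z|)%:E < +oo)%E.
    under eq_integral do rewrite ger0_norm//.
    by apply: le_lt_trans (Y1 T T0) _; rewrite ltry.
  by have [iJ JE _] := strip_fubini mY fin; rewrite JE; split; first exact: Y1.
pose A T := delta * ((1 + C0) * (T + 1)) + sigma * (10 + 8 * (C0 * (T + 1))).
have key T u : 1 <= T -> T <= u -> u <= T + 1 ->
    (\int[P]_w (nu T w)%:E <= \int[P]_w (Y (u, w))%:E + (A T)%:E)%E.
  move=> T1 Tu uT; have u0 : 0 < u by lra.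
  have [pY iY] := pathY u u0.
  have absI := ito_abs_bound u0 (mI u (ltW u0)) (ito u (ltW u0)) (Y2 u u0).
  pose J w := \int[mu]_(s in `[0, u]) Y (s, w).
  have J0 w : 0 <= J w by apply: Rintegral_ge0.
  have mnu : measurable_fun setT (nu T).
    by apply: (adapted_measurable F_usual (adm_adapted nu_adm)); lra.
  have mJ : measurable_fun setT J by apply/measurable_EFinP; exact: measurable_int iY.
  have mYu : measurable_fun setT (fun w => Y (u, w)).
    exact: (@measurable_fun_pair2 _ _ _ _ _ _ Y u mY).
  have mIu := mI u (ltW u0).
  have m1 : measurable_fun setT (fun w => (Y (u, w) + delta * J w)%:E).
    by apply/measurable_EFinP; apply: measurable_funD => //; exact: measurable_funM.
  have m2 : measurable_fun setT (fun w => (sigma * `|I u w|)%:E).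
    apply/measurable_EFinP; apply: measurable_funM => //.
    exact: measurableT_comp.
  apply: (@le_trans _ _ (\int[P]_w ((Y (u, w) + delta * J w)%:E +
      (sigma * `|I u w|)%:E))%E).
    have nuE : (\int[P]_w (nu T w)%:E = \int[P]_w (Num.max (nu T w) 0)%:E)%E.
      apply: ae_eq_integral => //.
      - by apply/measurable_EFinP.
      - by apply/measurable_EFinP; exact: measurable_maxr.
      - apply: filterS (adm_ge0 nu_adm) => w nu0 _; rewrite (max_idPl _)//.
        by apply: nu0; lra.
    rewrite nuE; apply: ae_ge0_le_integral => //.
    - by move=> w _; rewrite lee_fin le_max lexx orbT.
    - by apply/measurable_EFinP; exact: measurable_maxr.
    - move=> w _; rewrite -EFinD lee_fin addr_ge0 ?mulr_ge0//; try exact: ltW.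
      by rewrite addr_ge0// mulr_ge0// ltW.
    - exact: emeasurable_funD.
    have H1 := ae_and YX eqX; have H2 := ae_and xi_gt0 (adm_incr nu_adm).
    apply: filterS2 H1 H2 => w [YXw eqw] [xi0 incr] _.
    rewrite -EFinD lee_fin ge_max; apply/andP; split; last first.
      by rewrite !addr_ge0 ?mulr_ge0//; exact: ltW.
    apply: le_trans (incr T u _ Tu) _; first by lra.
    have := eqw u (ltW u0); rewrite -(YXw u (ltW u0)) => E.
    have -> : J w = \int[mu]_(s in `[0, u]) X s w.
      apply: eq_Rintegral => s; rewrite inE/= in_itv/= => /andP[s0 _].
      by rewrite YXw.
    have : - (sigma * I u w) <= sigma * `|I u w|.
      rewrite -mulrN ler_wpM2l ?(ltW sigma_gt0)//.
      by rewrite -normrN; exact: ler_norm.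
    lra.
  rewrite ge0_integralD//; last 2 first.
  - by move=> w _; rewrite lee_fin addr_ge0// mulr_ge0// ltW.
  - by move=> w _; rewrite lee_fin mulr_ge0// ltW.
  under [X in (X + _ <= _)%E]eq_integral do rewrite EFinD.
  rewrite ge0_integralD//; try by [move=> w _; rewrite lee_fin
    | move=> w _; rewrite lee_fin mulr_ge0// ltW
    | exact/measurable_EFinP
    | apply/measurable_EFinP; exact: measurable_funM].
  rewrite -addeA; apply: leeD => //.
  have scal (a b : R) (f : Omega -> R) : 0 <= a -> measurable_fun setT f ->
      (forall w, 0 <= f w) -> (\int[P]_w (f w)%:E <= b%:E)%E ->
      (\int[P]_w (a * f w)%:E <= (a * b)%:E)%E.
    move=> a0 mf f0 fb; under eq_integral do rewrite EFinM.
    rewrite ge0_integralZl//; try by [apply/measurable_EFinP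
      | move=> w _; rewrite lee_fin].
    by rewrite EFinM; apply: lee_wpmul2l.
  have h1 := scal delta _ J (ltW delta_gt0) mJ J0 pY.
  have h2 := scal sigma _ (fun w => `|I u w|) (ltW sigma_gt0)
    (measurableT_comp (@normr_measurable _ setT) mIu) (fun w => normr_ge0 _) absI.
  apply: le_trans (leeD h1 h2) _; rewrite -EFinD lee_fin /A.
  have k1 : delta * ((1 + C0) * u) <= delta * ((1 + C0) * (T + 1)).
    by apply: ler_wpM2l; [exact: ltW|apply: ler_wpM2l; lra].
  have k2 : sigma * (10 + 8 * (C0 * u)) <= sigma * (10 + 8 * (C0 * (T + 1))).
    apply: ler_wpM2l; first exact: ltW.
    have : C0 * u <= C0 * (T + 1) by apply: ler_wpM2l.
    lra.
  lra.
(* the factor 2 absorbs [T + 1 <= 2 T] *)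
exists (2 * (1 + C0 + delta * (1 + C0) + sigma * (10 + 8 * C0))) => T T1.
have T0 : 0 < T + 1 by lra.
pose EY (u : R) := (\int[P]_w (Y (u, w))%:E)%E.
have EY0 u : (0 <= EY u)%E by apply: integral_ge0 => w _; rewrite lee_fin.
have mEY : measurable_fun setT EY.
  exact: (@measurable_fun_fubini_tonelli_F _ _ _ _ _ P (EFin \o Y) mYE YE0).
have nu0 : (0 <= \int[P]_w (nu T w)%:E)%E.
  rewrite (ae_eq_integral (fun w => (Num.max (nu T w) 0)%:E))//.
  - by apply: integral_ge0 => w _; rewrite lee_fin le_max lexx orbT.
  - apply/measurable_EFinP; apply: (adapted_measurable F_usual (adm_adapted nu_adm)).
    by lra.
  - apply/measurable_EFinP; apply: measurable_maxr => //.
    apply: (adapted_measurable F_usual (adm_adapted nu_adm)); lra.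
  - apply: filterS (adm_ge0 nu_adm) => w nu0 _; rewrite (max_idPl _)//.
    by apply: nu0; lra.
have mI1 : measurable (`[T, T + 1]%classic : set (measurableTypeR R)).
  exact: measurable_itv.
have AT0 : 0 <= A T.
  rewrite /A; apply: addr_ge0; apply: mulr_ge0; try exact: ltW.
    by rewrite mulr_ge0//; lra.
  by rewrite addr_ge0// !mulr_ge0//; lra.
have len : (mu `[T, (T + 1)%R]%classic = 1)%E.
  rewrite /= lebesgue_measure_itv/= lte_fin ltrDl ltr01 -EFinB.
  by congr EFin; ring.
have avg : (\int[P]_w (nu T w)%:E <= \int[mu]_(u in `[T, (T + 1)%R]) (EY u + (A T)%:E))%E.
  rewrite -[leLHS]mule1 -len -integral_cst//.
  apply: ge0_le_integral => //.
  - by apply: emeasurable_funD => //; exact: measurable_funTS.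
  - by move=> u /=; rewrite in_itv/= => /andP[Tu uT]; exact: key.
apply: le_trans avg _; rewrite ge0_integralD//; try by [exact: measurable_funTS
  | move=> u _; rewrite lee_fin].
rewrite [X in (_ + X)%E](_ : _ = (A T)%:E); last first.
  rewrite integral_cst//; transitivity ((A T)%:E * 1)%E; last by rewrite mule1.
  by congr (_ * _)%E; exact: len.
have sub : (\int[mu]_(u in `[T, (T + 1)%R]) EY u <= ((1 + C0) * (T + 1))%:E)%E.
  apply: le_trans (Y1 _ T0); rewrite (strip_tonelli' P _ mYE YE0).
  apply: ge0_subset_integral => //; first exact: measurable_funTS.
  by move=> u /=; rewrite !in_itv/= => /andP[Tu ->]; rewrite andbT; lra.
apply: le_trans (leeD2r _ sub) _; rewrite -EFinD lee_fin /A.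
have p1 : 0 <= (1 + C0 + delta * (1 + C0) + sigma * (8 * C0)) * (T - 1).
  apply: mulr_ge0; last by lra.
  by rewrite !addr_ge0// ?mulr_ge0//; try exact: ltW; rewrite ?addr_ge0// ?mulr_ge0.
have p2 : 0 <= sigma * (T - 1) by apply: mulr_ge0; [exact: ltW|lra].
have p3 : 0 <= sigma * T by apply: mulr_ge0; [exact: ltW|lra].
lra.
Qed.

End control_growth.

(** * Lower and upper limits *)

Section limf.
Context {R : realType} (F : set_system R) {FF : ProperFilter F}.
Implicit Types (f : R -> \bar R) (c : R).

Lemma limf_esup_lt f c : (limf_esup f F < c%:E)%E -> \forall t \near F, (f t < c%:E)%E.
Proof.
rewrite /limf_esup => /ereal_inf_lt [_ [V FV <-]] Vc.
by apply: filterS FV => t Vt; apply: le_lt_trans Vc; apply: ereal_sup_ubound; exists t.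
Qed.

Lemma limf_esup_le f c : (\forall t \near F, (f t <= c%:E)%E) -> (limf_esup f F <= c%:E)%E.
Proof.
move=> Fc; apply: ge_ereal_inf; exists (ereal_sup (f @` [set t | (f t <= c%:E)%E])).
  by exists [set t | (f t <= c%:E)%E].
by apply: ge_ereal_sup => _ [t tc <-].
Qed.

Lemma limf_einf_gt f c : (c%:E < limf_einf f F)%E -> \forall t \near F, (c%:E < f t)%E.
Proof.
rewrite limf_einfE => /ereal_sup_gt [_ [V FV <-]] Vc.
by apply: filterS FV => t Vt; apply: (lt_le_trans Vc); apply: ereal_inf_lbound; exists t.
Qed.

Lemma limf_einf_ge f c : (\forall t \near F, (c%:E <= f t)%E) -> (c%:E <= limf_einf f F)%E.
Proof.
move=> Fc; rewrite limf_einfE; apply: le_ereal_sup_tmp.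
exists (ereal_inf (f @` [set t | (c%:E <= f t)%E])).
  by exists [set t | (c%:E <= f t)%E].
by apply: le_ereal_inf_tmp => _ [t tc <-].
Qed.

Lemma ereal_between (x y : \bar R) : (x < y)%E ->
  exists a b : R, [/\ (x < a%:E)%E, a < b & (b%:E < y)%E].
Proof.
case: x => [x||]; case: y => [y||]//=.
- rewrite lte_fin => xy; exists (x + (y - x) / 3), (x + 2 * (y - x) / 3).
  by rewrite !lte_fin; split; lra.
- by move=> _; exists (x + 1), (x + 2); rewrite lte_fin ltry; split => //; lra.
- by move=> _; exists (y - 2), (y - 1); rewrite lte_fin ltNyr; split => //; lra.
- by move=> _; exists 0, 1; rewrite ltNyr ltry; split => //; lra.
Qed.

Variables A B FO : R -> \bar R.

(** Otherwise [A] stays above some [c2] while [B], being convergent, stays below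
    some smaller constant; then [FO] stays below a negative constant. When only
    an upper limit of [FO] is known, the convergence of [B] is what excludes that
    the two facts hold at different times. *)
Lemma limf_einf_le_of_cvg : cvg (B @ F) -> (0 <= limf_esup FO F)%E ->
  (\forall t \near F, exists a b f : R,
    [/\ A t = a%:E, B t = b%:E, FO t = f%:E & f <= b - a]) ->
  (limf_einf A F <= limf_einf B F)%E.
Proof.
move=> cB FO0 H; rewrite leNgt; apply/negP => /ereal_between [c1 [c2 [Bc1 c12 c2A]]].
have HA := limf_einf_gt c2A.
have limB : (lim (B @ F) <= c1%:E)%E.
  rewrite leNgt; apply/negP => lc; move: Bc1; rewrite ltNge => /negP; apply.
  apply: limf_einf_ge.
  have : \forall t \near F, (c1%:E < B t)%E.
    by apply: (cB (fun x => (c1%:E < x)%E));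
      exact: (open_nbhs_nbhs (conj (@open_ereal_gt_ereal _ c1%:E) lc)).
  by apply: filterS => t /ltW.
have HB : \forall t \near F, (B t < ((c1 + c2) / 2)%:E)%E.
  apply: (cB (fun x => (x < ((c1 + c2) / 2)%:E)%E)).
  apply: open_nbhs_nbhs; split; first exact: open_ereal_lt_ereal.
  by apply: (le_lt_trans limB); rewrite lte_fin; lra.
have : (limf_esup FO F <= (((c1 - c2) / 2)%:E))%E.
  apply: limf_esup_le; near=> t.
  have [a [b [f [Aa Bb -> fle]]]] : exists a b f : R,
    [/\ A t = a%:E, B t = b%:E, FO t = f%:E & f <= b - a] by near: t.
  have : (B t < ((c1 + c2) / 2)%:E)%E by near: t.
  have : (c2%:E < A t)%E by near: t.
  by rewrite Aa Bb !lte_fin lee_fin => h1 h2; lra.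
by move=> /(le_trans FO0); rewrite lee_fin; lra.
Unshelve. all: by end_near. Qed.

Lemma limf_einf_le_of_einf : (0 <= limf_einf FO F)%E ->
  (\forall t \near F, exists a b f : R,
    [/\ A t = a%:E, B t = b%:E, FO t = f%:E & f <= b - a]) ->
  (limf_einf A F <= limf_einf B F)%E.
Proof.
move=> FO0 H; rewrite leNgt; apply/negP => /ereal_between [c1 [c2 [Bc1 c12 c2A]]].
have HA := limf_einf_gt c2A.
have HF : \forall t \near F, (((c1 - c2) / 2)%:E < FO t)%E.
  by apply: limf_einf_gt; apply: lt_le_trans FO0; rewrite lte_fin; lra.
move: Bc1; rewrite ltNge => /negP; apply; apply: limf_einf_ge; near=> t.
have [a [b [f [Aa -> Ff fle]]]] : exists a b f : R,
  [/\ A t = a%:E, B t = b%:E, FO t = f%:E & f <= b - a] by near: t.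
have : (((c1 - c2) / 2)%:E < FO t)%E by near: t.
have : (c2%:E < A t)%E by near: t.
by rewrite Aa Ff !lte_fin lee_fin => h1 h2; lra.
Unshelve. all: by end_near. Qed.

(** If [FO] stayed below [c' < 0], then a parameter [e] with [e C <= - c' / 2]
    would make [Ae e] exceed [B] by [e (- c') / 2] at all large times, hence also
    in the lower limit: [B] is bounded, so its lower limit is finite and the gain
    is strict. *)
Lemma limf_esup_ge0_of_perturbation (Ae : R -> R -> \bar R) (C C1 : R) : 0 <= C ->
  (forall e, 0 < e -> e <= 1 / 2 -> (limf_einf (Ae e) F <= limf_einf B F)%E) ->
  (forall e, 0 < e -> e <= 1 / 2 -> \forall t \near F, exists a b f : R,
    [/\ Ae e t = a%:E, B t = b%:E, FO t = f%:E & b - a <= e * f + e ^+ 2 * C]) ->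
  (\forall t \near F, (`|B t| <= C1%:E)%E) ->
  (0 <= limf_esup FO F)%E.
Proof.
move=> C0 opt H Bb; rewrite leNgt; apply/negP => /ereal_between [c' [c [FOc' c'c c0]]].
rewrite lte_fin in c0.
have {c'c c0} c'0 : 0 < - c' by lra.
have HF := limf_esup_lt FOc'.
pose e := Num.min (1 / 2) (- c' / (2 * (C + 1))).
have d0 : 0 < 2 * (C + 1) by lra.
have e0 : 0 < e by rewrite lt_min; apply/andP; split; [lra|exact: divr_gt0].
have e2 : e <= 1 / 2 by rewrite ge_min lexx.
have eC : e * C <= - c' / 2.
  have : e <= - c' / (2 * (C + 1)) by rewrite ge_min lexx orbT.
  rewrite ler_pdivlMr// => h.
  have := ltW e0; nra.
have Bfin : limf_einf B F \is a fin_num.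
  rewrite fin_numElt; apply/andP; split.
    apply: (@lt_le_trans _ _ ((- C1)%:E)); first exact: ltNyr.
    apply: limf_einf_ge; apply: filterS Bb => t.
    by case: (B t) => [b||]//=; rewrite !lee_fin ler_norml => /andP[].
  rewrite ltNge; apply/negP => Binf.
  have C1B : (C1%:E < limf_einf B F)%E by apply: lt_le_trans Binf; exact: ltry.
  have /(@filter_ex _ _ FF) [t []] : \forall t \near F, (C1%:E < B t)%E /\ (`|B t| <= C1%:E)%E.
    exact: filterI (limf_einf_gt C1B) Bb.
  by case: (B t) => [b||]//=; rewrite lte_fin lee_fin => h1 /ler_normlW; lra.
set l := fine (limf_einf B F).
have lE : limf_einf B F = l%:E by rewrite fineK.
pose k := e * (- c') / 4.
have k0 : 0 < k by rewrite divr_gt0// mulr_gt0.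
have lB : ((l - k)%:E < limf_einf B F)%E by rewrite lE lte_fin; lra.
have HB := limf_einf_gt lB.
have := opt e e0 e2; apply/negP; rewrite -ltNge lE.
apply: (@lt_le_trans _ _ (l + k)%:E); first by rewrite lte_fin; lra.
apply: limf_einf_ge.
have He := H e e0 e2; near=> t.
have [a [b [f [-> Bt Ft ba]]]] : exists a b f : R,
  [/\ Ae e t = a%:E, B t = b%:E, FO t = f%:E & b - a <= e * f + e ^+ 2 * C] by near: t.
have : ((l - k)%:E < B t)%E by near: t.
have : (FO t < c'%:E)%E by near: t.
rewrite Bt Ft !lte_fin lee_fin => fc lb.
have h1 : e * f <= e * c' by rewrite ler_pM2l// ltW.
have h2 : e ^+ 2 * C <= e * (- c' / 2) by rewrite expr2 -mulrA ler_pM2l.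
rewrite /k in lb *; lra.
Unshelve. all: by end_near. Qed.

End limf.

(** * The running profit *)

Section utility.
Context {R : realType}.
Implicit Types (a p l x y xh e : R).

Lemma g_xE a p l x : 0 < x -> g_x a p l x = p * (a * x `^ (a - 1)) + l.
Proof.
move=> x0; rewrite /g_x derive1E.
have h1 := is_derive1_powR a x0.
have h : is_derive x 1 (g a p l) (p * (a * x `^ (a - 1)) + l * 1).
  exact: is_deriveD.
by rewrite derive_val mulr1.
Qed.

(** Bernoulli's inequality [t ^ a <= 1 + a (t - 1)], which is Young's inequality
    for the exponents [1 / a] and [1 / (1 - a)], rescaled by [xh]. *)
Lemma powR_tangent a x xh : 0 < a -> a < 1 -> 0 <= x -> 0 < xh ->
  x `^ a <= xh `^ a + a * xh `^ (a - 1) * (x - xh).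
Proof.
move=> a0 a1 x0 xh0.
have xhN : xh != 0 by rewrite gt_eqF.
have E : xh `^ a = xh `^ (a - 1) * xh.
  by rewrite -[X in _ * X]powRr1 ?(ltW xh0)// -powRD ?xhN ?implybT//; congr powR; lra.
have rho0 : 0 <= x / xh by rewrite divr_ge0// ltW.
have B : (x / xh) `^ a <= x / xh * a + (1 - a).
  have := @conjugate_powR R ((x / xh) `^ a) 1 a^-1 (1 - a)^-1 (powR_ge0 _ _) ler01.
  rewrite !invr_gt0 subr_gt0 => /(_ a0 a1).
  rewrite !invrK -powRrM mulfV ?gt_eqF// powRr1// powR1 mulr1 mul1r.
  by apply; rewrite addrC subrK.
have xE : x = x / xh * xh by rewrite mulfVK.
move: rho0 B xE; move: (x / xh) => t t0 B ->.
rewrite powRM ?(ltW xh0)// E.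
set u := xh `^ (a - 1); have u0 : 0 <= u * xh by rewrite mulr_ge0 ?powR_ge0// ltW.
have /le_trans := ler_wpM2r u0 B; apply.
by rewrite le_eqVlt; apply/orP; left; apply/eqP; ring.
Qed.

(** [x ^ b] lies between [1] and [1 / x], and [1 / x <= 2] on this range. *)
Lemma powR_lip b x : - 1 <= b -> b <= 0 -> 1 / 2 <= x ->
  `|x `^ b - 1| <= 2 * `|x - 1|.
Proof.
move=> b1 b0 x2; have x0 : 0 < x by lra.
have xV : x^-1 * x = 1 by rewrite mulVf// gt_eqF.
have xV0 : 0 < x^-1 by rewrite invr_gt0.
have xN1 : x `^ (- 1) = x^-1 by rewrite powR_inv1// ltW.
have [x1|/ltW x1] := leP x 1.
  have h1 : 1 <= x `^ b.
    by rewrite -(powRr0 x); apply: ger_powR => //; rewrite x0 x1.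
  have h2 : x `^ b <= x^-1 by rewrite -xN1; apply: ger_powR => //; rewrite x0 x1.
  by rewrite ger0_norm ?ler0_norm; nra.
have h1 : x `^ b <= 1 by rewrite -(powRr0 x); exact: ler_powR.
have h2 : x^-1 <= x `^ b by rewrite -xN1; exact: ler_powR.
by rewrite ler0_norm ?ger0_norm; nra.
Qed.

Lemma g_tangent a p l x xh : 0 < a -> a < 1 -> 0 < p -> 0 <= x -> 0 < xh ->
  g a p l x - g a p l xh <= g_x a p l xh * (x - xh).
Proof.
move=> a0 a1 p0 x0 xh0; rewrite g_xE// /g.
have := ler_wpM2l (ltW p0) (powR_tangent a0 a1 x0 xh0); lra.
Qed.

Lemma powR_sub1 a x : 0 < x -> x `^ (a - 1) = x `^ (a - 2) * x.
Proof.
move=> x0; have xN : x != 0 by rewrite gt_eqF.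
by rewrite -[X in _ * X]powRr1 ?(ltW x0)// -powRD ?xN ?implybT//; congr powR; lra.
Qed.

(** Concavity at the perturbed point [y] bounds the loss by
    [e g_x(y) (xh - x)]. Since [e <= 1 / 2] keeps [y] above [xh / 2], replacing
    [g_x(y)] by [g_x(xh)] costs at most a multiple of [xh ^ (a - 2) `|y - xh|],
    which is of order [e]. *)
Lemma g_perturbation a p l x xh e : 0 < a -> a < 1 -> 0 < p -> 0 <= x -> 0 < xh ->
  0 < e -> e <= 1 / 2 ->
  g a p l xh - g a p l (e * x + (1 - e) * xh) <=
  e * (g_x a p l xh * (xh - x)) + e ^+ 2 * (2 * p * a) * (xh `^ (a - 2) * (x - xh) ^+ 2).
Proof.
move=> a0 a1 p0 x0 xh0 e0 e2; set y := e * x + (1 - e) * xh.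
have ex : 0 <= e * x by rewrite mulr_ge0// ltW.
have xh2 : xh / 2 <= y.
  have h : 0 <= (1 / 2 - e) * xh by rewrite mulr_ge0 ?subr_ge0// ltW.
  by rewrite /y; lra.
have y0 : 0 < y by apply: lt_le_trans xh2; rewrite divr_gt0.
apply: le_trans (g_tangent l a0 a1 p0 (ltW xh0) y0) _.
have -> : xh - y = e * (xh - x) by rewrite /y; ring.
rewrite !g_xE//; set u := xh `^ (a - 2).
have u0 : 0 <= u by exact: powR_ge0.
have uE : xh `^ (a - 1) = u * xh by exact: powR_sub1.
have rho2 : 1 / 2 <= y / xh by rewrite ler_pdivlMr//; lra.
have yE : y = y / xh * xh by rewrite mulfVK// gt_eqF.
have D : `|y `^ (a - 1) - xh `^ (a - 1)| <= u * 2 * (e * `|x - xh|).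
  rewrite {1}yE powRM ?divr_ge0 ?(ltW xh0) ?(ltW y0)//.
  rewrite -[X in _ - X]mul1r -mulrBl normrM (ger0_norm (powR_ge0 _ _)) uE.
  have h : `|(y / xh) `^ (a - 1) - 1| <= 2 * `|y / xh - 1| by apply: powR_lip; lra.
  have h' : `|y / xh - 1| * xh = e * `|x - xh|.
    rewrite -{2}(ger0_norm (ltW xh0)) -normrM -[in RHS](ger0_norm (ltW e0)) -normrM.
    by congr Num.norm; rewrite mulrBl mulfVK ?gt_eqF// /y; ring.
  apply: le_trans (ler_wpM2r _ h) _; first by rewrite mulr_ge0// ltW.
  by rewrite -h' le_eqVlt; apply/orP; left; apply/eqP; ring.
have : (y `^ (a - 1) - xh `^ (a - 1)) * (xh - x) <= u * 2 * (e * (x - xh) ^+ 2).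
  apply: le_trans (ler_norm _) _; rewrite normrM [X in _ * X]distrC.
  apply: le_trans (ler_wpM2r (normr_ge0 _) D) _.
  rewrite -[X in _ <= _ * (_ * X)]real_normK ?num_real//.
  by rewrite le_eqVlt; apply/orP; left; apply/eqP; ring.
have epa : 0 <= e * (p * a) by rewrite !mulr_ge0// ltW.
move=> /(ler_wpM2l epa) h.
lra.
Qed.

End utility.

(** * Long-run averages *)

Section avg_bounded.
Context {d : measure_display} {Omega : measurableType d} {R : realType}.
Variable P : probability Omega R.
Notation mu := (@lebesgue_measure R).
Notation TO := (measurableTypeR R * Omega)%type.
Notation strip := (@strip d Omega R).
#[local] Hint Extern 0 (measurable _) => solve [apply: measurable_strip] : core.

Lemma ae_prodS (Q1 Q2 : TO -> Prop) : (forall z, Q1 z -> Q2 z) ->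
  {ae (mu \x P)%E, forall z, Q1 z} -> {ae (mu \x P)%E, forall z, Q2 z}.
Proof.
move=> Q12 [N [mN N0 QN]]; exists N; split => // z nQ.
by apply: QN => /Q12.
Qed.

Lemma ae_prod_and (Q1 Q2 : TO -> Prop) : {ae (mu \x P)%E, forall z, Q1 z} ->
  {ae (mu \x P)%E, forall z, Q2 z} -> {ae (mu \x P)%E, forall z, Q1 z /\ Q2 z}.
Proof.
move=> h1 h2; have [N [mN N0 QN]] := negligibleU h1 h2; exists N; split => // z nQ.
by apply: QN; apply/not_andP.
Qed.

(** The common form of all bounds on the state: a mean over
    [[0, T]] and the sample space that is bounded uniformly in [T]. *)
Definition avg_bounded (f : TO -> R) := measurable_fun setT f /\
  exists2 C : R, 0 <= C & forall T, 0 < T ->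
    (\int[mu \x P]_(z in strip T) `|f z|%:E <= (C * T)%:E)%E.

Lemma avg_bounded_le (f h : TO -> R) : measurable_fun setT f -> avg_bounded h ->
  {ae (mu \x P)%E, forall z, 0 <= z.1 -> `|f z| <= `|h z|} -> avg_bounded f.
Proof.
move=> mf [mh [C C0 hC]] fh; split => //; exists C => // T T0.
apply: le_trans (hC T T0); apply: ae_ge0_le_integral => //.
- by apply/measurable_EFinP; apply: measurableT_comp => //; exact: measurable_funTS.
- by apply/measurable_EFinP; apply: measurableT_comp => //; exact: measurable_funTS.
- apply: ae_prodS fh => z h0 [/= + _]; rewrite in_itv/= => /andP[z0 _].
  by rewrite lee_fin; exact: h0.
Qed.

Lemma avg_boundedD (f h : TO -> R) : avg_bounded f -> avg_bounded h ->
  avg_bounded (fun z => f z + h z).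
Proof.
move=> [mf [C C0 fC]] [mh [C' C'0 hC]]; split; first exact: measurable_funD.
exists (C + C'); first exact: addr_ge0.
move=> T T0; have mfS := @measurable_funTS _ _ _ _ (strip T) _ mf.
have mhS := @measurable_funTS _ _ _ _ (strip T) _ mh.
rewrite mulrDl EFinD; apply: le_trans (leeD (fC T T0) (hC T T0)).
rewrite -ge0_integralD//; try by [apply/measurable_EFinP; exact: measurableT_comp].
apply: ge0_le_integral => //.
- by apply/measurable_EFinP; apply: measurableT_comp => //; exact: measurable_funD.
- by apply: emeasurable_funD; apply/measurable_EFinP; exact: measurableT_comp.
- by move=> z _; rewrite -EFinD lee_fin ler_normD.
Qed.

Lemma avg_boundedZ (c : R) (f : TO -> R) : avg_bounded f ->
  avg_bounded (fun z => c * f z).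
Proof.
move=> [mf [C C0 fC]]; split; first exact: measurable_funM.
exists (`|c| * C); first exact: mulr_ge0.
move=> T T0; have mfS := @measurable_funTS _ _ _ _ (strip T) _ mf.
under eq_integral do rewrite normrM EFinM.
rewrite ge0_integralZl//; last by apply/measurable_EFinP; exact: measurableT_comp.
by rewrite -mulrA EFinM; apply: lee_wpmul2l => //; exact: fC.
Qed.

Lemma avg_bounded_cst (c : R) : avg_bounded (cst c).
Proof.
split => //; exists `|c| => // T T0.
rewrite [leLHS](_ : _ = (`|c|%:E * (mu \x P)%E (strip T))%E).
  by rewrite measure_strip.
exact: (integral_cst (mu \x P)%E (measurable_strip T) `|c|%:E).
Qed.

Definition strip_int T (f : TO -> R) : R := fine (\int[mu \x P]_(z in strip T) (f z)%:E)%E.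

Lemma avg_bounded_integrable T f : 0 < T -> avg_bounded f ->
  (mu \x P)%E.-integrable (strip T) (EFin \o f).
Proof.
move=> T0 [mf [C C0 fC]]; have [|_ _ //] := strip_fubini (P := P) (T := T) mf.
by apply: le_lt_trans (fC T T0) _; exact: ltry.
Qed.

Lemma strip_intD T f h : 0 < T -> avg_bounded f -> avg_bounded h ->
  strip_int T (fun z => f z + h z) = strip_int T f + strip_int T h.
Proof. by move=> T0 af ah; apply: RintegralD => //; exact: avg_bounded_integrable. Qed.

Lemma strip_intZ T c f : 0 < T -> avg_bounded f ->
  strip_int T (fun z => c * f z) = c * strip_int T f.
Proof. by move=> T0 af; apply: RintegralZl => //; exact: avg_bounded_integrable. Qed.

Lemma strip_int_abs f : avg_bounded f -> exists2 C : R, 0 <= C &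
  forall T, 0 < T -> `|strip_int T f| <= C * T.
Proof.
move=> af; have [mf [C C0 fC]] := af; exists C => // T T0.
have iF := avg_bounded_integrable T0 af.
rewrite /strip_int -lee_fin; apply: le_trans (fC T T0).
rewrite -fine_abse; last exact: integrable_fin_num.
rewrite fineK; last by rewrite abse_fin_num; exact: integrable_fin_num.
apply: le_abse_integral => //; apply/measurable_EFinP; exact: measurable_funTS.
Qed.

Lemma strip_int_le T f h : 0 < T -> avg_bounded f -> avg_bounded h ->
  {ae (mu \x P)%E, forall z, 0 <= z.1 -> f z <= h z} -> strip_int T f <= strip_int T h.
Proof.
move=> T0 af ah fh.
have ad : avg_bounded (fun z => h z + (-1) * f z).
  by apply: avg_boundedD => //; exact: avg_boundedZ.
have : 0 <= strip_int T (fun z => h z + (-1) * f z).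
  rewrite /strip_int (ae_eq_integral (fun z => (`|h z + (-1) * f z|)%:E))//.
  - by apply: fine_ge0; apply: integral_ge0.
  - apply/measurable_EFinP/measurable_funTS; exact: ad.1.
  - apply/measurable_EFinP/measurable_funTS; apply: measurableT_comp => //; exact: ad.1.
  - apply: ae_prodS fh => z fh [/= + _]; rewrite in_itv/= => /andP[/fh z0 _].
    by rewrite ger0_norm//; lra.
by rewrite strip_intD ?strip_intZ//; [lra|exact: avg_boundedZ].
Qed.

Hypothesis P_complete : P.-negligible `<=` measurable.

Lemma ae_time (Q : Omega -> Prop) : {ae P, forall w, Q w} ->
  {ae (mu \x P)%E, forall z, Q z.2}.
Proof.
move=> [N [mN N0 QN]]; exists (setT `*` N); split.
- exact: measurableX.
- apply: (etrans (product_measure1E _ _ _ mN)) => //.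
  by move: N0 => /= N0; rewrite (_ : P N = 0%E)?mule0//.
- by move=> z /= nQ; split => //; exact: QN.
Qed.

(** Tonelli's theorem applies to jointly measurable representatives only. *)
Definition version (f : TO -> R) (f0 : R -> Omega -> R) :=
  {ae P, forall w, forall t, 0 <= t -> f0 t w = f (t, w)}.

Lemma version_ae f f0 : version f f0 ->
  {ae (mu \x P)%E, forall z, 0 <= z.1 -> f0 z.1 z.2 = f z}.
Proof. by move=> /ae_time; apply: ae_prodS => -[t w] /= h; exact: h. Qed.

Lemma version_strip T (f : TO -> R) (f0 : R -> Omega -> R) :
  measurable_fun setT f -> (forall z, 0 <= f z) ->
  version f f0 ->
  (\int[P]_w \int[mu]_(t in `[0%R, T]) (f0 t w)%:E =
   \int[mu \x P]_(z in strip T) (f z)%:E)%E.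
Proof.
move=> mf f_ge0 v; have mF : measurable_fun setT (EFin \o f) by exact/measurable_EFinP.
have F0 z : (0 <= (EFin \o f) z)%E by rewrite lee_fin.
rewrite (strip_tonelli P T mF F0).
have mI := measurable_path_integral T mF F0.
have E : {ae P, forall w, (\int[mu]_(t in `[0%R, T]) (EFin \o f) (t, w))%E =
    (\int[mu]_(t in `[0%R, T]) (f0 t w)%:E)%E}.
  apply: filterS v => w h; apply: eq_integral => t; rewrite inE/= in_itv/= => /andP[t0 _].
  by rewrite h.
apply: ae_eq_integral => //.
- exact: (complete_measurable_fun P_complete mI E).
- by apply: filterS E => w h _.
Qed.

Lemma version_expectation T f f0 (N : Omega -> R) : 0 < T -> avg_bounded f ->
  version f f0 -> P.-integrable setT (EFin \o N) ->
  ('E_P[fun w => ((\int[mu]_(t in `[0%R, T]) f0 t w) - N w)%R])%E =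
  (strip_int T f - fine 'E_P[N])%:E.
Proof.
move=> T0 af v iN; have [mf [C C0 fC]] := af.
have [|iI IE iS] := strip_fubini (P := P) (T := T) mf.
  by apply: le_lt_trans (fC T T0) _; exact: ltry.
have E : {ae P, forall w, (\int[mu]_(t in `[0%R, T]) f (t, w))%R =
    (\int[mu]_(t in `[0%R, T]) f0 t w)%R}.
  apply: filterS v => w h; congr fine; apply: eq_integral => t.
  by rewrite inE/= in_itv/= => /andP[t0 _]; rewrite h.
have mN : measurable_fun setT N by apply/measurable_EFinP; exact: measurable_int iN.
have mI : measurable_fun setT (fun w => \int[mu]_(t in `[0%R, T]) f (t, w)).
  by apply/measurable_EFinP; exact: measurable_int iI.
rewrite unlock (ae_eq_integral (fun w =>
    (\int[mu]_(t in `[0%R, T]) f (t, w))%:E - (N w)%:E)%E)//; first last.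
- by apply: filterS E => w h _ /=; rewrite h EFinB.
- by apply: emeasurable_funB; exact/measurable_EFinP.
- apply/measurable_EFinP; apply: measurable_funB => //.
  exact: (complete_measurable_fun P_complete mI E).
rewrite integralB// IE EFinB; congr (_ - _)%E; rewrite fineK//.
- exact: integrable_fin_num.
- exact: integrable_fin_num.
Qed.

Lemma sup_mean_moment_avg (a : R) (f : TO -> R) (f0 : R -> Omega -> R) : measurable_fun setT f ->
  version f f0 ->
  (sup_mean_moment P a f0 < +oo)%E <-> avg_bounded (fun z => `|f z| `^ a).
Proof.
move=> mf v; pose h z := `|f z| `^ a.
have mh : measurable_fun setT h.
  apply: (measurableT_comp (measurable_powR _)); exact: measurableT_comp.
have h0 z : 0 <= h z by exact: powR_ge0.
have vh : version h (fun t w => `|f0 t w| `^ a).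
  by apply: filterS v => w vw t t0; rewrite vw.
have E T := version_strip T mh h0 vh.
have normh z : `|h z|%:E = (h z)%:E by rewrite ger0_norm.
split => [supfin|[_ [C C0 hC]]].
  pose S := sup_mean_moment P a f0.
  have S0 : (0 <= S)%E.
    apply: le_trans (ereal_sup_ubound (ex_intro2 _ _ 1 ltr01 erefl)).
    rewrite invr1 mul1e; apply: integral_ge0 => w _; apply: integral_ge0 => t _.
    by rewrite lee_fin powR_ge0.
  split => //; exists (fine S); first exact: fine_ge0.
  move=> T T0; rewrite (eq_integral _ _ (fun z _ => normh z)) -E.
  have : ((T^-1)%:E * \int[P]_w \int[mu]_(t in `[0%R, T]) (`|f0 t w| `^ a)%:E <= S)%E.
    by apply: ereal_sup_ubound; exists T.
  have Sfin : S \is a fin_num by rewrite ge0_fin_numE.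
  by rewrite lee_pdivrMl// -{1}(fineK Sfin) -EFinM mulrC.
apply: (@le_lt_trans _ _ C%:E); last exact: ltry.
apply: ge_ereal_sup => _ [T T0 <-]; rewrite /= in T0.
rewrite E lee_pdivrMl// -EFinM mulrC.
by apply: le_trans (hC T T0); rewrite (eq_integral _ _ (fun z _ => normh z)).
Qed.

End avg_bounded.

(** * Moment conditions *)

Section moment_conditions.
Context {d : measure_display} {Omega : measurableType d} {R : realType}.
Variable P : probability Omega R.
Notation mu := (@lebesgue_measure R).
Notation TO := (measurableTypeR R * Omega)%type.
Notation avg_bounded := (avg_bounded P).
Notation version := (version P).
Hypothesis P_complete : P.-negligible `<=` measurable.

Definition ess_le (f : TO -> R) (C : R) :=
  {ae (mu \x P)%E, forall z, 0 <= z.1 -> f z <= C}.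

Lemma version_ess_le (f : TO -> R) (f0 : R -> Omega -> R) (C : R) : version f f0 ->
  {ae (mu \x P)%E, forall z, 0 <= z.1 -> f0 z.1 z.2 <= C} <-> ess_le f C.
Proof.
move=> /version_ae v; split => h; apply: ae_prodS (ae_prod_and v h) => z [vz hz] z0.
  by rewrite -vz//; exact: hz.
by rewrite vz//; exact: hz.
Qed.

(** The moment condition, read on a jointly measurable version of the state. *)
Definition moment_fun (r : \bar R) (f : TO -> R) : Prop :=
  match r with
  | r%:E => avg_bounded (fun z => f z `^ (2 * r))
  | _ => exists C, ess_le f C
  end.

Lemma moment_conditionE (r : \bar R) (f : TO -> R) (f0 : R -> Omega -> R) :
  measurable_fun setT f -> (forall z, 0 <= f z) ->
  version f f0 -> moment_condition P r f0 <-> moment_fun r f.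
Proof.
move=> mf f_ge0 v.
have B : ess_bounded P f0 <-> exists C, ess_le f C.
  have vn : version (fun z => `|f z|) (fun t w => `|f0 t w|).
    by apply: filterS v => w vw t t0; rewrite vw.
  split => -[C h]; exists C.
    have := (version_ess_le C vn).1 h; apply: ae_prodS => z hz /hz.
    by rewrite ger0_norm.
  apply/(version_ess_le C vn); apply: ae_prodS h => z hz /hz.
  by rewrite ger0_norm.
case: r => [r||] //=; have := sup_mean_moment_avg P_complete (2 * r) mf v.
by under [fun z => `|f z| `^ _]eq_fun do rewrite ger0_norm//.
Qed.

(** For convex combinations of states, which lie below the maximum; hence the
    controls satisfying the moment condition form a convex set. *)
Lemma moment_fun_max (r : \bar R) (f f1 f2 : TO -> R) : measurable_fun setT f ->
  (forall z, 0 <= f z <= Num.max (f1 z) (f2 z)) -> (1 <= r)%E ->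
  moment_fun r f1 -> moment_fun r f2 -> moment_fun r f.
Proof.
move=> mf f12; case: r => [r|_|//]; first rewrite lee_fin => r1.
  move=> a1 a2; apply: avg_bounded_le (avg_boundedD a1 a2) _.
    exact: (measurableT_comp (measurable_powR _)).
  apply: aeW => z _; rewrite !ger0_norm ?addr_ge0 ?powR_ge0//.
  have /andP[f0 +] := f12 z; rewrite le_max => /orP[h|h].
    apply: le_trans (_ : f1 z `^ (2 * r) <= _); last by rewrite lerDl powR_ge0.
    by apply: ge0_ler_powR => //; rewrite ?nnegrE ?(le_trans f0 h)//; lra.
  apply: le_trans (_ : f2 z `^ (2 * r) <= _); last by rewrite lerDr powR_ge0.
  by apply: ge0_ler_powR => //; rewrite ?nnegrE ?(le_trans f0 h)//; lra.
move=> [C1 h1] [C2 h2]; exists (Num.max C1 C2).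
apply: ae_prodS (ae_prod_and h1 h2) => z [{}h1 {}h2] z0.
have /andP[_] := f12 z; rewrite le_max => /orP[h|h]; rewrite le_max.
  by rewrite (le_trans h (h1 z0)).
by rewrite (le_trans h (h2 z0)) orbT.
Qed.

Lemma powR_le1D (x a b : R) : 0 <= x -> 0 < a -> a <= b -> x `^ a <= 1 + x `^ b.
Proof.
move=> x0 a0 ab; have [x1|/ltW x1] := leP x 1.
  apply: (@le_trans _ _ 1); last by rewrite lerDl powR_ge0.
  have := @ge0_ler_powR _ a (ltW a0) x 1; rewrite powR1 !nnegrE x0 x1 ler01.
  exact.
by apply: le_trans (ler_powR x1 ab) _; rewrite lerDr.
Qed.

Lemma moment_fun_sqr (r : \bar R) (f : TO -> R) : measurable_fun setT f -> (forall z, 0 <= f z) ->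
  (1 <= r)%E -> moment_fun r f -> avg_bounded (fun z => f z ^+ 2).
Proof.
move=> mf f0; have m2 : measurable_fun setT (fun z => f z ^+ 2).
  exact: measurable_funX.
case: r => [r||]//=; rewrite ?lee_fin => r1.
  move=> a; apply: avg_bounded_le (avg_boundedD (avg_bounded_cst P 1) a) _ => //.
  apply: aeW => z _; rewrite !ger0_norm ?addr_ge0 ?powR_ge0 ?sqr_ge0//=.
  by rewrite -powR_mulrn//; apply: powR_le1D => //; lra.
move=> [C h]; apply: avg_bounded_le (avg_bounded_cst P (C ^+ 2)) _ => //.
apply: ae_prodS h => z hz /hz fC; rewrite /= !ger0_norm ?sqr_ge0//.
by apply: lerXn2r => //; rewrite nnegrE//; exact: le_trans fC.
Qed.

Definition inverse_moment_fun (r : \bar R) (u : TO -> R) : Prop :=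
  match r with
  | r%:E => avg_bounded (fun z => u z `^ r)
  | _ => exists C, ess_le u C
  end.

(** For the infinite exponent, the bounds on the strips share one constant, and
    countably many strips cover the half-line. *)
Lemma inverse_moment_conditionE (alpha : R) (r : \bar R) (f : TO -> R)
    (f0 : R -> Omega -> R) : measurable_fun setT f ->
  version f f0 -> inverse_moment_condition P alpha r f0 ->
  inverse_moment_fun r (fun z => f z `^ (alpha - 2)).
Proof.
move=> mf v; pose u z := f z `^ (alpha - 2).
pose u0 t w := f0 t w `^ (alpha - 2).
have mu_ : measurable_fun setT u by exact: (measurableT_comp (measurable_powR _)).
have vu : version u u0 by apply: filterS v => w vw t t0; rewrite /u0 vw.
have B : (sup_ess_bound P u0 < +oo)%E -> exists C, ess_le u C.
  move=> supfin.
  have [c hc] : exists c : R, (sup_ess_bound P u0 < c%:E)%E.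
    case E : (sup_ess_bound P u0) supfin => [s||]//= _.
      by exists (s + 1); rewrite lte_fin; lra.
    by exists 0; exact: ltNyr.
  exists c.
  have H (n : nat) : {ae (mu \x P)%E, forall z : TO, 0 <= z.1 <= n.+1%:R -> u z <= c}.
    have : (ereal_inf [set C%:E | C in [set C : R | (0 <= C)%R /\
      {ae (mu \x P)%E, forall z, (0 <= z.1 <= n.+1%:R)%R -> (u0 z.1 z.2 <= C)%R}]] < c%:E)%E.
      apply: (@le_lt_trans _ _ (sup_ess_bound P u0)) => //.
      by apply: ereal_sup_ubound; exists n.+1%:R => //=.
    move=> /ereal_inf_lt [_ [C [C0 hC] <-]]; rewrite lte_fin => /ltW Cc.
    apply: ae_prodS (ae_prod_and (version_ae vu) hC) => z [vz hz] /[dup] /andP[z0 _].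
    by move=> /hz; rewrite vz// => /le_trans; apply.
  have [N [mN N0 HN]] : (mu \x P)%E.-negligible
      (\bigcup_n [set z : TO | ~ (0 <= z.1 <= n.+1%:R -> u z <= c)]).
    by apply: negligible_bigcup => n; exact: H.
  exists N; split => // z /= nz; apply: HN.
  have [n zn] : exists n : nat, z.1 <= n.+1%:R.
    exists (Num.truncn `|z.1|); apply: le_trans (ler_norm _) _.
    exact/ltW/truncnS_gt.
  exists n => //= h; apply: nz => z0; apply: h; by rewrite z0.
case: r => [r||]//= /(sup_mean_moment_avg P_complete r mu_ vu).1.
by under [fun z => `|u z| `^ _]eq_fun do rewrite ger0_norm ?powR_ge0//.
Qed.

(** Young's inequality [u f^2 <= u^r' / r' + f^(2 r) / r]; at an infinite exponent
    one of the two factors is bounded, and the other is dominated by its moment. *)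
Lemma conjugate_avg_bounded (r r' : \bar R) (u f : TO -> R) : (1 <= r)%E -> (1 <= r')%E ->
  (r^-1 + r'^-1 = 1)%E -> measurable_fun setT u -> (forall z, 0 <= u z) ->
  measurable_fun setT f -> (forall z, 0 <= f z) ->
  inverse_moment_fun r' u -> moment_fun r f -> avg_bounded (fun z => u z * f z ^+ 2).
Proof.
move=> r1 r'1 rr' mu_ u0 mf f0 iu mfr.
have muf : measurable_fun setT (fun z => u z * f z ^+ 2).
  by apply: measurable_funM => //; exact: measurable_funX.
have f2 := moment_fun_sqr mf f0 r1 mfr.
case: r' r'1 rr' iu => [r'||]//= r'1 rr' iu; last first.
  have [C hC] := iu.
  apply: avg_bounded_le (avg_boundedZ C f2) _ => //.
  apply: ae_prodS hC => z hz /hz uC.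
  have C0 : 0 <= C by exact: le_trans uC.
  by rewrite !ger0_norm ?mulr_ge0 ?sqr_ge0// ler_wpM2r ?sqr_ge0.
rewrite lee_fin in r'1.
case: r r1 rr' mfr => [r||]//= r1 rr' mfr; last first.
  have [C hC] := mfr.
  apply: avg_bounded_le (avg_boundedZ (C ^+ 2) (avg_boundedD (avg_bounded_cst P 1) iu)) _ => //.
  apply: ae_prodS hC => z hz /hz fC.
  have C0 : 0 <= C by exact: le_trans fC.
  rewrite !ger0_norm ?mulr_ge0 ?sqr_ge0 ?addr_ge0 ?powR_ge0//= mulrC.
  apply: ler_pM; rewrite ?sqr_ge0//; first by apply: lerXn2r; rewrite ?nnegrE.
  by rewrite -{1}(powRr1 (u0 z)); exact: powR_le1D.
rewrite lee_fin in r1.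
have r0 : 0 < r by lra.
have r'0 : 0 < r' by lra.
have {}rr' : r'^-1 + r^-1 = 1.
  by move: rr'; rewrite !inver !gt_eqF// -EFinD => -[]; rewrite addrC.
apply: avg_bounded_le (avg_boundedD iu mfr) _ => //.
apply: aeW => z _; rewrite !ger0_norm ?mulr_ge0 ?sqr_ge0 ?addr_ge0 ?powR_ge0//=.
apply: le_trans (conjugate_powR (u0 z) (sqr_ge0 (f z)) r'0 r0 rr') _.
rewrite -powR_mulrn// -powRrM.
by apply: lerD; rewrite ler_pdivrMr// ler_peMr// powR_ge0.
Qed.

End moment_conditions.

(** * First-order comparison of two controls *)

Section comparison.
Context {d : measure_display} {Omega : measurableType d} {R : realType}.
Variables (P : probability Omega R) (F0m : set (set Omega)) (F : R -> set (set Omega)).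
Variables q alpha : R.
Variables (X : (R -> Omega -> R) -> (R -> Omega -> R)) (p lambda : R).
Notation mu := (@lebesgue_measure R).
Notation TO := (measurableTypeR R * Omega)%type.
Notation avg_bounded := (avg_bounded P).
Notation version := (version P).
Notation S := (strip_int P).
Notation g := (g alpha p lambda).
Notation g_x := (g_x alpha p lambda).
Notation FO nuh nu := (mean_first_order P q alpha X p lambda nuh nu).
Notation payoff_at nu := (mean_payoff P q alpha X p lambda nu).
Notation oo := (pinfty_nbhs R).

Hypothesis F_usual : usual_filtration P F0m F.
Hypotheses (alpha_gt0 : 0 < alpha) (alpha_lt1 : alpha < 1) (p_gt0 : 0 < p).
Let P_complete := usual_complete F_usual.

(* A Borel form of the marginal profit: the last term corrects the value of the
   closed formula at 0, where the derivative has no explicit expression. *)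
Let dg (x : R) := p * (alpha * x `^ (alpha - 1)) + lambda +
  (g_x 0 - (p * (alpha * 0 `^ (alpha - 1)) + lambda)) * \1_[set 0%R] x.

Lemma marginalE x : 0 <= x -> g_x x = dg x.
Proof.
rewrite /dg le_eqVlt => /orP[/eqP <-|x0].
  by rewrite indicE mem_set//= mulr1 addrC subrK.
rewrite g_xE// indicE memNset ?mulr0 ?addr0//=; first by move=> h; rewrite h ltxx in x0.
Qed.

Lemma measurable_marginal : measurable_fun setT dg.
Proof.
apply: measurable_funD.
  by do 3?[apply: measurable_funD|apply: measurable_funM] => //.
by apply: measurable_funM => //; exact: measurable_indic.
Qed.

Lemma measurable_g : measurable_fun setT g.
Proof. by apply: measurable_funD; apply: measurable_funM. Qed.

Lemma g_bound x : 0 <= x -> `|g x| <= (p + `|lambda|) * (2 + x ^+ 2).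
Proof.
move=> x0; rewrite /Defs.g; apply: le_trans (ler_normD _ _) _.
rewrite !normrM (ger0_norm (ltW p_gt0)) (ger0_norm (powR_ge0 _ _)) (ger0_norm x0) mulrDl.
have x1 : x <= 2 + x ^+ 2 by nra.
apply: lerD; last exact: ler_wpM2l.
apply: ler_wpM2l; first exact: ltW.
apply: le_trans (powR_le1D x0 alpha_gt0 (ltW alpha_lt1)) _.
by rewrite powRr1//; nra.
Qed.

Section one_control.
Variables (nu : R -> Omega -> R) (nu_adm : admissible P F nu).

Lemma control_integrable T : 0 < T -> P.-integrable setT (EFin \o nu T).
Proof.
move=> T0; have mnu := adapted_measurable F_usual (adm_adapted nu_adm) (ltW T0).
apply/integrableP; split; first exact/measurable_EFinP.
apply: le_lt_trans (adm_mean nu_adm T0); rewrite unlock le_eqVlt; apply/orP; left.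
apply/eqP; apply: ae_eq_integral => //.
- by apply: measurableT_comp => //; exact/measurable_EFinP.
- exact/measurable_EFinP.
- by apply: filterS (adm_ge0 nu_adm) => w h _ /=; rewrite ger0_norm// h// ltW.
Qed.

Lemma control_mean_ge0 T : 0 < T -> 0 <= fine 'E_P[nu T].
Proof.
move=> T0; have mnu := adapted_measurable F_usual (adm_adapted nu_adm) (ltW T0).
rewrite unlock (ae_eq_integral (fun w => (`|nu T w|)%:E))//.
- by apply: fine_ge0; apply: integral_ge0.
- exact/measurable_EFinP.
- by apply/measurable_EFinP; exact: measurableT_comp.
- by apply: filterS (adm_ge0 nu_adm) => w h _ /=; rewrite ger0_norm// h// ltW.
Qed.

Lemma mean_payoffE T Y : 0 < T -> avg_bounded (g \o Y) -> version Y (X nu) ->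
  payoff_at nu T = (T^-1 * (S T (g \o Y) - q * fine 'E_P[nu T]))%:E.
Proof.
move=> T0 ag v; rewrite /mean_payoff EFinM; congr (_ * _)%E.
have vg : version (g \o Y) (fun t w => g (X nu t w)).
  by apply: filterS v => w vw t t0; rewrite vw.
have iq : P.-integrable setT (EFin \o (fun w => q * nu T w)).
  exact: (integrableZl measurableT q (control_integrable T0)).
rewrite (version_expectation P_complete T0 ag vg iq); congr (_ - _)%:E.
rewrite unlock; under eq_integral do rewrite EFinM.
rewrite integralZl//; last exact: control_integrable.
rewrite fineM//; exact: (integrable_fin_num measurableT (control_integrable T0)).
Qed.

End one_control.

Lemma mean_first_orderE (nuh nu : R -> Omega -> R) T (Yh Y : TO -> R) : 0 < T ->
  admissible P F nuh -> admissible P F nu -> (forall z, 0 <= Yh z) ->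
  avg_bounded (fun z => dg (Yh z) * (Yh z - Y z)) ->
  version Yh (X nuh) -> version Y (X nu) ->
  FO nuh nu T = (T^-1 * (S T (fun z => dg (Yh z) * (Yh z - Y z)) -
    q * (fine 'E_P[nuh T] - fine 'E_P[nu T])))%:E.
Proof.
move=> T0 ah an Yh0 af vh v; rewrite /mean_first_order EFinM; congr (_ * _)%E.
have vg : version (fun z => dg (Yh z) * (Yh z - Y z))
    (fun t w => g_x (X nuh t w) * (X nuh t w - X nu t w)).
  by apply: filterS2 vh v => w h1 h2 t t0; rewrite h1// h2// marginalE.
have ih := control_integrable ah T0; have i := control_integrable an T0.
have iB : P.-integrable setT (fun w => (nuh T w)%:E - (nu T w)%:E)%E.
  exact: integrableB.
have iq : P.-integrable setT (EFin \o (fun w => q * (nuh T w - nu T w))).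
  exact: (integrableZl measurableT q iB).
rewrite (version_expectation P_complete T0 af vg iq); congr (_ - _)%:E.
rewrite unlock; under eq_integral do rewrite EFinM EFinB.
rewrite integralZl// integralB// fineM//; last first.
  by rewrite fin_numB; apply/andP; split; exact: (integrable_fin_num measurableT).
by rewrite fineB//; exact: (integrable_fin_num measurableT).
Qed.

Lemma admissible_comb (nu1 nu2 : R -> Omega -> R) (a b : R) : 0 <= a -> 0 <= b ->
  admissible P F nu1 -> admissible P F nu2 ->
  admissible P F (fun t w => a * nu1 t w + b * nu2 t w).
Proof.
move=> a0 b0 n1 n2; split.
- move=> t t0; have sF := uf_sigma F_usual t0.
  apply: (measurable_wrtD sF); apply: (measurable_wrtM sF).
  + exact: measurable_wrt_cst.
  + exact: (adm_adapted n1).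
  + exact: measurable_wrt_cst.
  + exact: (adm_adapted n2).
- apply: filterS2 (adm_ge0 n1) (adm_ge0 n2) => w h1 h2 t t0.
  by rewrite addr_ge0// mulr_ge0 ?h1 ?h2.
- apply: filterS2 (adm_incr n1) (adm_incr n2) => w h1 h2 s t s0 st.
  by apply: lerD; apply: ler_wpM2l => //; [exact: h1|exact: h2].
- apply: filterS2 (adm_right_continuous n1) (adm_right_continuous n2) => w h1 h2 t t0.
  by apply: cvgD; apply: cvgMr; [exact: h1|exact: h2].
- move=> T T0; have i1 := integrableZl measurableT a (control_integrable n1 T0).
  have i2 := integrableZl measurableT b (control_integrable n2 T0).
  have := integrable_fin_num measurableT (integrableD measurableT i1 i2).
  rewrite fin_numElt => /andP[_]; rewrite unlock; apply: le_lt_trans.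
  by rewrite le_eqVlt; apply/orP; left; apply/eqP;
    apply: eq_integral => w _; rewrite /= EFinD !EFinM.
Qed.

Section two_controls.
Variables (nuh nu : R -> Omega -> R) (Yh Y : TO -> R).
Hypotheses (nuh_adm : admissible P F nuh) (nu_adm : admissible P F nu).
Hypotheses (mYh : measurable_fun setT Yh) (mY : measurable_fun setT Y).
Hypotheses (Yh_ge0 : forall z, 0 <= Yh z) (Y_ge0 : forall z, 0 <= Y z).
Hypotheses (vYh : version Yh (X nuh)) (vY : version Y (X nu)).
Hypothesis Yh_gt0 : {ae (mu \x P)%E, forall z, 0 <= z.1 -> 0 < Yh z}.
Hypotheses (Yh2 : avg_bounded (fun z => Yh z ^+ 2)) (Y2 : avg_bounded (fun z => Y z ^+ 2)).
Let u z := Yh z `^ (alpha - 2).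
Hypotheses (uYh2 : avg_bounded (fun z => u z * Yh z ^+ 2)).
Hypotheses (uY2 : avg_bounded (fun z => u z * Y z ^+ 2)).
Let fo z := dg (Yh z) * (Yh z - Y z).
Let dev z := u z * (Y z - Yh z) ^+ 2.

Let mu_ : measurable_fun setT u.
Proof. exact: (measurableT_comp (measurable_powR _)). Qed.

Lemma avg_bounded_g (Z : TO -> R) : measurable_fun setT Z -> (forall z, 0 <= Z z) ->
  avg_bounded (fun z => Z z ^+ 2) -> avg_bounded (g \o Z).
Proof.
move=> mZ Z0 Z2.
apply: avg_bounded_le (avg_boundedZ (p + `|lambda|)
  (avg_boundedD (avg_bounded_cst P 2) Z2)) _.
  exact: (measurableT_comp measurable_g).
apply: aeW => z _ /=; apply: le_trans (g_bound (Z0 z)) _; exact: ler_norm.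
Qed.

Lemma avg_bounded_dev : avg_bounded dev.
Proof.
apply: avg_bounded_le (avg_boundedZ 2 (avg_boundedD uY2 uYh2)) _.
  by apply: measurable_funM => //; apply: measurable_funX; exact: measurable_funB.
apply: aeW => z _; apply: le_trans (ler_norm _).
have u0 : 0 <= u z by exact: powR_ge0.
rewrite /dev (ger0_norm (mulr_ge0 u0 (sqr_ge0 _)))/=.
have := mulr_ge0 u0 (sqr_ge0 (Y z + Yh z)); lra.
Qed.

(** Since [xh ^ (alpha - 1) = xh ^ (alpha - 2) xh], the power part of the integrand
    is dominated by [xh ^ (alpha - 2) (xh^2 + x^2)]. *)
Lemma avg_bounded_fo : avg_bounded fo.
Proof.
apply: avg_bounded_le (avg_boundedD
  (avg_boundedZ (2 * p * alpha) (avg_boundedD uYh2 uY2))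
  (avg_boundedZ `|lambda| (avg_boundedD (avg_bounded_cst P 2) (avg_boundedD Yh2 Y2)))) _.
  apply: measurable_funM; last exact: measurable_funB.
  exact: (measurableT_comp measurable_marginal).
apply: ae_prodS Yh_gt0 => z /[apply] h0; apply: le_trans (ler_norm _).
rewrite /fo -marginalE// g_xE// powR_sub1// -/(u z) /=.
have := Y_ge0 z; have : 0 <= u z by exact: powR_ge0.
move: (u z) (Yh z) (Y z) h0 => v x y x0 v0 y0.
have xy : `|x - y| <= x + y.
  by rewrite ler_norml; apply/andP; split; lra.
rewrite mulrDl; apply: le_trans (ler_normD _ _) _; apply: lerD; last first.
  rewrite normrM; apply: ler_wpM2l => //; apply: le_trans xy _.
  have := sqr_ge0 (x - 1); have := sqr_ge0 (y - 1); lra.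
have k0 : 0 <= p * alpha by rewrite mulr_ge0 ?ltW.
rewrite -!mulrA mulrA normrM (ger0_norm k0).
have -> : 2 * (p * (alpha * (v * x ^+ 2 + v * y ^+ 2))) =
  p * alpha * (v * (2 * (x ^+ 2 + y ^+ 2))) by ring.
apply: ler_wpM2l => //; rewrite normrM (ger0_norm v0); apply: ler_wpM2l => //.
rewrite normrM gtr0_norm//; apply: le_trans (ler_wpM2l (ltW x0) xy) _; nra.
Qed.

(** Concavity of [g], integrated; the costs of the controls enter both sides
    linearly and cancel. *)
Lemma first_order_upper : \forall T \near oo, exists a b f : R,
  [/\ payoff_at nu T = a%:E, payoff_at nuh T = b%:E, FO nuh nu T = f%:E & f <= b - a].
Proof.
have agh := avg_bounded_g mYh Yh_ge0 Yh2; have ag := avg_bounded_g mY Y_ge0 Y2.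
near=> T.
have T0 : 0 < T by near: T; exact: nbhs_pinfty_gt.
do 3!eexists; split.
- exact: (mean_payoffE nu_adm T0 ag vY).
- exact: (mean_payoffE nuh_adm T0 agh vYh).
- exact: (mean_first_orderE T0 nuh_adm nu_adm Yh_ge0 avg_bounded_fo vYh vY).
rewrite -mulrBr; apply: ler_wpM2l; first by rewrite invr_ge0 ltW.
have : S T fo <= S T (fun z => (g \o Yh) z + (-1) * (g \o Y) z).
  apply: strip_int_le => //; first exact: avg_bounded_fo.
    by apply: avg_boundedD => //; exact: avg_boundedZ.
  apply: ae_prodS Yh_gt0 => z /[apply] h0; rewrite /fo -marginalE//=.
  have := g_tangent lambda alpha_gt0 alpha_lt1 p_gt0 (Y_ge0 z) h0; lra.
rewrite strip_intD//; last exact: avg_boundedZ.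
rewrite strip_intZ//; rewrite -/fo; lra.
Unshelve. all: by end_near. Qed.

Variables (e : R) (nue : R -> Omega -> R).
Hypotheses (e_gt0 : 0 < e) (e_le : e <= 1 / 2) (nue_adm : admissible P F nue).
Hypothesis nueE : forall t w, nue t w = e * nu t w + (1 - e) * nuh t w.
Hypothesis vYe : version (fun z => e * Y z + (1 - e) * Yh z) (X nue).

Lemma control_mean_comb T : 0 < T ->
  fine 'E_P[nue T] = e * fine 'E_P[nu T] + (1 - e) * fine 'E_P[nuh T].
Proof.
move=> T0; have ih := control_integrable nuh_adm T0; have i := control_integrable nu_adm T0.
have i1 := integrableZl measurableT e i; have i2 := integrableZl measurableT (1 - e) ih.
rewrite unlock; under eq_integral do rewrite nueE EFinD !EFinM.
rewrite integralD// !integralZl// fineD ?fineM//; try exact: (integrable_fin_num measurableT).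
  by apply: fin_numM => //; exact: (integrable_fin_num measurableT).
by apply: fin_numM => //; exact: (integrable_fin_num measurableT).
Qed.

(** The cost of the perturbed control is affine in [e], so that the remainder comes
    from [g] alone and is quadratic. *)
Lemma first_order_lower (C : R) : (forall T, 0 < T -> `|S T dev| <= C * T) ->
  \forall T \near oo, exists a b f : R,
  [/\ payoff_at nue T = a%:E, payoff_at nuh T = b%:E, FO nuh nu T = f%:E &
      b - a <= e * f + e ^+ 2 * (2 * p * alpha * C)].
Proof.
move=> devC; pose Ye z := e * Y z + (1 - e) * Yh z.
have e0 := ltW e_gt0; have e1 : 0 <= 1 - e by have : e <= 1 / 2 by []; lra.
have Ye_ge0 z : 0 <= Ye z by rewrite addr_ge0// mulr_ge0.
have mYe : measurable_fun setT Ye by apply: measurable_funD; exact: measurable_funM.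
have Ye2 : avg_bounded (fun z => Ye z ^+ 2).
  apply: avg_bounded_le (avg_boundedD Y2 Yh2) _; first exact: measurable_funX.
  apply: aeW => z _; rewrite !ger0_norm ?addr_ge0 ?sqr_ge0// /Ye.
  have := Y_ge0 z; have := Yh_ge0 z; move: (Y z) (Yh z) => y x x0 y0.
  have := mulr_ge0 (mulr_ge0 e0 e1) (sqr_ge0 (x - y)).
  have := mulr_ge0 e0 (sqr_ge0 x); have := mulr_ge0 e1 (sqr_ge0 y); lra.
have agh := avg_bounded_g mYh Yh_ge0 Yh2; have age := avg_bounded_g mYe Ye_ge0 Ye2.
have afo := avg_bounded_fo; have adev := avg_bounded_dev.
near=> T.
have T0 : 0 < T by near: T; exact: nbhs_pinfty_gt.
do 3!eexists; split.
- exact: (mean_payoffE nue_adm T0 age vYe).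
- exact: (mean_payoffE nuh_adm T0 agh vYh).
- exact: (mean_first_orderE T0 nuh_adm nu_adm Yh_ge0 avg_bounded_fo vYh vY).
rewrite control_mean_comb// -/fo.
have H : S T (g \o Yh) - S T (g \o Ye) <= e * S T fo + e ^+ 2 * (2 * p * alpha) * (C * T).
  have : S T (fun z => (g \o Yh) z + (-1) * (g \o Ye) z) <=
      S T (fun z => e * fo z + e ^+ 2 * (2 * p * alpha) * dev z).
    apply: strip_int_le => //.
    - by apply: avg_boundedD => //; exact: avg_boundedZ.
    - by apply: avg_boundedD; exact: avg_boundedZ.
    apply: ae_prodS Yh_gt0 => z /[apply] h0; rewrite /fo -marginalE//=.
    have := g_perturbation lambda alpha_gt0 alpha_lt1 p_gt0 (Y_ge0 z) h0 e_gt0 e_le.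
    by rewrite /dev /u /Ye; lra.
  rewrite (strip_intD T0 agh (avg_boundedZ (-1) age)) (strip_intZ (-1) T0 age).
  rewrite (strip_intD T0 (avg_boundedZ e afo) (avg_boundedZ _ adev)).
  rewrite (strip_intZ e T0 afo) (strip_intZ _ T0 adev) => h.
  have h2 : e ^+ 2 * (2 * p * alpha) * S T dev <= e ^+ 2 * (2 * p * alpha) * (C * T).
    apply: ler_wpM2l; first by rewrite mulr_ge0 ?sqr_ge0 ?mulr_ge0// ltW.
    exact: le_trans (ler_norm _) (devC T T0).
  lra.
have -> : e ^+ 2 * (2 * p * alpha * C) = T^-1 * (e ^+ 2 * (2 * p * alpha) * (C * T)).
  by field; rewrite gt_eqF.
rewrite -mulrBr mulrCA -mulrDr; apply: ler_wpM2l; first by rewrite invr_ge0 ltW.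
rewrite -/Ye; lra.
Unshelve. all: by end_near. Qed.

End two_controls.

End comparison.

(** * Necessary and sufficient first-order conditions *)

Theorem lemma4p3 (d : measure_display) (Omega : measurableType d) (R : realType)
  (P : probability Omega R)
  (F0m : set (set Omega)) (F : R -> set (set Omega))
  (W : R -> Omega -> R) (xi : Omega -> R)
  (delta sigma q alpha : R)
  (X : (R -> Omega -> R) -> (R -> Omega -> R))
  (p lambda : R) (r r' : \bar R) (nuh : R -> Omega -> R)
  (delta_gt0 : 0 < delta) (sigma_gt0 : 0 < sigma) (q_gt0 : 0 < q)
  (alpha_gt0 : 0 < alpha) (alpha_lt1 : alpha < 1)
  (F_usual : usual_filtration P F0m F)
  (W_bm : brownian_motion P F W)
  (xi_meas : measurable_wrt F0m xi)
  (xi_gt0 : {ae P, forall w, 0 < xi w})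
  (xi_indep : independent_algebras P (generated_by xi) (generated_by_process W))
  (delta_sigma : 0 < 2 * delta - sigma ^+ 2)
  (xi_L2 : ('E_P[fun w => (xi w ^+ 2)%R] < +oo)%E)
  (X_sde : forall nu, admissible P F nu ->
     solves_sde P F W xi delta sigma nu (X nu))
  (p_gt0 : 0 < p) (lambda_lt : lambda < q * delta)
  (r_ge1 : (1 <= r)%E) (r'_ge1 : (1 <= r')%E)
  (rr' : (r^-1 + r'^-1 = 1)%E)
  (nuh_A2 : A2 P F X r nuh)
  (nuh_inv : inverse_moment_condition P alpha r' (X nuh)) :
  (optimal_within P q alpha X (A2 P F X r) p lambda nuh ->
     forall nu, A2 P F X r nu ->
       (0 <= limf_esup (mean_first_order P q alpha X p lambda nuh nu)
               (pinfty_nbhs R))%E)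
  /\
  ( ((forall nu, A2 P F X r nu ->
        (0 <= limf_esup (mean_first_order P q alpha X p lambda nuh nu)
                (pinfty_nbhs R))%E)
     /\ cvg (mean_payoff P q alpha X p lambda nuh T @[T --> pinfty_nbhs R]))
    \/
    (forall nu, A2 P F X r nu ->
        (0 <= limf_einf (mean_first_order P q alpha X p lambda nuh nu)
                (pinfty_nbhs R))%E)
    -> optimal_within P q alpha X (A2 P F X r) p lambda nuh ).
Proof.
have P_complete := usual_complete F_usual.
have m_xi : measurable_fun setT xi.
  apply: (measurable_wrtW _ xi_meas).
  exact: subset_trans (uf_incr0m F_usual) (uf_sub F_usual (lexx 0)).
have data nu : A2 P F X r nu -> exists Y : measurableTypeR R * Omega -> R,
    [/\ measurable_fun setT Y, forall z, 0 <= Y z, version P Y (X nu),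
        {ae (lebesgue_measure \x P)%E, forall z, 0 <= z.1 -> 0 < Y z} &
        moment_fun P r Y].
  move=> [nu_adm nu_mom].
  have [Y [mY Y0 YX Ypos]] := state_version F_usual W_bm m_xi nu_adm (X_sde _ nu_adm) xi_gt0.
  have vY : version P Y (X nu) by apply: filterS YX => w h t t0; rewrite h.
  by exists Y; split => //; exact/(moment_conditionE P_complete r mY Y0 vY).
have [nuh_adm _] := nuh_A2; have [Yh [mYh Yh0 vYh Yhpos Yhmom]] := data _ nuh_A2.
have iu := inverse_moment_conditionE P_complete mYh vYh nuh_inv.
have mu_ : measurable_fun setT (fun z => Yh z `^ (alpha - 2)).
  exact: (measurableT_comp (measurable_powR _)).
have uAB (Y : measurableTypeR R * Omega -> R) (mY : measurable_fun setT Y) 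
    (Y0 : forall z, 0 <= Y z) (Ymom : moment_fun P r Y) :=
  conjugate_avg_bounded r_ge1 r'_ge1 rr' mu_ (fun z => powR_ge0 (Yh z) _) mY Y0 iu Ymom.
have Yh2 := moment_fun_sqr mYh Yh0 r_ge1 Yhmom; have uYh2 := uAB _ mYh Yh0 Yhmom.
have upper nu : A2 P F X r nu ->
    \forall T \near pinfty_nbhs R, exists a b f : R,
    [/\ mean_payoff P q alpha X p lambda nu T = a%:E,
        mean_payoff P q alpha X p lambda nuh T = b%:E,
        mean_first_order P q alpha X p lambda nuh nu T = f%:E & f <= b - a].
  move=> nuA; have [nu_adm _] := nuA; have [Y [mY Y0 vY Ypos Ymom]] := data _ nuA.
  exact: (first_order_upper q lambda F_usual alpha_gt0 alpha_lt1 p_gt0 nuh_adm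
    nu_adm mYh mY Yh0 Y0 vYh vY Yhpos Yh2 (moment_fun_sqr mY Y0 r_ge1 Ymom)
    uYh2 (uAB _ mY Y0 Ymom)).
split; last first.
  move=> H; split => // nu nuA; case: H => [[FO0 cB]|FO0].
    by apply: (limf_einf_le_of_cvg cB (FO0 _ nuA)); exact: upper.
  by apply: (limf_einf_le_of_einf (FO0 _ nuA)); exact: upper.
move=> [_ opt] nu nuA.
have [nu_adm _] := nuA; have [Y [mY Y0 vY Ypos Ymom]] := data _ nuA.
have Y2 := moment_fun_sqr mY Y0 r_ge1 Ymom; have uY2 := uAB _ mY Y0 Ymom.
have [C C0 devC] := strip_int_abs (avg_bounded_dev mYh mY uYh2 uY2).
have agh := avg_bounded_g lambda alpha_gt0 alpha_lt1 p_gt0 mYh Yh0 Yh2.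
have [Cg Cg0 ghC] := strip_int_abs agh.
have [D nuhD] : exists D : R, forall T : R, 1 <= T ->
    (\int[P]_w (nuh T w)%:E <= (D * T)%:E)%E.
  have [_ [C2 C20 hC2]] := Yh2.
  have YX : {ae P, forall w, forall t, 0 <= t -> Yh (t, w) = X nuh t w}.
    by apply: filterS vYh => w h t t0; rewrite h.
  apply: (control_growth F_usual W_bm nuh_adm (X_sde _ nuh_adm) mYh YX delta_gt0
    sigma_gt0 xi_gt0 Yh0 C20).
  move=> T T0; apply: le_trans (hC2 T T0); rewrite le_eqVlt; apply/orP; left.
  by apply/eqP; apply: eq_integral => z _; rewrite ger0_norm ?sqr_ge0.
pose nue (e : R) : R -> Omega -> R := fun t w => e * nu t w + (1 - e) * nuh t w.
have comb (e : R) : 0 < e -> e <= 1 / 2 -> admissible P F (nue e) /\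
    version P (fun z => e * Y z + (1 - e) * Yh z) (X (nue e)).
  move=> e0 e2; have e1 : 0 <= 1 - e by lra.
  have nue_adm := admissible_comb F_usual (ltW e0) e1 nu_adm nuh_adm.
  split => //.
  have ab : e + (1 - e) = 1 by rewrite addrC subrK.
  have := state_affine F_usual W_bm m_xi nu_adm nuh_adm nue_adm (X_sde _ nu_adm)
    (X_sde _ nuh_adm) (X_sde _ nue_adm) ab (fun _ _ => erefl).
  move=> aff; apply: filterS2 aff (ae_and vY vYh) => w h [h1 h2] t t0.
  by rewrite h// h1// h2.
apply: (@limf_esup_ge0_of_perturbation _ _ _ (mean_payoff P q alpha X p lambda nuh) _
  (fun e => mean_payoff P q alpha X p lambda (nue e)) (2 * p * alpha * C) (Cg + q * D)).
- by rewrite !mulr_ge0// ltW.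
- move=> e e0 e2; apply: opt; have [nue_adm vYe] := comb e e0 e2; split => //.
  have mYe : measurable_fun setT (fun z => e * Y z + (1 - e) * Yh z).
    by apply: measurable_funD; exact: measurable_funM.
  have e1 : 0 <= 1 - e by lra.
  have Ye0 z : 0 <= e * Y z + (1 - e) * Yh z.
    by rewrite addr_ge0// mulr_ge0// ltW.
  apply/(moment_conditionE P_complete r mYe Ye0 vYe).
  apply: (moment_fun_max mYe _ r_ge1 Ymom Yhmom) => z; rewrite Ye0/=.
  have h1 : e * Y z <= e * Num.max (Y z) (Yh z).
    by apply: ler_wpM2l; [exact: ltW|rewrite le_max lexx].
  have h2 : (1 - e) * Yh z <= (1 - e) * Num.max (Y z) (Yh z).
    by apply: ler_wpM2l => //; rewrite le_max lexx orbT.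
  lra.
- move=> e e0 e2; have [nue_adm vYe] := comb e e0 e2.
  exact: (first_order_lower q lambda F_usual alpha_gt0 alpha_lt1 p_gt0 nuh_adm
    nu_adm mYh mY Yh0 Y0 vYh vY Yhpos Yh2 Y2 uYh2 uY2 e0 e2 nue_adm
    (fun _ _ => erefl) vYe devC).
near=> T.
have T1 : 1 <= T by near: T; apply: nbhs_pinfty_ge; exact: num_real.
have T0 : 0 < T by lra.
rewrite (mean_payoffE q F_usual nuh_adm T0 agh vYh) abse_EFin lee_fin.
have m0 := control_mean_ge0 F_usual nuh_adm T0.
have mD : fine 'E_P[nuh T] <= D * T.
  rewrite -lee_fin fineK; first by rewrite unlock; exact: nuhD.
  rewrite unlock; exact: (integrable_fin_num measurableT (control_integrable F_usual nuh_adm T0)).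
rewrite normrM gtr0_norm ?invr_gt0// ler_pdivrMl//.
apply: le_trans (ler_normB _ _) _; rewrite [leRHS]mulrC mulrDl.
apply: lerD; first exact: ghC.
by rewrite ger0_norm ?mulr_ge0 ?(ltW q_gt0)// -mulrA ler_pM2l.
Unshelve. all: by end_near. Qed.
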